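(* Let $f:\Omega\subseteq\mathbb{R}^4\to\mathbb{R}_3$ be (the restriction of) a slice-regular function, where $\Omega=\Omega_D\cap\mathbb{R}^4$ is open in $\mathbb{R}^4$. Then: (a) The spherical derivative $f'_s$ is harmonic on $\Omega$, i.e. its eight real components are harmonic functions. (b) $\overline\partial\Delta_4f=\Delta_4\overline\partial f=-2\Delta_4f'_s=0$. (c) $\Delta_4^2f=0$, i.e. every slice-regular function on $\mathbb{R}_3$ is biharmonic on $\Omega$. (d) $\Delta_4f=-4\,\dfrac{\partial f'_s}{\partial x}$. Therefore also $\dfrac{\partial f'_s}{\partial x}$ is harmonic on $\Omega$.
   Context: $\mathbb{R}_3$ is the real Clifford algebra generated by $e_1,e_2,e_3$ with $e_ie_j+e_je_i=-2\delta_{ij}$ (real dimension 8); $x\mapsto x^c$ (Clifford conjugation) is the unique linear antiinvolution with $e_i^c=-e_i$. The paravector space $\{x_0+x_1e_1+x_2e_2+x_3e_3\}$ is identified with $\mathbb{R}^4$; $\Delta_4=\sum_{i=0}^3\partial^2/\partial x_i^2$ and $\overline\partial=\frac{\partial}{\partial x_0}+\sum_{i=1}^3e_i\frac{\partial}{\partial x_i}$. Let $\mathbb{S}_{\mathbb{R}_3}=\{J\in\mathbb{R}_3: J+J^c=0,\ JJ^c=1\}$, $\mathbb{C}_J=\langle1,J\rangle$, and let $\mathcal{Q}_{\mathbb{R}_3}=\bigcup_{J\in\mathbb{S}_{\mathbb{R}_3}}\mathbb{C}_J$ be the quadratic cone, which contains $\mathbb{R}^4$. For $x\in\mathcal{Q}_{\mathbb{R}_3}$,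 $\operatorname{Im}(x)=\frac{x-x^c}{2}$. For $D\subseteq\mathbb{C}$ conjugation-invariant, $\Omega_D=\{\alpha+J\beta:\alpha+i\beta\in D,\ J\in\mathbb{S}_{\mathbb{R}_3}\}$. A stem function on $D$ is a map $F=F_1+\imath F_2:D\to\mathbb{R}_3\otimes_{\mathbb{R}}\mathbb{C}$ ($F_1,F_2$ being $\mathbb{R}_3$-valued, $\imath^2=-1$) with $F(\overline z)=\overline{F(z)}$, where $\overline{a+\imath b}=a-\imath b$. It induces the (left) slice function $f=\mathcal{I}(F):\Omega_D\to\mathbb{R}_3$, $f(\alpha+J\beta)=F_1(\alpha+i\beta)+JF_2(\alpha+i\beta)$; $f$ is slice-regular if $F$ is holomorphic (with respect to the complex structure given by $\imath$). The same symbol denotes the restriction of $f$ to $\Omega$. The spherical derivative of $f$ is $f'_s(x)=\frac12\operatorname{Im}(x)^{-1}(f(x)-f(x^c))$ for $x\notin\mathbb{R}$; it is a slice function (induced by $\beta^{-1}F_2(\alpha,\beta)$), and for $f$ slice-regular it extends real-analytically to the real points of $\Omega$. The slice derivative of a slice function $g=\mathcal{I}(G)$ of class $\mathcal{C}^1$ is $\frac{\partial g}{\partial x}=\mathcal{I}\left(\frac{\partial G}{\partial z}\right)$ with $\frac{\partial}{\partial z}=\frac12\left(\frac{\partial}{\partial\alpha}-\imath\frac{\partial}{\partial\beta}\right)$. *)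

(* Defs.v *)
From HB Require Import structures.
From mathcomp Require Import all_boot all_order all_algebra.
From mathcomp Require Import all_classical all_reals all_analysis.

Set Implicit Arguments.
Unset Strict Implicit.
Unset Printing Implicit Defensive.

Import Order.TTheory GRing.Theory Num.Theory.
Import numFieldNormedType.Exports.
Local Open Scope classical_set_scope.
Local Open Scope ring_scope.

(** * The real Clifford algebra with three generators of square -1

  The basis element [e_A], for A a subset of {1,2,3}, is the coordinate vector
  whose index has the characteristic function of A as binary expansion (bit i
  stands for the generator e_(i+1)).  Thus the coordinates are, in order,
  those of 1, e1, e2, e1e2, e3, e1e3, e2e3, e1e2e3.  Sorting the generators of
  [e_A * e_B] costs one sign for each pair (i in A, j in B) with j < i, and
  each i in both A and B contributes [e_i * e_i = -1]; what remains is [e_C]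
  with C the symmetric difference of A and B. *)

Definition blade_xor (A B : 'I_8) : 'I_8 := inord (Nat.lxor A B).

Definition blade_swaps (A B : nat) : nat :=
  count (fun ij => [&& Nat.testbit A ij.1, Nat.testbit B ij.2 & ij.2 <= ij.1]%N)
    [seq (i, j) | i <- iota 0 3, j <- iota 0 3].

Definition blade_size (A : nat) : nat := count (Nat.testbit A) (iota 0 3).

Definition clifford3 (R : realType) : Type := 'rV[R]_8.

HB.instance Definition _ (R : realType) :=
  NormedModule.copy (clifford3 R) 'rV[R]_8.

Section CliffordRing.
Variable R : realType.
Implicit Types x y z : clifford3 R.

Definition cl_one : clifford3 R := delta_mx 0 0.

Definition cl_mul x y : clifford3 R :=
  \row_C \sum_(A < 8) (-1) ^+ blade_swaps A (blade_xor A C) *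
                      (x 0 A * y 0 (blade_xor A C)).

Lemma lxor_lt8 (A B : 'I_8) : (Nat.lxor A B < 8)%N.
Proof.
have H : all (fun a => all (fun b => Nat.lxor a b < 8)%N (iota 0 8)) (iota 0 8).
  by vm_compute.
by apply: (allP (allP H A _) B); rewrite mem_iota /= ltn_ord.
Qed.

Lemma blade_xorE (A B : 'I_8) : blade_xor A B = Nat.lxor A B :> nat.
Proof. by rewrite /blade_xor inordK // lxor_lt8. Qed.

Lemma forall_blade (P : nat -> bool) : all P (iota 0 8) -> forall A : 'I_8, P A.
Proof. by move=> H A; apply: (allP H); rewrite mem_iota /= ltn_ord. Qed.

Lemma blade_xorC (A B : 'I_8) : blade_xor A B = blade_xor B A.
Proof.
apply/val_inj; rewrite /= !blade_xorE; apply/eqP.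
have H : all (fun a => all (fun b => Nat.lxor a b == Nat.lxor b a) (iota 0 8))
  (iota 0 8) by vm_compute.
exact: (forall_blade (forall_blade H A)).
Qed.

Lemma blade_xorA (A B C : 'I_8) :
  blade_xor A (blade_xor B C) = blade_xor (blade_xor A B) C.
Proof.
apply/val_inj; rewrite /= !blade_xorE; apply/eqP.
have H : all (fun a => all (fun b => all (fun c =>
    Nat.lxor a (Nat.lxor b c) == Nat.lxor (Nat.lxor a b) c)
  (iota 0 8)) (iota 0 8)) (iota 0 8) by vm_compute.
exact: (forall_blade (forall_blade (forall_blade H A) B)).
Qed.

Lemma blade_xorr0 (A : 'I_8) : blade_xor A 0 = A.
Proof.
apply/val_inj; rewrite /= !blade_xorE; apply/eqP.
have H : all (fun a => Nat.lxor a 0 == a) (iota 0 8) by vm_compute.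
exact: (forall_blade H).
Qed.

Lemma blade_xorxx (A : 'I_8) : blade_xor A A = 0.
Proof.
apply/val_inj; rewrite /= !blade_xorE; apply/eqP.
have H : all (fun a => Nat.lxor a a == 0%N) (iota 0 8) by vm_compute.
exact: (forall_blade H).
Qed.

Lemma blade_xorK (A : 'I_8) : involutive (blade_xor A).
Proof. by move=> B; rewrite blade_xorA blade_xorxx blade_xorC blade_xorr0. Qed.

Lemma blade_swaps0l (A : 'I_8) : blade_swaps 0 A = 0%N.
Proof.
apply/eqP; have H : all (fun a => blade_swaps 0 a == 0%N) (iota 0 8).
  by vm_compute.
exact: (forall_blade H).
Qed.

Lemma blade_swaps0r (A : 'I_8) : blade_swaps A 0 = 0%N.
Proof.
apply/eqP; have H : all (fun a => blade_swaps a 0 == 0%N) (iota 0 8).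
  by vm_compute.
exact: (forall_blade H).
Qed.

Lemma blade_cocycle (A B C : 'I_8) :
  odd (blade_swaps A B + blade_swaps (blade_xor A B) C) =
  odd (blade_swaps A (blade_xor B C) + blade_swaps B C).
Proof.
rewrite !blade_xorE; apply/eqP.
have H : all (fun a => all (fun b => all (fun c =>
    odd (blade_swaps a b + blade_swaps (Nat.lxor a b) c) ==
    odd (blade_swaps a (Nat.lxor b c) + blade_swaps b c))
  (iota 0 8)) (iota 0 8)) (iota 0 8) by vm_compute.
exact: (forall_blade (forall_blade (forall_blade H A) B)).
Qed.

Lemma cl_mulA : associative cl_mul.
Proof.
move=> x y z; apply/rowP => C; rewrite !mxE.
under eq_bigr do rewrite mxE !big_distrr /=.
under [RHS]eq_bigr do rewrite mxE big_distrl big_distrr /=.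
rewrite [RHS]exchange_big /=; apply: eq_bigr => A _.
rewrite [RHS](reindex_inj (inv_inj (@blade_xorK A))) /=.
apply: eq_bigr => B _; rewrite blade_xorK.
have -> : blade_xor (blade_xor A B) C = blade_xor B (blade_xor A C).
  by rewrite blade_xorA (blade_xorC B).
set E := blade_xor B (blade_xor A C).
have -> : blade_xor A C = blade_xor B E by rewrite /E blade_xorK.
have S : (-1) ^+ blade_swaps (blade_xor A B) E * (-1) ^+ blade_swaps A B =
  (-1) ^+ blade_swaps A (blade_xor B E) * (-1) ^+ blade_swaps B E :> R.
  by rewrite -!exprD -signr_odd addnC blade_cocycle signr_odd.
rewrite !mulrA S -!mulrA; congr (_ * _); exact: mulrCA.
Qed.

Lemma cl_mul1l : left_id cl_one cl_mul.
Proof.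
move=> x; apply/rowP => C; rewrite mxE (bigD1 0) //= big1 ?addr0.
  by rewrite blade_swaps0l mxE eqxx !mul1r blade_xorC blade_xorr0.
by move=> A /negbTE nA; rewrite mxE nA andbF mul0r mulr0.
Qed.

Lemma cl_mul1r : right_id cl_one cl_mul.
Proof.
move=> x; apply/rowP => C; rewrite mxE (bigD1 C) //= big1 ?addr0.
  by rewrite blade_xorxx blade_swaps0r mxE eqxx mul1r mulr1.
move=> A nA; rewrite [cl_one _ _]mxE eqxx /=; case: eqP; last by rewrite mulr0 mulr0.
move=> AC; case/eqP: nA.
by apply: (can_inj (blade_xorK A)); rewrite blade_xorxx AC.
Qed.

Lemma cl_mulDl : left_distributive cl_mul +%R.
Proof.
move=> x y z; apply/rowP => C; rewrite !mxE -big_split /=.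
by apply: eq_bigr => A _; rewrite mxE mulrDl mulrDr.
Qed.

Lemma cl_mulDr : right_distributive cl_mul +%R.
Proof.
move=> x y z; apply/rowP => C; rewrite !mxE -big_split /=.
by apply: eq_bigr => A _; rewrite mxE !mulrDr.
Qed.

Lemma cl_one_neq0 : cl_one != 0.
Proof. by apply/eqP => /rowP /(_ 0); rewrite !mxE => /eqP; rewrite oner_eq0. Qed.

HB.instance Definition _ := GRing.Zmodule_isNzRing.Build (clifford3 R)
  cl_mulA cl_mul1l cl_mul1r cl_mulDl cl_mulDr cl_one_neq0.

Lemma cl_scalerAl (a : R) x y : a *: (x * y) = (a *: x) * y.
Proof.
apply/rowP => C; rewrite !mxE big_distrr /=.
by apply: eq_bigr => A _; rewrite mxE mulrCA !mulrA.
Qed.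

Lemma cl_scalerAr (a : R) x y : a *: (x * y) = x * (a *: y).
Proof.
apply/rowP => C; rewrite !mxE big_distrr /=.
by apply: eq_bigr => A _; rewrite mxE mulrCA (mulrCA a).
Qed.

HB.instance Definition _ :=
  GRing.Lmodule_isLalgebra.Build R (clifford3 R) cl_scalerAl.
HB.instance Definition _ :=
  GRing.Lalgebra_isAlgebra.Build R (clifford3 R) cl_scalerAr.

Definition cl_unit : {pred clifford3 R} :=
  fun x => `[< exists y, y * x = 1 /\ x * y = 1 >].

Definition cl_inv x : clifford3 R :=
  if x \in cl_unit then xget x [set y | y * x = 1 /\ x * y = 1] else x.

Lemma cl_invP x : x \in cl_unit -> cl_inv x * x = 1 /\ x * cl_inv x = 1.
Proof.
move=> ux; rewrite /cl_inv ux; move/asboolP: ux => ex.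
exact: (@xgetPex _ x [set y | y * x = 1 /\ x * y = 1] ex).
Qed.

Fact cl_mulVr : {in cl_unit, left_inverse 1 cl_inv *%R}.
Proof. by move=> x /cl_invP[]. Qed.

Fact cl_mulrV : {in cl_unit, right_inverse 1 cl_inv *%R}.
Proof. by move=> x /cl_invP[]. Qed.

Fact cl_unitP x y : y * x = 1 /\ x * y = 1 -> x \in cl_unit.
Proof. by move=> yx; apply/asboolP; exists y. Qed.

Fact cl_inv_out : {in [predC cl_unit], cl_inv =1 id}.
Proof. by move=> x /negbTE nx; rewrite /cl_inv nx. Qed.

HB.instance Definition _ := GRing.NzRing_hasMulInverse.Build (clifford3 R)
  cl_mulVr cl_mulrV cl_unitP cl_inv_out.

Definition cl_gen (i : 'I_3) : clifford3 R := delta_mx 0 (inord (2 ^ i)%N).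

(** Clifford conjugation of [e_A], with k the size of A: reversing the product
  costs the sign of exponent k(k-1)/2, changing the signs of all the
  generators the sign of exponent k. *)
Definition cl_conj x : clifford3 R :=
  \row_A ((-1) ^+ 'C((blade_size A).+1, 2) * x 0 A).

Lemma blade_mul (A B : 'I_8) :
  (delta_mx 0 A : clifford3 R) * delta_mx 0 B =
  (-1) ^+ blade_swaps A B *: delta_mx 0 (blade_xor A B).
Proof.
apply/rowP => C; rewrite mxE (bigD1 A) //= big1 ?addr0; last first.
  by move=> D /negbTE nD; rewrite mxE nD andbF mul0r mulr0.
rewrite !mxE !eqxx /= mul1r.
have -> : (blade_xor A C == B) = (C == blade_xor A B).
  by apply/eqP/eqP => [<-|->]; rewrite blade_xorK.
by case: eqP => [->|_]; rewrite ?blade_xorK ?mulr0.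
Qed.

Lemma val_cl_gen (i : 'I_3) : (inord (2 ^ i)%N : 'I_8) = (2 ^ i)%N :> nat.
Proof. by rewrite inordK //; case: i => [[|[|[]]]]. Qed.

Lemma cl_gen_anticomm (i j : 'I_3) :
  cl_gen i * cl_gen j + cl_gen j * cl_gen i = - 2 * (i == j)%:R.
Proof.
rewrite /cl_gen !blade_mul; case: eqP => [->|/eqP nij].
  rewrite blade_xorxx val_cl_gen.
  have -> : blade_swaps (2 ^ j)%N (2 ^ j)%N = 1%N by case: j => [[|[|[]]]].
  by rewrite expr1 scaleN1r mulr1 -opprD; congr (- _).
rewrite mulr0 (blade_xorC (inord (2 ^ j)%N)) !val_cl_gen -scalerDl.
have S : odd (blade_swaps (2 ^ i)%N (2 ^ j)%N) =
  ~~ odd (blade_swaps (2 ^ j)%N (2 ^ i)%N).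
  by case: i j nij => [[|[|[|//]]] ?] [[|[|[|//]]] ?].
rewrite -signr_odd S -[X in _ + X]signr_odd; case: (odd _).
  by rewrite subrr scale0r.
by rewrite addNr scale0r.
Qed.

Lemma cl_conjD x y : cl_conj (x + y) = cl_conj x + cl_conj y.
Proof. by apply/rowP => A; rewrite !mxE mulrDr. Qed.

Lemma cl_conjZ (a : R) x : cl_conj (a *: x) = a *: cl_conj x.
Proof. by apply/rowP => A; rewrite !mxE mulrCA. Qed.

Lemma cl_conjK : involutive cl_conj.
Proof. by move=> x; apply/rowP => A; rewrite !mxE signrMK. Qed.

Lemma cl_conj_gen (i : 'I_3) : cl_conj (cl_gen i) = - cl_gen i.
Proof.
apply/rowP => A; rewrite !mxE /=; case: eqP => [->|_]; last by rewrite mulr0 oppr0.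
by rewrite val_cl_gen; case: i => [[|[|[|//]]] ?]; rewrite expr1 mulN1r.
Qed.

Lemma blade_conj_cocycle (A C : 'I_8) :
  odd ('C((blade_size C).+1, 2) + blade_swaps A (blade_xor A C)) =
  odd (blade_swaps (blade_xor A C) A +
       ('C((blade_size (blade_xor A C)).+1, 2) + 'C((blade_size A).+1, 2))).
Proof.
rewrite !blade_xorE; apply/eqP.
have H : all (fun a => all (fun c =>
    odd ('C((blade_size c).+1, 2) + blade_swaps a (Nat.lxor a c)) ==
    odd (blade_swaps (Nat.lxor a c) a +
         ('C((blade_size (Nat.lxor a c)).+1, 2) + 'C((blade_size a).+1, 2))))
  (iota 0 8)) (iota 0 8) by vm_compute.
exact: (forall_blade (forall_blade H A)).
Qed.

Lemma cl_conjM x y : cl_conj (x * y) = cl_conj y * cl_conj x.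
Proof.
apply/rowP => C; rewrite !mxE big_distrr /=.
rewrite [RHS](reindex_inj (inv_inj (@blade_xorK C))) /=.
apply: eq_bigr => A _; rewrite (blade_xorC C A).
have -> : blade_xor (blade_xor A C) C = A.
  by rewrite -blade_xorA blade_xorxx blade_xorr0.
rewrite !mxE.
have S : (-1) ^+ 'C((blade_size C).+1, 2) * (-1) ^+ blade_swaps A (blade_xor A C) =
  (-1) ^+ blade_swaps (blade_xor A C) A *
  ((-1) ^+ 'C((blade_size (blade_xor A C)).+1, 2) *
   (-1) ^+ 'C((blade_size A).+1, 2)) :> R.
  by rewrite -!exprD -signr_odd blade_conj_cocycle signr_odd.
rewrite mulrA S [x 0 A * _]mulrC -!mulrA; congr (_ * (_ * _)).
by rewrite mulrCA.
Qed.

End CliffordRing.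

(** * Differential operators on open subsets of a normed space *)

(** Class [C^k], for a function between normed spaces, the first one of finite
  dimension, on an open set [U]. *)
Fixpoint class_C (R : realType) (V W : normedModType R) (k : nat) (U : set V)
    (g : V -> W) : Prop :=
  if k is k'.+1 then
    (forall x v, U x -> derivable g x v) /\ (forall v, class_C k' U ('D_v g))
  else forall x, U x -> {for x, continuous g}.

Definition laplacian (R : realType) (n : nat) (W : normedModType R)
    (g : 'rV[R]_n -> W) (x : 'rV[R]_n) : W :=
  \sum_(i < n) 'D_(delta_mx 0 i) ('D_(delta_mx 0 i) g) x.

Definition harmonic (R : realType) (n : nat) (U : set 'rV[R]_n)
    (u : 'rV[R]_n -> R) : Prop :=
  class_C 2 U u /\ forall x, U x -> laplacian u x = 0.

Section Clifford.
Variable R : realType.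
Local Notation cl3 := (clifford3 R).

Definition paravector (x : 'rV[R]_4) : cl3 :=
  (x 0 0)%:A + \sum_(i < 3) x 0 (lift ord0 i) *: cl_gen R i.

Definition dbar (g : 'rV[R]_4 -> cl3) (x : 'rV[R]_4) : cl3 :=
  'D_(delta_mx 0 0) g x +
  \sum_(i < 3) cl_gen R i * 'D_(delta_mx 0 (lift ord0 i)) g x.

Definition cl_harmonic (U : set 'rV[R]_4) (g : 'rV[R]_4 -> cl3) : Prop :=
  forall A : 'I_8, harmonic U (fun x => g x 0 A).

Definition cl_biharmonic (U : set 'rV[R]_4) (g : 'rV[R]_4 -> cl3) : Prop :=
  class_C 4 U g /\ forall x, U x -> laplacian (laplacian g) x = 0.

(** * Slice functions

  The complexification of a real vector space [V] is [V * V], the pair [(a, b)]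
  being a + i b; this covers both C (with [V := R]) and the values of stem
  functions (with [V := cl3]). *)

Definition cconj (V : zmodType) (w : V * V) : V * V := (w.1, - w.2).
Definition imul (V : zmodType) (w : V * V) : V * V := (- w.2, w.1).

Definition imag_units : set cl3 :=
  [set J | J + cl_conj J = 0 /\ J * cl_conj J = 1].

Definition conj_invariant (D : set (R * R)) : Prop :=
  forall z, D z -> D (cconj z).

Definition circularization (D : set (R * R)) : set cl3 :=
  [set x | exists z J, [/\ D z, imag_units J & x = z.1%:A + z.2 *: J]].

Definition stem (D : set (R * R)) (F : R * R -> cl3 * cl3) : Prop :=
  forall z, D z -> F (cconj z) = cconj (F z).

(** [f] is, on the circularization of [D], the slice function induced by [F]. *)
Definition induces (D : set (R * R)) (F : R * R -> cl3 * cl3)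
    (f : cl3 -> cl3) : Prop :=
  forall z J, D z -> imag_units J ->
    f (z.1%:A + z.2 *: J) = (F z).1 + J * (F z).2.

(** Complex differentiability: the real differential is C-linear. *)
Definition holomorphic (D : set (R * R)) (F : R * R -> cl3 * cl3) : Prop :=
  forall z, D z ->
    differentiable F z /\ forall h, 'd F z (imul h) = imul ('d F z h).

Definition slice_regular (D : set (R * R)) (f : cl3 -> cl3) : Prop :=
  exists F, [/\ stem D F, holomorphic D F & induces D F f].

Definition cl_im (x : cl3) : cl3 := 2^-1 *: (x - cl_conj x).

Definition cl_real : set cl3 := range (fun a : R => a%:A).

Definition spherical_quotient (f : cl3 -> cl3) (x : cl3) : cl3 :=
  2^-1 *: ((cl_im x)^-1 * (f x - f (cl_conj x))).

(** The value at a real point is the one of the continuous extension. *)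
Definition spherical_derivative (D : set (R * R)) (f : cl3 -> cl3) (x : cl3) :
    cl3 :=
  if x \in cl_real then
    lim (spherical_quotient f @ within (circularization D `\` cl_real) (nbhs x))
  else spherical_quotient f x.

Definition stem_dz (G : R * R -> cl3 * cl3) (z : R * R) : cl3 * cl3 :=
  2^-1 *: ('D_(1, 0) G z - imul ('D_(0, 1) G z)).

(** [g] is a slice function of class C^1 on the circularization of [D], and [h]
  is its slice derivative there. *)
Definition is_slice_derivative (D : set (R * R)) (g h : cl3 -> cl3) : Prop :=
  exists G, [/\ stem D G, class_C 1 D G, induces D G g & induces D (stem_dz G) h].

End Clifford.

(* Main.v *)
From HB Require Import structures.
Require Import Defs.
From mathcomp Require Import all_boot all_order all_algebra.
From mathcomp Require Import all_classical all_reals all_analysis.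
From mathcomp Require Import ring lra.

Set Implicit Arguments.
Unset Strict Implicit.
Unset Printing Implicit Defensive.

Import Order.TTheory GRing.Theory Num.Theory.
Import numFieldNormedType.Exports.
Local Open Scope classical_set_scope.
Local Open Scope ring_scope.

(** The restriction of [f] to R^4 is an axial object.  Write a paravector as
  [x = a + b I], with [b] the length of its vector part and [I] an imaginary
  unit, and let [F = F1 + i F2] be the stem function of [f].  Then
  [f x = P0 x + vpart x * Q0 x], where [P0 = F1] and [Q0 = F2 / b] are
  functions of [(a, b)] alone and [Q0] is the spherical derivative.  Let [Pn]
  and [Qn] be the same two functions for the n-th complex derivative of [F].
  The Cauchy-Riemann equations say that, away from the real axis,

    d/da Pn = P(n+1),   b^-1 d/db Pn = - Q(n+1),
    d/da Qn = Q(n+1),   b^-1 d/db Qn = Zn  with  b^2 Zn = P(n+1) - Qn,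

  and every identity of the theorem becomes algebra in the [Pn], [Qn], [Zn],
  because the operators act on axial functions through [d/da] and [b^-1 d/db]
  ([laplacian_jet], [laplacian_vpart_jet], [dbar_jet], [dbar_vpart_jet]): the
  Laplacian kills [Qn] and [vpart * Zn], [dbar f = - 2 Q0], and
  [laplacian f = - 2 Q1 + 2 vpart * Z0].  The last expression is [- 4] times
  half of [d/da Q0 - I d/db Q0], the slice derivative of [Q0]
  ([laplacian_slice4_slice_derivative]).

  This computation needs more regularity than the hypotheses display.

  Differentiability of every order.  The stem function is only supposed to be
  complex differentiable.  Goursat's bisection argument ([goursat]), applied to
  a closed form in polar coordinates, expresses the derivative at a point by an
  integral over a circle of fixed radius ([circle_formula]); differentiating
  under the integral sign shows that the derivative is again holomorphic
  ([CR_derivative]), hence the whole tower of derivatives exists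
  ([CR_iterated_derivatives]).

  The real axis.  Neither [b] nor the quotient [F2 / b] is manifestly
  differentiable at [b = 0].  Since [F2] is odd in [b], the quotient is the
  average over [0 <= t <= 1] of the derivative of [F] at [(a, t b)].  The
  averages with weights [t^m] form, together with the even functions of the
  tower, a family whose b-derivatives are [b] times members of the family
  ([axis_avg_odd], [axis_avg_parts]); such functions of [(a, b)] are
  differentiable on R^4 even on the axis ([is_derive_meridian]), so the whole
  family is smooth there ([smooth_axial]).  Identities proved off the axis then
  extend to it by continuity ([off_axis_dense]).

  Finally the spherical derivative at a real point, a limit over the quadratic
  cone, is the value of the continuous function [Q0]
  ([spherical_derivative_slice]). *)

(** * Integrals over a segment *)

Section SegmentIntegral.
Variable R : realType.
Local Notation mu := (@lebesgue_measure R).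
Implicit Types (a b c : R) (f g : R -> R).

(** Two-sided continuity at the points of the segment, end points included:
  the functions integrated below are continuous on a neighbourhood, and this
  form composes without subspace topologies. *)
Definition cont_on a b f := forall t, a <= t <= b -> {for t, continuous f}.

Definition seg_int a b f : R := (\int[mu]_(t in `[a, b]) f t)%R.

Lemma cont_on_integrable a b f :
  cont_on a b f -> mu.-integrable `[a, b] (EFin \o f).
Proof.
move=> cf; apply: continuous_compact_integrable; first exact: segment_compact.
by apply/continuous_in_subspaceT => t; rewrite inE /= in_itv /= => /cf.
Qed.

Lemma eq_seg_int a b f g :
  (forall t, a <= t <= b -> f t = g t) -> seg_int a b f = seg_int a b g.
Proof. by move=> fg; apply: eq_Rintegral => t; rewrite inE /= in_itv /= => /fg. Qed.

Lemma seg_intD a b f g : cont_on a b f -> cont_on a b g ->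
  seg_int a b (fun t => f t + g t) = seg_int a b f + seg_int a b g.
Proof. by move=> cf cg; apply: RintegralD => //; exact: cont_on_integrable. Qed.

Lemma seg_intB a b f g : cont_on a b f -> cont_on a b g ->
  seg_int a b (fun t => f t - g t) = seg_int a b f - seg_int a b g.
Proof. by move=> cf cg; apply: RintegralB => //; exact: cont_on_integrable. Qed.

Lemma seg_intZ a b k f : cont_on a b f ->
  seg_int a b (fun t => k * f t) = k * seg_int a b f.
Proof. by move=> cf; apply: RintegralZl => //; exact: cont_on_integrable. Qed.

Lemma seg_int_cst a b k : a <= b -> seg_int a b (fun=> k) = k * (b - a).
Proof.
move=> ab; rewrite /seg_int Rintegral_cst//= lebesgue_measure_itv /= lte_fin.
case: ltgtP ab => // -> _.
by rewrite subrr.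
Qed.

Lemma seg_int_le a b f k : a <= b -> cont_on a b f ->
  (forall t, a <= t <= b -> `|f t| <= k) -> `|seg_int a b f| <= k * (b - a).
Proof.
move=> ab cf fk; rewrite -seg_int_cst//.
apply: (le_trans (le_normr_Rintegral _ (cont_on_integrable cf))) => //.
apply: le_Rintegral => //.
- apply: (@cont_on_integrable _ _ (fun t => `|f t|)) => t /cf ct.
  exact: continuous_comp ct (@norm_continuous _ _ _).
- by apply: cont_on_integrable => t _; exact: cst_continuous.
Qed.

Lemma seg_int_split c a b f : a <= c <= b -> cont_on a b f ->
  seg_int a b f = seg_int a c f + seg_int c b f.
Proof.
move=> /andP[ac cb] cf; have If := cont_on_integrable cf.
apply/esym/eqP; rewrite addrC eq_sym -subr_eq; apply/eqP.
rewrite /seg_int Rintegral_itvB ?bnd_simp//.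
apply: Rintegral_itv_obnd_cbnd; apply: integrableS If => //.
by apply: subset_itv; rewrite bnd_simp.
Qed.

Lemma seg_int_deriv a b F f : a <= b ->
  (forall t, a <= t <= b -> is_derive t 1 F (f t)) -> cont_on a b f ->
  seg_int a b f = F b - F a.
Proof.
rewrite le_eqVlt => /predU1P[<- _ _|ab dF cf].
  by rewrite /seg_int set_itv1 Rintegral_set1 subrr.
have dF1 t : a <= t <= b -> derivable F t 1 by move=> /dF[].
have cF t : a <= t <= b -> {for t, continuous F}.
  by move=> /dF1/derivable1_diffP/differentiable_continuous.
rewrite /seg_int /Rintegral (@continuous_FTC2 _ f F)//.
- by apply/continuous_in_subspaceT => t; rewrite inE /= in_itv /= => /cf.
- split.
  + by move=> t; rewrite in_itv /= => /andP[/ltW ta /ltW tb]; apply: dF1; rewrite ta.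
  + by apply: cvg_at_right_filter; apply: cF; rewrite lexx ltW.
  + by apply: cvg_at_left_filter; apply: cF; rewrite lexx ltW.
- move=> t; rewrite in_itv /= => /andP[/ltW ta /ltW tb].
  by rewrite derive1E; case: (dF t) => //; rewrite ta.
Qed.

End SegmentIntegral.

(** * Differentials of functions on the plane *)

(** The little-o definition of the differential, with the remainder estimated
  by an explicit inequality that epsilon arguments can produce and consume. *)
Lemma is_diff_near (R : realType) (V W : normedModType R) (f : V -> W) (x : V)
    (df : {linear V -> W}) : continuous df ->
  (forall e, 0 < e -> \forall h \near (0 : V),
    `|f (h + x) - f x - df h| <= e * `|h|) ->
  is_diff x f df.
Proof.
move=> dfc H.
have E : f \o shift x = cst (f x) + df +o_ 0 id.
  apply/eqaddoP => e e0; have := H e e0.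
  by apply: filterS => h /=; rewrite !fctE /= opprD addrA.
have dE := diff_unique dfc E.
apply: DiffDef; last exact: dE.
by apply/diff_locallyP; rewrite dE.
Qed.

Section PlaneDifferential.
Variable R : realType.
Implicit Types (u v : R * R -> R) (z h : R * R) (a b : R).

Definition plin a b : R * R -> R := fun h => a * h.1 + b * h.2.

(** Fréchet differentiability with partial derivatives [a] and [b]; real
  differentiability, unlike the mere existence of partial derivatives, is what
  the chain rule and Goursat's argument need. *)
Definition pdiff u z a b := is_diff z u (plin a b).

Lemma plin_linear a b : linear (plin a b).
Proof. by move=> k h h'; rewrite /plin /= /GRing.scale /=; ring. Qed.

Lemma plin_continuous a b : continuous (plin a b).
Proof.
move=> z; apply: cvgD; apply: cvgM; try exact: cvg_cst.
  exact: cvg_fst.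
exact: cvg_snd.
Qed.

Lemma pdiffP u z a b : pdiff u z a b <->
  forall e, 0 < e -> \forall h \near (0 : R * R),
    `|u (h + z) - u z - plin a b h| <= e * `|h|.
Proof.
split=> [[du dE] e e0|H].
  have /eqaddoP/(_ e e0) := diff_locally du; rewrite dE.
  by apply: filterS => h /=; rewrite !fctE /= opprD addrA.
pose linM := GRing.isLinear.Build _ _ _ _ _ (plin_linear a b).
pose L : {linear _ -> _} := HB.pack (plin a b) linM.
exact: (@is_diff_near _ _ _ u z L (@plin_continuous a b) H).
Qed.

Lemma pdiff_continuous u z a b : pdiff u z a b -> {for z, continuous u}.
Proof. by move=> [du _]; exact: differentiable_continuous. Qed.

Lemma pdiff_unique u z a b a' b' : pdiff u z a b -> pdiff u z a' b' -> a = a' /\ b = b'.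
Proof.
move=> [_ E] [_]; rewrite E => ab.
have := congr1 (fun f => f (1, 0)) ab; have := congr1 (fun f => f (0, 1)) ab.
by rewrite /plin /= !mulr1 !mulr0 !addr0 !add0r.
Qed.

Lemma is_derive1_diff (f : R -> R) (t d : R) :
  is_derive t 1 f d -> is_diff t f (fun k : R => k * d).
Proof.
move=> [df E]; apply: DiffDef; first exact/derivable1_diffP.
by rewrite deriv1E// derive1E E.
Qed.

Lemma pdiff_curve u (c1 c2 : R -> R) (t d1 d2 a b : R) :
  is_derive t 1 c1 d1 -> is_derive t 1 c2 d2 -> pdiff u (c1 t, c2 t) a b ->
  is_derive t 1 (fun s => u (c1 s, c2 s)) (a * d1 + b * d2).
Proof.
move=> /is_derive1_diff D1 /is_derive1_diff D2 du.
have D : is_diff t (u \o (fun s => (c1 s, c2 s)))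
    (plin a b \o (fun k : R => (k * d1, k * d2))) by exact: is_diff_comp.
case: D => dd E; apply: DeriveDef; first exact/derivable1_diffP.
by rewrite deriveE// E /plin /= !mul1r.
Qed.

Lemma pdiff_comp u (f g : R * R -> R) z a b f1 f2 g1 g2 :
  pdiff f z f1 f2 -> pdiff g z g1 g2 -> pdiff u (f z, g z) a b ->
  pdiff (fun w => u (f w, g w)) z (a * f1 + b * g1) (a * f2 + b * g2).
Proof.
rewrite /pdiff => df dg du.
have D : is_diff z (u \o (fun s => (f s, g s)))
    (plin a b \o (fun h => (plin f1 f2 h, plin g1 g2 h))) by exact: is_diff_comp.
rewrite /pdiff (_ : plin _ _ = (plin a b \o (fun h => (plin f1 f2 h, plin g1 g2 h))))//.
by apply/funext => h; rewrite /plin /=; ring.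
Qed.

Lemma pdiff_eq u z a b a' b' : pdiff u z a b -> a = a' -> b = b' -> pdiff u z a' b'.
Proof. by move=> ? <- <-. Qed.

Lemma pdiffD u v z a b a' b' : pdiff u z a b -> pdiff v z a' b' ->
  pdiff (fun w => u w + v w) z (a + a') (b + b').
Proof.
move=> du dv; rewrite /pdiff (_ : plin _ _ = plin a b + plin a' b').
  exact: is_diffD.
by apply/funext => h; rewrite !fctE /plin; ring.
Qed.

Lemma pdiffB u v z a b a' b' : pdiff u z a b -> pdiff v z a' b' ->
  pdiff (fun w => u w - v w) z (a - a') (b - b').
Proof.
move=> du dv; rewrite /pdiff (_ : plin _ _ = plin a b - plin a' b').
  exact: is_diffB.
by apply/funext => h; rewrite !fctE /plin; ring.
Qed.

Lemma pdiffM u v z a b a' b' : pdiff u z a b -> pdiff v z a' b' ->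
  pdiff (fun w => u w * v w) z (u z * a' + v z * a) (u z * b' + v z * b).
Proof.
move=> du dv; rewrite /pdiff (_ : plin _ _ = u z *: plin a' b' + v z *: plin a b).
  exact: is_diffM.
by apply/funext => h; rewrite !fctE /plin /GRing.scale /=; ring.
Qed.

Lemma pdiffZ u z a b k : pdiff u z a b -> pdiff (fun w => k * u w) z (k * a) (k * b).
Proof.
move=> du; rewrite /pdiff (_ : plin _ _ = k *: plin a b).
  exact: is_diffZ.
by apply/funext => h; rewrite !fctE /plin /GRing.scale /=; ring.
Qed.

Lemma pdiff_cst k z : pdiff (fun=> k) z 0 0.
Proof.
rewrite /pdiff (_ : plin _ _ = 0); first exact: is_diff_cst.
by apply/funext => h; rewrite /plin !mul0r addr0.
Qed.

Lemma pdiff_fst z : pdiff (fun w => w.1) z 1 0.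
Proof.
apply/pdiffP => e e0; near=> h; rewrite /plin /= mul1r mul0r addr0 addrK subrr normr0.
by rewrite mulr_ge0// ltW.
Unshelve. all: by end_near. Qed.

Lemma pdiff_snd z : pdiff (fun w => w.2) z 0 1.
Proof.
apply/pdiffP => e e0; near=> h; rewrite /plin /= mul1r mul0r add0r addrK subrr normr0.
by rewrite mulr_ge0// ltW.
Unshelve. all: by end_near. Qed.

Lemma pdiff_comp1 (f : R -> R) u z a b (d : R) : is_derive (u z) 1 f d -> pdiff u z a b ->
  pdiff (fun w => f (u w)) z (d * a) (d * b).
Proof.
move=> /is_derive1_diff D1 du.
have D : is_diff z (f \o u) ((fun k : R => k * d) \o plin a b) by exact: is_diff_comp.
rewrite /pdiff (_ : plin _ _ = ((fun k : R => k * d) \o plin a b))//.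
by apply/funext => h; rewrite /plin /=; ring.
Qed.

End PlaneDifferential.

(** * Differentiation under the integral sign *)

Lemma is_derive_affine (R : realType) (p q t : R) :
  is_derive t 1 (fun s => s * p + q) p.
Proof.
have -> : (fun s => s * p + q) = (p \*: id) + cst q.
  by apply/funext => s; rewrite !fctE /= mulrC.
by apply: is_derive_eq; rewrite addr0 /GRing.scale /= mulr1.
Qed.

Section ParametricIntegral.
Variables (R : realType) (a b : R).
Hypothesis ab : a <= b.
Variable V : set (R * R).
Hypothesis openV : open V.
Implicit Types (g : R * R -> R -> R) (z h : R * R).

Definition joint_cont g := forall z t, V z -> a <= t <= b ->
  {for (z, t), continuous (fun p : (R * R) * R => g p.1 p.2)}.

Lemma joint_cont_on g z : joint_cont g -> V z -> cont_on a b (g z).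
Proof.
move=> cg Vz t tab.
apply: (@continuous2_cvg _ (R * R)%type R R (nbhs t) _ (fun=> z) id g z t).
- exact: cg.
- exact: cvg_cst.
- exact: cvg_id.
Qed.

(** Continuity in the parameter is uniform over the compact segment of
  integration (tube lemma). *)
Lemma joint_cont_unif g z (e : R) : joint_cont g -> V z -> 0 < e ->
  \forall w \near z, forall t, a <= t <= b -> `|g w t - g z t| < e.
Proof.
move=> cg Vz e0.
have /compact_near_coveringP cpt := @segment_compact R a b.
have := @cpt (R * R)%type (nbhs z) (fun w t => `|g w t - g z t| < e) _.
have H : forall t, `[a, b]%classic t ->
    \forall t' \near t & w \near z, `|g w t' - g z t'| < e.
  move=> t /=; rewrite in_itv /= => tab.
  have e20 : 0 < e / 2 by rewrite divr_gt0.
  have /cvgrPdist_lt/(_ _ e20)[[A B] /= [nA nB] AB] := cg z t Vz tab.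
  exists (B, A) => //= -[t' w] /= [Bt' Aw].
  have h1 := AB (w, t') (conj Aw Bt').
  have h2 := AB (z, t') (conj (nbhs_singleton nA) Bt').
  rewrite /= in h1 h2.
  rewrite -(subrKA (g z t)) (le_lt_trans (ler_normD _ _))// (splitr e).
  by rewrite ltrD// distrC.
move=> /(_ _ H); apply: filterS => w Hw t tab; apply: Hw.
by rewrite /= in_itv.
Qed.

Lemma seg_int_param_continuous g z : joint_cont g -> V z ->
  {for z, continuous (fun w => seg_int a b (g w))}.
Proof.
move=> cg Vz; apply/cvgrPdist_lt => e e0.
have d0 : 0 < e / (b - a + 1) by rewrite divr_gt0// ltr_wpDl// subr_ge0.
have nV : \forall w \near z, V w by exact: open_nbhs_nbhs (conj openV Vz).
near=> w.
have Vw : V w by near: w.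
rewrite -seg_intB; try exact: joint_cont_on.
have H : forall t, a <= t <= b -> `|g z t - g w t| <= e / (b - a + 1).
  move=> t tab; rewrite distrC ltW//; move: t tab; near: w.
  exact: joint_cont_unif.
apply: le_lt_trans (seg_int_le ab _ H) _.
  by move=> t tab; apply: cvgB; exact: (joint_cont_on cg).
rewrite mulrAC ltr_pdivrMr ?ltr_wpDl// ?subr_ge0//.
by rewrite ltr_pM2l// ltrDl.
Unshelve. all: by end_near. Qed.

(** By the mean value theorem in the parameter, the increment of the integrand
  differs from its linear part by at most the oscillation of the partial
  derivatives, which is uniformly small by [joint_cont_unif]. *)
Lemma pdiff_seg_int g g1 g2 z : joint_cont g -> joint_cont g1 -> joint_cont g2 ->
  (forall w t, V w -> a <= t <= b -> pdiff (g^~ t) w (g1 w t) (g2 w t)) -> V z ->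
  pdiff (fun w => seg_int a b (g w)) z (seg_int a b (g1 z)) (seg_int a b (g2 z)).
Proof.
move=> cg cg1 cg2 dg Vz; apply/pdiffP => e e0.
pose d := e / (b - a + 1) / 2.
have d0 : 0 < d by rewrite !divr_gt0// ltr_wpDl// subr_ge0.
have nV : \forall w \near z, V w by exact: open_nbhs_nbhs (conj openV Vz).
have N : \forall w \near z, V w /\ forall t, a <= t <= b ->
    `|g1 w t - g1 z t| < d /\ `|g2 w t - g2 z t| < d.
  near=> w; split; first by near: w.
  move=> t tab; split; move: t tab; near: w; exact: joint_cont_unif.
move/nbhs_ballP : N => [r /= r0 Hr].
have nr : \forall h \near (0 : R * R), `|h| < r by exact: nbhs0_lt.
near=> h.
have hr : `|h| < r by near: h.
have seg c : 0 <= c <= 1 -> V (c *: h + z) /\ forall t, a <= t <= b ->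
    `|g1 (c *: h + z) t - g1 z t| < d /\ `|g2 (c *: h + z) t - g2 z t| < d.
  move=> /andP[c0 c1]; apply: Hr; rewrite -ball_normE /= opprD addrC subrK normrN.
  by rewrite normrZ ger0_norm// (le_lt_trans _ hr)// ler_piMl.
have V1 : V (h + z) by have [] := seg 1; rewrite ?ler01 ?lexx ?scale1r.
have cont_lin : cont_on a b (fun t => h.1 * g1 z t + h.2 * g2 z t).
  move=> t tab; apply: cvgD; apply: cvgM; try exact: cvg_cst.
    exact: (joint_cont_on cg1).
  exact: (joint_cont_on cg2).
have -> : plin (seg_int a b (g1 z)) (seg_int a b (g2 z)) h =
    seg_int a b (fun t => h.1 * g1 z t + h.2 * g2 z t).
  rewrite seg_intD ?seg_intZ ?/plin; try exact: joint_cont_on.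
  - by rewrite mulrC [X in _ + X]mulrC.
  - by move=> t tab; apply: cvgM; [exact: cvg_cst|exact: (joint_cont_on cg1)].
  - by move=> t tab; apply: cvgM; [exact: cvg_cst|exact: (joint_cont_on cg2)].
have cont_dif : cont_on a b (fun t => g (h + z) t - g z t).
  by move=> t tab; apply: cvgB; exact: (joint_cont_on cg).
rewrite -!seg_intB//; try exact: joint_cont_on.
have K t : a <= t <= b ->
    `|g (h + z) t - g z t - (h.1 * g1 z t + h.2 * g2 z t)| <=
      e / (b - a + 1) * `|h|.
  move=> tab.
  pose c1 s : R := s * h.1 + z.1; pose c2 s : R := s * h.2 + z.2.
  pose df s := g1 (s *: h + z) t * h.1 + g2 (s *: h + z) t * h.2.
  have dg1 (s : R) : 0 <= s <= 1 -> is_derive s 1 (fun s => g (c1 s, c2 s) t) (df s).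
    move=> s01; rewrite /df.
    apply: (@pdiff_curve _ (g^~ t) c1 c2).
    - exact: is_derive_affine.
    - exact: is_derive_affine.
    - apply: dg => //; exact: (seg s s01).1.
  have [|||c c01 E] := @MVT_segment R (fun s => g (c1 s, c2 s) t) df 0 1.
  - by [].
  - by move=> s; rewrite in_itv /= => /andP[/ltW s0 /ltW s1]; apply: dg1; rewrite s0.
  - apply/continuous_in_subspaceT => s; rewrite inE /= in_itv /= => s01.
    apply/differentiable_continuous/derivable1_diffP.
    by case: (dg1 s s01).
  have E1 : (c1 1, c2 1) = h + z by rewrite /c1 /c2 !mul1r.
  have E0 : (c1 0, c2 0) = z by rewrite /c1 /c2 !mul0r !add0r; case: (z).
  rewrite E1 E0 subr0 mulr1 /df in E; rewrite E.
  rewrite in_itv /= in c01.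
  have [/ltW G1 /ltW G2] := (seg c c01).2 t tab.
  rewrite (_ : _ - _ = (g1 (c *: h + z) t - g1 z t) * h.1 +
    (g2 (c *: h + z) t - g2 z t) * h.2); last by ring.
  rewrite (le_trans (ler_normD _ _))// !normrM.
  rewrite (_ : e / (b - a + 1) * `|h| = d * `|h| + d * `|h|); last first.
    by rewrite /d -mulrDl -splitr.
  rewrite prod_normE /=; apply: lerD; apply: ler_pM => //.
    by rewrite le_max lexx.
  by rewrite le_max lexx orbT.
apply: le_trans (seg_int_le ab _ K) _.
  by move=> t tab; apply: cvgB; [exact: cont_dif|exact: cont_lin].
rewrite mulrAC ler_wpM2r// mulrAC ler_pdivrMr ?ltr_wpDl// ?subr_ge0//.
by rewrite ler_wpM2l ?(ltW e0)// lerDl.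
Unshelve. all: by end_near. Qed.

End ParametricIntegral.

(** * Goursat's theorem for closed forms on a rectangle *)

Section Goursat.
Variables (R : realType) (P Q : R * R -> R) (a b c d : R).
Hypotheses (ab : a <= b) (cd : c <= d).

Definition in_rect (z : R * R) := [/\ a <= z.1, z.1 <= b, c <= z.2 & z.2 <= d].

Hypothesis closedPQ : forall z, in_rect z ->
  exists p1 q2 k, pdiff P z p1 k /\ pdiff Q z k q2.

(** The integral of the form [P ds + Q dt] along the boundary of the rectangle,
  counterclockwise. *)
Definition circulation (x1 x2 y1 y2 : R) : R :=
  seg_int x1 x2 (fun s => P (s, y1) - P (s, y2)) +
  seg_int y1 y2 (fun t => Q (x2, t) - Q (x1, t)).

Let contP z : in_rect z -> {for z, continuous P}.
Proof. by move=> /closedPQ[p1 [q2 [k [dP _]]]]; exact: pdiff_continuous dP. Qed.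

Let contQ z : in_rect z -> {for z, continuous Q}.
Proof. by move=> /closedPQ[p1 [q2 [k [_ dQ]]]]; exact: pdiff_continuous dQ. Qed.

Let contP1 x1 x2 y : a <= x1 -> x2 <= b -> c <= y -> y <= d ->
  cont_on x1 x2 (fun s => P (s, y)).
Proof.
move=> ax xb cy yd s /andP[xs sx].
apply: (@continuous2_cvg _ R R R (nbhs s) _ id (fun=> y) (fun s t => P (s, t)) s y).
- rewrite (_ : (fun z => _) = P); last by apply/funext => -[].
  by apply: contP; split => //=; [exact: le_trans ax _|exact: le_trans xb].
- exact: cvg_id.
- exact: cvg_cst.
Qed.

Let contQ2 y1 y2 x : a <= x -> x <= b -> c <= y1 -> y2 <= d ->
  cont_on y1 y2 (fun t => Q (x, t)).
Proof.
move=> ax xb cy yd t /andP[ys sy].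
apply: (@continuous2_cvg _ R R R (nbhs t) _ (fun=> x) id (fun s t => Q (s, t)) x t).
- rewrite (_ : (fun z => _) = Q); last by apply/funext => -[].
  by apply: contQ; split => //=; [exact: le_trans cy _|exact: le_trans yd].
- exact: cvg_cst.
- exact: cvg_id.
Qed.

Let contB (x y : R) (f g : R -> R) : cont_on x y f -> cont_on x y g ->
  cont_on x y (fun t => f t - g t).
Proof. by move=> cf cg t tab; apply: cvgB; [exact: cf|exact: cg]. Qed.

Let circ_split1 x1 x2 x3 y1 y2 : a <= x1 -> x1 <= x2 -> x2 <= x3 -> x3 <= b ->
  c <= y1 -> y1 <= y2 -> y2 <= d ->
  circulation x1 x3 y1 y2 = circulation x1 x2 y1 y2 + circulation x2 x3 y1 y2.
Proof.
move=> ax x12 x23 xb cy y12 yd.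
have [ax2 ax3] : a <= x2 /\ a <= x3 by split; lra.
have [xb2 xb1] : x2 <= b /\ x1 <= b by split; lra.
have [cy2 yd1] : c <= y2 /\ y1 <= d by split; lra.
rewrite /circulation (@seg_int_split _ x2 x1 x3) ?x12//; last first.
  by apply: contB; apply: contP1.
have -> : seg_int y1 y2 (fun t => Q (x3, t) - Q (x1, t)) =
  seg_int y1 y2 (fun t => Q (x2, t) - Q (x1, t)) +
  seg_int y1 y2 (fun t => Q (x3, t) - Q (x2, t)).
  rewrite -seg_intD; try by apply: contB; apply: contQ2.
  by apply: eq_seg_int => t _; ring.
by ring.
Qed.

Let circ_split2 x1 x2 y1 y2 y3 : a <= x1 -> x1 <= x2 -> x2 <= b ->
  c <= y1 -> y1 <= y2 -> y2 <= y3 -> y3 <= d ->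
  circulation x1 x2 y1 y3 = circulation x1 x2 y1 y2 + circulation x1 x2 y2 y3.
Proof.
move=> ax x12 xb cy y12 y23 yd.
have [ax2 xb1] : a <= x2 /\ x1 <= b by split; lra.
have [cy2 cy3] : c <= y2 /\ c <= y3 by split; lra.
have [yd2 yd1] : y2 <= d /\ y1 <= d by split; lra.
rewrite /circulation (@seg_int_split _ y2 y1 y3) ?y12//; last first.
  by apply: contB; apply: contQ2.
have -> : seg_int x1 x2 (fun s => P (s, y1) - P (s, y3)) =
  seg_int x1 x2 (fun s => P (s, y1) - P (s, y2)) +
  seg_int x1 x2 (fun s => P (s, y2) - P (s, y3)).
  rewrite -seg_intD; try by apply: contB; apply: contP1.
  by apply: eq_seg_int => t _; ring.
by ring.
Qed.

(** At a point of the rectangle the form agrees to first order with an affine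
  form whose matrix is symmetric; the latter is exact, so only the remainder,
  of size [e] times the diameter, is integrated along the boundary. *)
Let circ_small z e : in_rect z -> 0 < e -> exists2 r, 0 < r &
  forall x1 x2 y1 y2, a <= x1 -> x1 <= z.1 -> z.1 <= x2 -> x2 <= b ->
    c <= y1 -> y1 <= z.2 -> z.2 <= y2 -> y2 <= d ->
    x2 - x1 + (y2 - y1) < r ->
    `|circulation x1 x2 y1 y2| <= e * (x2 - x1 + (y2 - y1)) ^+ 2.
Proof.
move=> zr e0; have [p1 [q2 [k [/pdiffP dP /pdiffP dQ]]]] := closedPQ zr.
have e20 : 0 < e / 2 by rewrite divr_gt0.
have [r /= r0 Hr] : exists2 r, 0 < r & forall h : R * R, `|h| < r ->
    `|P (h + z) - P z - plin p1 k h| <= e / 2 * `|h| /\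
    `|Q (h + z) - Q z - plin k q2 h| <= e / 2 * `|h|.
  have : \forall h \near (0 : R * R),
      `|P (h + z) - P z - plin p1 k h| <= e / 2 * `|h| /\
      `|Q (h + z) - Q z - plin k q2 h| <= e / 2 * `|h|.
    by near=> h; split; near: h; [exact: dP|exact: dQ].
  move=> /nbhs_ballP[r r0 Hr]; exists r => // h hr; apply: Hr.
  by rewrite -ball_normE /= sub0r normrN.
exists r => // x1 x2 y1 y2 ax x1z zx2 xb cy y1z zy2 yd small.
set l := x2 - x1 + (y2 - y1) in small *.
have near_z s t : x1 <= s <= x2 -> y1 <= t <= y2 ->
    `|P (s, t) - P z - plin p1 k (s - z.1, t - z.2)| <= e / 2 * l /\
    `|Q (s, t) - Q z - plin k q2 (s - z.1, t - z.2)| <= e / 2 * l.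
  move=> /andP[s1 s2] /andP[t1 t2].
  pose h : R * R := (s - z.1, t - z.2).
  have hl : `|h| <= l.
    rewrite prod_normE /= ge_max !ler_norml /l; apply/andP; split; apply/andP; split; lra.
  have -> : (s, t) = h + z by rewrite /h; case: (z) => ? ?; congr (_, _) => /=; ring.
  have [K1 K2] := Hr h (le_lt_trans hl small).
  by split; [apply: (le_trans K1)|apply: (le_trans K2)]; rewrite ler_wpM2l// ltW.
have K1 : `|seg_int x1 x2 (fun s => P (s, y1) - P (s, y2)) -
    k * (y1 - y2) * (x2 - x1)| <= e * l * (x2 - x1).
  have x12 := le_trans x1z zx2.
  have y12 := le_trans y1z zy2.
  have cP : cont_on x1 x2 (fun s => P (s, y1) - P (s, y2)).
    by apply: contB; apply: contP1 => //; [exact: le_trans yd|exact: le_trans y12].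
  rewrite -seg_int_cst// -seg_intB//; last by move=> t _; exact: cvg_cst.
  apply: seg_int_le => //.
  - by apply: contB => // t _; exact: cvg_cst.
  - move=> s s12.
    have [|A _] := near_z s y1 s12; first by apply/andP; split; lra.
    have [|B _] := near_z s y2 s12; first by apply/andP; split; lra.
    move: A B; rewrite /plin /= !ler_norml => /andP[A1 A2] /andP[B1 B2].
    by apply/andP; split; lra.
have K2 : `|seg_int y1 y2 (fun t => Q (x2, t) - Q (x1, t)) -
    k * (x2 - x1) * (y2 - y1)| <= e * l * (y2 - y1).
  have x12 := le_trans x1z zx2.
  have y12 := le_trans y1z zy2.
  have cQ : cont_on y1 y2 (fun t => Q (x2, t) - Q (x1, t)).
    by apply: contB; apply: contQ2 => //; [exact: le_trans x12|exact: le_trans xb].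
  rewrite -seg_int_cst// -seg_intB//; last by move=> t _; exact: cvg_cst.
  apply: seg_int_le => //.
  - by apply: contB => // t _; exact: cvg_cst.
  - move=> t t12.
    have [|_ A] := near_z x1 t _ t12; first by apply/andP; split; lra.
    have [|_ B] := near_z x2 t _ t12; first by apply/andP; split; lra.
    move: A B; rewrite /plin /= !ler_norml => /andP[A1 A2] /andP[B1 B2].
    by apply/andP; split; lra.
rewrite /circulation.
rewrite (_ : _ + _ = (seg_int x1 x2 (fun s => P (s, y1) - P (s, y2)) -
    k * (y1 - y2) * (x2 - x1)) + (seg_int y1 y2 (fun t => Q (x2, t) - Q (x1, t)) -
    k * (x2 - x1) * (y2 - y1))); last by ring.
apply: le_trans (ler_normD _ _) _.
by rewrite (_ : e * l ^+ 2 = e * l * (x2 - x1) + e * l * (y2 - y1)) ?lerD// /l; ring.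
Unshelve. all: by end_near. Qed.

(** The circulation around a rectangle is the sum of those around its four
  quarters, so one quarter carries at least a fourth of it. *)
Let quarter x y l m : 0 <= l -> 0 <= m ->
  a <= x -> x + l <= b -> c <= y -> y + m <= d -> forall K,
  K < `|circulation x (x + l) y (y + m)| -> exists x' y',
  [/\ x' = x \/ x' = x + l / 2, y' = y \/ y' = y + m / 2 &
      K / 4 < `|circulation x' (x' + l / 2) y' (y' + m / 2)|].
Proof.
move=> l0 m0 ax xb cy yd K.
have [xh yh] : x + l / 2 + l / 2 = x + l /\ y + m / 2 + m / 2 = y + m.
  by rewrite -!addrA -!splitr.
rewrite (@circ_split1 x (x + l / 2)); [|lra..].
rewrite (@circ_split2 x _ y (y + m / 2)); [|lra..].
rewrite (@circ_split2 _ (x + l) y (y + m / 2)); [|lra..].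
move=> KC; apply: contrapT => H.
have small x' y' : x' = x \/ x' = x + l / 2 -> y' = y \/ y' = y + m / 2 ->
    `|circulation x' (x' + l / 2) y' (y' + m / 2)| <= K / 4.
  by move=> hx hy; rewrite leNgt; apply/negP => ?; apply: H; exists x', y'.
have A := small x y (or_introl erefl) (or_introl erefl).
have B := small x _ (or_introl erefl) (or_intror erefl).
have C := small _ y (or_intror erefl) (or_introl erefl).
have D := small _ _ (or_intror erefl) (or_intror erefl).
rewrite xh in C D; rewrite yh in B D.
move: KC; apply/negP; rewrite -leNgt.
apply: le_trans (ler_normD _ _) _.
have := lerD (ler_normD (circulation x (x + l / 2) y (y + m / 2))
  (circulation x (x + l / 2) (y + m / 2) (y + m)))
  (ler_normD (circulation (x + l / 2) (x + l) y (y + m / 2))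
  (circulation (x + l / 2) (x + l) (y + m / 2) (y + m))).
by move=> /le_trans; apply; lra.
Qed.

(** Otherwise bisection yields nested rectangles, shrinking to a point, whose
  circulation decreases no faster than their area; this contradicts
  [circ_small] at the limit point.  The partial derivatives need not be
  continuous, which is the point: the stem function is only assumed to be
  differentiable. *)
Lemma goursat : circulation a b c d = 0.
Proof.
apply/eqP/negPn/negP => nz.
pose K := `|circulation a b c d| / 2.
have K0 : 0 < K by rewrite divr_gt0// normr_gt0.
(* l n and m n are the sides of the rectangles of generation n. *)
pose l n := (b - a) / 2 ^+ n; pose m n := (d - c) / 2 ^+ n.
have l0 n : 0 <= l n by rewrite divr_ge0// ?subr_ge0// exprn_ge0.
have m0 n : 0 <= m n by rewrite divr_ge0// ?subr_ge0// exprn_ge0.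
have lS n : l n.+1 = l n / 2 by rewrite /l exprSr invfM mulrA.
have mS n : m n.+1 = m n / 2 by rewrite /m exprSr invfM mulrA.
pose bad n (p : R * R) := [/\ a <= p.1, p.1 + l n <= b, c <= p.2, p.2 + m n <= d
  & K / 4 ^+ n < `|circulation p.1 (p.1 + l n) p.2 (p.2 + m n)|].
pose nested n (p q : R * R) := [/\ p.1 <= q.1, q.1 + l n.+1 <= p.1 + l n,
  p.2 <= q.2 & q.2 + m n.+1 <= p.2 + m n].
have step (np : nat * (R * R)) : exists q, bad np.1 np.2 ->
    bad np.1.+1 q /\ nested np.1 np.2 q.
  case: np => n [x y] /=; have [H|?] := pselect (bad n (x, y)); last by exists (x, y).
  case: H => /= ax xb cy yd KC.
  have [x' [y' [hx hy K']]] := quarter (l0 n) (m0 n) ax xb cy yd KC.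
  have lh := splitr (l n); have mh := splitr (m n).
  have lh0 := l0 n.+1; have mh0 := m0 n.+1.
  exists (x', y') => _; rewrite /bad /nested /= exprSr invfM mulrA.
  rewrite lS in lh0 *; rewrite mS in mh0 *.
  by case: hx => -> in K' *; case: hy => -> in K' *; split; split => //; lra.
have [next Hnext] := choice step.
pose p n : R * R := nat_rect (fun=> (R * R)%type) (a, c) (fun n q => next (n, q)) n.
have badp n : bad n (p n).
  elim: n => [|n IH]; last by have [] := Hnext (n, p n) IH.
  rewrite /bad /p /= /l /m expr0 !divr1 !subrKC; split => //.
  by rewrite /K ltr_pdivrMr// ltr_pMr ?ltr1n// normr_gt0.
have nestp n : nested n (p n) (p n.+1) by have [] := Hnext (n, p n) (badp n).
have nest1 n k : (p n).1 <= (p (n + k)%N).1 /\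
    (p (n + k)%N).1 + l (n + k)%N <= (p n).1 + l n.
  elim: k => [|k [IH1 IH2]]; first by rewrite addn0.
  by rewrite addnS; have [] := nestp (n + k)%N; split; lra.
have nest2 n k : (p n).2 <= (p (n + k)%N).2 /\
    (p (n + k)%N).2 + m (n + k)%N <= (p n).2 + m n.
  elim: k => [|k [IH1 IH2]]; first by rewrite addn0.
  by rewrite addnS; have [] := nestp (n + k)%N; split; lra.
have ub1 n k : (p k).1 <= (p n).1 + l n.
  have /orP[nk|kn] := leq_total n k.
    by have [] := nest1 n (k - n)%N; rewrite subnKC//; have := l0 k; lra.
  by have [] := nest1 k (n - k)%N; rewrite subnKC//; have := l0 n; lra.
have ub2 n k : (p k).2 <= (p n).2 + m n.
  have /orP[nk|kn] := leq_total n k.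
    by have [] := nest2 n (k - n)%N; rewrite subnKC//; have := m0 k; lra.
  by have [] := nest2 k (n - k)%N; rewrite subnKC//; have := m0 n; lra.
pose X := sup (range (fun n => (p n).1)); pose Y := sup (range (fun n => (p n).2)).
have X1 n : (p n).1 <= X.
  by apply: ub_le_sup; [exists ((p 0%N).1 + l 0%N) => _ [k _ <-]|exists n].
have Y1 n : (p n).2 <= Y.
  by apply: ub_le_sup; [exists ((p 0%N).2 + m 0%N) => _ [k _ <-]|exists n].
have X2 n : X <= (p n).1 + l n.
  by apply: ge_sup; [exists (p 0%N).1, 0%N|move=> _ [k _ <-]].
have Y2 n : Y <= (p n).2 + m n.
  by apply: ge_sup; [exists (p 0%N).2, 0%N|move=> _ [k _ <-]].
have XYr : in_rect (X, Y).
  have [/= h1 h2 h3 h4 _] := badp 0%N.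
  have x1 : a <= X := X1 0%N; have x2 : X <= a + l 0%N := X2 0%N.
  have y1 : c <= Y := Y1 0%N; have y2 : Y <= c + m 0%N := Y2 0%N.
  by split => //=; [exact: le_trans x2 _|exact: le_trans y2 _].
pose L := b - a + (d - c).
have L0 : 0 <= L by rewrite addr_ge0// subr_ge0.
have e0 : 0 < K / (L ^+ 2 + 1) by rewrite divr_gt0// ltr_wpDl// exprn_ge0.
have [r r0 Hr] := circ_small XYr e0.
have [n Ln] : exists n, L / 2 ^+ n < r.
  have [n] : exists n : nat, L / r < n%:R.
    by exists (Num.truncn (L / r)).+1; exact: truncnS_gt.
  rewrite ltr_pdivrMr// => Ln; exists n; rewrite ltr_pdivrMr ?exprn_gt0//.
  rewrite (lt_le_trans Ln)// mulrC ler_wpM2l ?ltW//.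
  by rewrite -natrX ltr_nat ltn_expl.
have [h1 h2 h3 h4 h5] := badp n.
have lm : l n + m n = L / 2 ^+ n by rewrite /l /m -mulrDl.
have := Hr _ _ _ _ h1 (X1 n) (X2 n) h2 h3 (Y1 n) (Y2 n) h4.
rewrite ![_ + _ - _]addrAC !subrr !add0r lm => /(_ Ln); apply/negP; rewrite -ltNge.
apply: le_lt_trans h5.
rewrite expr_div_n -exprM mulnC exprM (_ : 2 ^+ 2 = 4); last by rewrite -natrX.
rewrite mulrA ler_wpM2r//.
rewrite mulrAC ler_pdivrMr; last by rewrite ltr_wpDl// exprn_ge0.
by rewrite ler_wpM2l ?(ltW K0)// lerDl.
Qed.

End Goursat.

(** * The derivative of a holomorphic function is holomorphic *)

Lemma is_derive_invf (R : realType) (V : normedModType R) (f : V -> R) (x v : V)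
    (df : R) : f x != 0 -> is_derive x v f df ->
  is_derive x v (fun y => (f y)^-1) (- (df / f x ^+ 2)).
Proof.
move=> fx [dfx E]; apply: DeriveDef; first exact: derivableV.
by rewrite deriveV// E /GRing.scale /= mulNr mulrC.
Qed.

Section CauchyRiemann.
Variable R : realType.
Implicit Types (D : set (R * R)) (u v : R * R -> R) (z w : R * R).

(** [u + i v] is holomorphic on [D] with derivative [ux + i vx]: the
  Cauchy-Riemann equations, with the other two partial derivatives replaced by
  their values. *)
Definition CR D u v ux vx := forall z, D z ->
  pdiff u z (ux z) (- vx z) /\ pdiff v z (vx z) (ux z).

(** Multiplication by [- i]: what is proved for real parts holds for imaginary
  parts. *)
Lemma CR_mulNi D u v ux vx : CR D u v ux vx ->
  CR D v (fun z => - u z) vx (fun z => - ux z).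
Proof.
move=> cr z /cr[du dv]; split; first by rewrite opprK.
have := pdiffZ (-1) du; rewrite !mulN1r opprK.
by rewrite (_ : (fun w => -1 * u w) = (fun w => - u w))//; apply/funext => w; rewrite mulN1r.
Qed.

Definition polar z (r t : R) : R * R := (z.1 + r * cos t, z.2 + r * sin t).

Lemma pdiff_polar u z (p : R * R) a b : pdiff u (polar z p.1 p.2) a b ->
  pdiff (fun q => u (polar z q.1 q.2)) p (a * cos p.2 + b * sin p.2)
    (p.1 * (b * cos p.2 - a * sin p.2)).
Proof.
move=> du.
have dcos : pdiff (fun q => cos q.2) p 0 (- sin p.2).
  apply: pdiff_eq (pdiff_comp1 (is_derive_cos p.2) (pdiff_snd p)) _ _; ring.
have dsin : pdiff (fun q => sin q.2) p 0 (cos p.2).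
  apply: pdiff_eq (pdiff_comp1 (is_derive_sin p.2) (pdiff_snd p)) _ _; ring.
have d1 := pdiffD (pdiff_cst z.1 p) (pdiffM (pdiff_fst p) dcos).
have d2 := pdiffD (pdiff_cst z.2 p) (pdiffM (pdiff_fst p) dsin).
apply: pdiff_eq (pdiff_comp d1 d2 du) _ _; ring.
Qed.

Lemma polar_dist z (r t : R) : 0 <= r -> `|polar z r t - z| <= r.
Proof.
move=> r0; rewrite prod_normE /= ge_max ![_ + _ * _ - _]addrAC !subrr !add0r !normrM.
rewrite (ger0_norm r0); apply/andP; split; rewrite ler_piMr//.
  by rewrite ler_norml cos_geN1 cos_le1.
by rewrite ler_norml sin_geN1 sin_le1.
Qed.

(** The real part of Cauchy's formula for the first derivative,
  [f' z = 1 / (2 pi r) * integral of f (z + r e^(i t)) e^(- i t) dt].  In polar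
  coordinates the form [f (w) dw / (w - z)^2] is closed, so Goursat's theorem
  on the rectangle [s, r] x [0, 2 pi] shows that the normalized integral is the
  same at all radii; its limit as the radius tends to 0 is computed from the
  differentiability of [f] at [z]. *)
Lemma circle_formula D u v ux vx z (r : R) : CR D u v ux vx -> 0 < r ->
  (forall s t, 0 <= s <= r -> D (polar z s t)) ->
  seg_int 0 (pi *+ 2) (fun t => u (polar z r t) * cos t + v (polar z r t) * sin t) =
  pi *+ 2 * r * ux z.
Proof.
move=> cr r0 Dz.
have pi2 : 0 <= pi *+ 2 :> R by rewrite mulrn_wge0// pi_ge0.
pose Q q := (u (polar z q.1 q.2) * cos q.2 + v (polar z q.1 q.2) * sin q.2) / q.1.
pose P q := (v (polar z q.1 q.2) * cos q.2 - u (polar z q.1 q.2) * sin q.2) / q.1 ^+ 2.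
have dPQ (p : R * R) : 0 < p.1 <= r -> exists p1 q2 k, pdiff P p p1 k /\ pdiff Q p k q2.
  move=> /andP[p0 pr].
  have pD : D (polar z p.1 p.2) by apply: Dz; rewrite pr ltW.
  have [du dv] := cr _ pD.
  have {}du := pdiff_polar du; have {}dv := pdiff_polar dv.
  have dcos : pdiff (fun q => cos q.2) p 0 (- sin p.2).
    apply: pdiff_eq (pdiff_comp1 (is_derive_cos p.2) (pdiff_snd p)) _ _; ring.
  have dsin : pdiff (fun q => sin q.2) p 0 (cos p.2).
    apply: pdiff_eq (pdiff_comp1 (is_derive_sin p.2) (pdiff_snd p)) _ _; ring.
  have dinv : pdiff (fun q => q.1^-1) p (- p.1 ^- 2) 0.
    have dV : is_derive p.1 1 (fun x : R => x^-1) (- (1 / p.1 ^+ 2)).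
      by apply: is_derive_invf; rewrite gt_eqF.
    apply: pdiff_eq (pdiff_comp1 dV (pdiff_fst p)) _ _; last by rewrite mulr0.
    by rewrite mulr1 div1r.
  have dQ := pdiffM (pdiffD (pdiffM du dcos) (pdiffM dv dsin)) dinv.
  have dP := pdiffM (pdiffB (pdiffM dv dcos) (pdiffM du dsin)) (pdiffM dinv dinv).
  have PE : P = (fun w => (v (polar z w.1 w.2) * cos w.2 -
      u (polar z w.1 w.2) * sin w.2) * (w.1^-1 * w.1^-1)).
    by apply/funext => q; rewrite /P expr2 invfM.
  rewrite -PE in dP; do 3 eexists; split; first exact: dP.
  apply: pdiff_eq dQ _ erefl.
  have p10 : p.1 != 0 by rewrite gt_eqF.
  by field.
have cst_cont k : cont_on 0 (pi *+ 2) (fun=> k) by move=> t _; exact: cvg_cst.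
have ccos k : cont_on 0 (pi *+ 2) (fun t : R => k * cos t).
  by move=> t _; apply: cvgM; [exact: cvg_cst|exact: continuous_cos].
have csin k : cont_on 0 (pi *+ 2) (fun t : R => k * sin t).
  by move=> t _; apply: cvgM; [exact: cvg_cst|exact: continuous_sin].
have cD f g : cont_on 0 (pi *+ 2) f -> cont_on 0 (pi *+ 2) g ->
    cont_on 0 (pi *+ 2) (fun t => f t + g t).
  by move=> cf cg t tT; apply: cvgD; [exact: cf|exact: cg].
have contQ s : 0 < s <= r -> cont_on 0 (pi *+ 2) (fun t => Q (s, t)).
  move=> sr t _; have [p1 [q2 [k [_ /pdiff_continuous cQ]]]] := dPQ (s, t) sr.
  apply: (@continuous2_cvg _ R R R (nbhs t) _ (fun=> s) id (fun s t => Q (s, t)) s t).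
  - by rewrite (_ : (fun z => _) = Q)//; apply/funext => -[].
  - exact: cvg_cst.
  - exact: cvg_id.
have J s : 0 < s <= r -> seg_int 0 (pi *+ 2) (fun t => Q (s, t)) =
    seg_int 0 (pi *+ 2) (fun t => Q (r, t)).
  move=> /andP[s0 sr].
  have H p : in_rect s r 0 (pi *+ 2) p -> exists p1 q2 k, pdiff P p p1 k /\ pdiff Q p k q2.
    by move=> [/(lt_le_trans s0) p0 pr _ _]; apply: dPQ; rewrite p0.
  have := goursat sr pi2 H; rewrite /circulation.
  rewrite (@eq_seg_int _ s r _ (fun=> 0)); last first.
    move=> t _; rewrite /P /polar /=.
    by rewrite cos2pi sin2pi cos0 sin0 subrr.
  rewrite seg_int_cst// mul0r add0r seg_intB.
  - by move/eqP; rewrite subr_eq0 => /eqP.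
  - by apply: contQ; rewrite r0 lexx.
  - by apply: contQ; rewrite s0.
have -> : seg_int 0 (pi *+ 2)
    (fun t => u (polar z r t) * cos t + v (polar z r t) * sin t) =
    r * seg_int 0 (pi *+ 2) (fun t => Q (r, t)).
  rewrite -seg_intZ; last by apply: contQ; rewrite r0 lexx.
  by apply: eq_seg_int => t _; rewrite /Q /= mulrCA divff ?gt_eqF// mulr1.
rewrite (_ : _ * ux z = r * (ux z * (pi *+ 2))); last by ring.
congr (_ * _); apply/eqP; rewrite -subr_eq0 -normr_le0; apply/ler_addgt0Pr => e e0.
rewrite add0r.
pose e' := e / (2 * (pi *+ 2) + 1).
have T1 : 0 < 2 * (pi *+ 2) + 1 :> R by rewrite ltr_wpDl// mulr_ge0.
have e'0 : 0 < e' by rewrite divr_gt0.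
have zD : D z.
  have := Dz 0 0; rewrite /polar !mul0r !addr0 lexx ltW// => /(_ isT).
  by case: (z).
have [/pdiffP/(_ _ e'0) du /pdiffP/(_ _ e'0) dv] := cr z zD.
have [d /= d0 Hd] : exists2 d, 0 < d & forall h : R * R, `|h| < d ->
    `|u (h + z) - u z - plin (ux z) (- vx z) h| <= e' * `|h| /\
    `|v (h + z) - v z - plin (vx z) (ux z) h| <= e' * `|h|.
  have : \forall h \near (0 : R * R),
      `|u (h + z) - u z - plin (ux z) (- vx z) h| <= e' * `|h| /\
      `|v (h + z) - v z - plin (vx z) (ux z) h| <= e' * `|h|.
    by near=> h; split; near: h.
  move=> /nbhs_ballP[d d0 Hd]; exists d => // h pdiff; apply: Hd.
  by rewrite -ball_normE /= sub0r normrN.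
(* A radius at which the first-order expansion at z holds within e'. *)
pose s := Num.min r (d / 2).
have s0 : 0 < s by rewrite lt_min r0 divr_gt0.
have sr : s <= r by rewrite ge_min lexx.
have sd : s < d by rewrite gt_min ltr_pdivrMr// mulr2n mulrDr mulr1 ltrDl d0 orbT.
rewrite -(J s) ?s0//.
pose A t := u z / s * cos t + (v z / s * sin t + ux z).
have cA : cont_on 0 (pi *+ 2) A by apply: (cD) => //; apply: (cD) => //.
have -> : ux z * (pi *+ 2) = seg_int 0 (pi *+ 2) A.
  rewrite !seg_intD ?seg_intZ ?seg_int_cst//; last 3 first.
  - by move=> t _; exact: continuous_sin.
  - by move=> t _; exact: continuous_cos.
  - exact: (cD).
  rewrite (@seg_int_deriv _ _ _ sin cos)//; last first.
    by move=> t _; exact: continuous_cos.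
  have -> : seg_int 0 (pi *+ 2) sin = - cos (pi *+ 2) - - cos (0 : R).
    apply: (@seg_int_deriv _ _ _ (fun t => - cos t)) => // t _.
      by rewrite -[sin t]opprK; exact: is_deriveN.
    exact: continuous_sin.
  by rewrite sin2pi cos2pi sin0 cos0 !subrr !mulr0 !add0r subr0.
rewrite -seg_intB//; last by apply: contQ; rewrite s0.
have K t : 0 <= t <= pi *+ 2 -> `|Q (s, t) - A t| <= 2 * e'.
  move=> _; set h := polar z s t - z.
  have hs : `|h| <= s by apply: polar_dist; exact: ltW.
  have [] := Hd h (le_lt_trans hs sd); rewrite subrK /plin.
  have -> : h.1 = s * cos t by rewrite /h /= addrAC subrr add0r.
  have -> : h.2 = s * sin t by rewrite /h /= addrAC subrr add0r.
  set Eu := (X in `|X| <= _) => hu; set Ev := (X in `|X| <= _) => hv.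
  have -> : Q (s, t) - A t = (Eu * cos t + Ev * sin t) / s.
    have sn0 : s != 0 by rewrite gt_eqF.
    have E1 : ux z = ux z * (cos t ^+ 2 + sin t ^+ 2) by rewrite cos2Dsin2 mulr1.
    by rewrite /A {}E1 /Q /Eu /Ev /=; field.
  rewrite normrM normfV (gtr0_norm s0) ler_pdivrMr//.
  rewrite (le_trans (ler_normD _ _))// !normrM (_ : 2 * e' * s = e' * s + e' * s); last by ring.
  have es : e' * `|h| <= e' * s by rewrite ler_wpM2l// ltW.
  apply: lerD.
    rewrite (le_trans _ es)// (le_trans _ hu)// ler_piMr//.
    by rewrite ler_norml cos_geN1 cos_le1.
  rewrite (le_trans _ es)// (le_trans _ hv)// ler_piMr//.
  by rewrite ler_norml sin_geN1 sin_le1.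
apply: le_trans (seg_int_le pi2 _ K) _.
  by move=> t tT; apply: cvgB; [apply: contQ => //; rewrite s0|exact: cA].
rewrite subr0 (_ : 2 * e' * (pi *+ 2) = e * (2 * (pi *+ 2)) / (2 * (pi *+ 2) + 1)); last first.
  by rewrite /e'; ring.
rewrite ler_pdivrMr//.
by rewrite ler_wpM2l ?(ltW e0)// lerDl.
Unshelve. all: by end_near. Qed.

Lemma pdiff_near u v z a b : (\forall w \near z, u w = v w) ->
  pdiff u z a b -> pdiff v z a b.
Proof.
move=> uv /pdiffP du; apply/pdiffP => e e0; have {}du := du e e0.
have uv0 : \forall h \near (0 : R * R), u (h + z) = v (h + z).
  by move: uv; rewrite (near_shift 0 z) subr0.
rewrite -(nbhs_singleton uv); near=> h.
by rewrite -(near uv0 h)//; near: h.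
Unshelve. all: by end_near. Qed.

(** Convergence of pairs, stated with the limit as a pair so that it unifies
  with neighbourhoods of a point of a product. *)
Lemma cvg_pairP (T : Type) (U V : topologicalType) (F : set_system T) {FF : Filter F}
    (f : T -> U) (g : T -> V) (a : U) (b : V) : f @ F --> a -> g @ F --> b ->
  (fun x => (f x, g x)) @ F --> (a, b).
Proof. exact: cvg_pair. Qed.

Lemma polar_continuous (r : R) :
  continuous (fun p : (R * R) * R => polar p.1 r p.2).
Proof.
move=> [z t].
have c1 : p.1.1 @[p --> (z, t)] --> z.1.
  by apply: (@continuous_comp _ _ _ fst fst (z, t)); exact: cvg_fst.
have c2 : p.1.2 @[p --> (z, t)] --> z.2.
  by apply: (@continuous_comp _ _ _ fst snd (z, t)); [exact: cvg_fst|exact: cvg_snd].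
have cc : cos p.2 @[p --> (z, t)] --> cos t.
  by apply: (@continuous_comp _ _ _ snd cos (z, t)); [exact: cvg_snd|exact: continuous_cos].
have cs : sin p.2 @[p --> (z, t)] --> sin t.
  by apply: (@continuous_comp _ _ _ snd sin (z, t)); [exact: cvg_snd|exact: continuous_sin].
exact: (cvg_pairP (cvgD c1 (cvgM (cvg_cst r) cc)) (cvgD c2 (cvgM (cvg_cst r) cs))).
Qed.

(** [circle_formula] writes the derivative near a point as an integral over a
  circle of fixed radius, first of the continuous function [f], which makes the
  derivative continuous, and then allows differentiation under the integral
  sign. *)
Lemma CR_derivative D u v ux vx : open D -> CR D u v ux vx ->
  exists uxx vxx, CR D ux vx uxx vxx.
Proof.
move=> oD cr.
suff pt : forall z, exists ab : R * R, D z -> pdiff ux z ab.1 (- ab.2) /\ pdiff vx z ab.2 ab.1.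
  have [f Hf] := choice pt.
  by exists (fun z => (f z).1), (fun z => (f z).2) => z /Hf.
have pi2 : 0 <= pi *+ 2 :> R by rewrite mulrn_wge0// pi_ge0.
have pi20 : 0 < pi *+ 2 :> R by rewrite mulrn_wgt0// pi_gt0.
have cu w : D w -> {for w, continuous u} by move=> /cr[/pdiff_continuous].
have cv w : D w -> {for w, continuous v} by move=> /cr[_ /pdiff_continuous].
pose mix (f g : R * R -> R) r w t := f (polar w r t) * cos t + g (polar w r t) * sin t.
have discs z0 : D z0 -> exists r V, [/\ 0 < r, open V, V z0, V `<=` D &
    forall w s t, V w -> 0 <= s <= r -> D (polar w s t)].
  move=> Dz0; have /nbhs_ballP[d /= d0 Hd] := open_nbhs_nbhs (conj oD Dz0).
  have d20 : 0 < d / 2 by rewrite divr_gt0.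
  exists (d / 2), (ball z0 (d / 2)); split => //.
  - exact: ball_open.
  - exact: ballxx.
  - by move=> w /(@le_ball _ _ _ _ d); rewrite ler_pdivrMr// ler_pMr// ler1n => /(_ isT)/Hd.
  - move=> w s t; rewrite -!ball_normE /= => wd /andP[s0 sd]; apply: Hd.
    rewrite -ball_normE /= -(subrKA w) (le_lt_trans (ler_normD _ _))// (splitr d).
    by rewrite ltr_leD// distrC (le_trans (polar_dist _ _ s0)).
have mix_cont r (V : set (R * R)) (f g : R * R -> R) : (forall w t, V w -> D (polar w r t)) ->
    (forall w, D w -> {for w, continuous f}) -> (forall w, D w -> {for w, continuous g}) ->
    joint_cont 0 (pi *+ 2) V (mix f g r).
  move=> VD cf cg w t Vw _; have Dp := VD w t Vw.
  have cp := @polar_continuous r (w, t).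
  have cc : cos p.2 @[p --> (w, t)] --> cos t.
    by apply: (@continuous_comp _ _ _ snd cos (w, t)); [exact: cvg_snd|exact: continuous_cos].
  have cs : sin p.2 @[p --> (w, t)] --> sin t.
    by apply: (@continuous_comp _ _ _ snd sin (w, t)); [exact: cvg_snd|exact: continuous_sin].
  apply: cvgD; apply: cvgM => //.
    exact: (cvg_comp _ _ cp (cf _ Dp)).
  exact: (cvg_comp _ _ cp (cg _ Dp)).
have mix_formula r (V : set (R * R)) (f g fx gx : R * R -> R) : CR D f g fx gx -> 0 < r ->
    (forall w s t, V w -> 0 <= s <= r -> D (polar w s t)) -> forall w, V w ->
    (pi *+ 2 * r)^-1 * seg_int 0 (pi *+ 2) (mix f g r w) = fx w.
  move=> cfg r0 VD w Vw; rewrite /mix (circle_formula cfg r0); last first.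
    by move=> s t; exact: VD.
  by rewrite mulKf// gt_eqF// mulr_gt0.
have mix_near r (V : set (R * R)) (f g fx gx : R * R -> R) z : CR D f g fx gx -> 0 < r -> open V -> V z ->
    (forall w s t, V w -> 0 <= s <= r -> D (polar w s t)) ->
    \forall w \near z, (pi *+ 2 * r)^-1 * seg_int 0 (pi *+ 2) (mix f g r w) = fx w.
  move=> cfg r0 oV Vz VD; have nV := open_nbhs_nbhs (conj oV Vz).
  by apply: filterS nV => w Vw; exact: (mix_formula r V f g fx gx).
have rot := CR_mulNi cr.
have cont_fx (f g fx gx : R * R -> R) : CR D f g fx gx ->
    (forall w, D w -> {for w, continuous f}) -> (forall w, D w -> {for w, continuous g}) ->
    forall w, D w -> {for w, continuous fx}.
  move=> cfg cf cg z Dz; have [r [V [r0 oV Vz _ VD]]] := discs z Dz.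
  have near_fx := mix_near r V f g fx gx z cfg r0 oV Vz VD.
  have lim : (fun w => (pi *+ 2 * r)^-1 * seg_int 0 (pi *+ 2) (mix f g r w)) @ z --> fx z.
    rewrite -(nbhs_singleton near_fx); apply: cvgM; first exact: cvg_cst.
    apply: (seg_int_param_continuous pi2 oV) => //.
    by apply: mix_cont => // w t Vw; apply: VD => //; rewrite ltW//= lexx.
  exact: cvg_trans (near_eq_cvg near_fx) lim.
have cux := cont_fx _ _ _ _ cr cu cv.
have cvx : forall w, D w -> {for w, continuous vx}.
  by apply: (cont_fx _ _ _ _ rot) => // w Dw; apply: cvgN; exact: cu.
move=> z; have [Dz|?] := pselect (D z); last by exists (0, 0).
have [r [V [r0 oV Vz VD' VD]]] := discs z Dz.
have VDr w t : V w -> D (polar w r t) by move=> Vw; apply: VD => //; rewrite ltW//= lexx.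
have pdiffmix (f g fx fy gx gy : R * R -> R) :
    (forall w, D w -> pdiff f w (fx w) (fy w) /\ pdiff g w (gx w) (gy w)) ->
    (forall w, D w -> {for w, continuous fx}) -> (forall w, D w -> {for w, continuous fy}) ->
    (forall w, D w -> {for w, continuous gx}) -> (forall w, D w -> {for w, continuous gy}) ->
    pdiff (fun w => (pi *+ 2 * r)^-1 * seg_int 0 (pi *+ 2) (mix f g r w)) z
      ((pi *+ 2 * r)^-1 * seg_int 0 (pi *+ 2) (mix fx gx r z))
      ((pi *+ 2 * r)^-1 * seg_int 0 (pi *+ 2) (mix fy gy r z)).
  move=> dfg cfx cfy cgx cgy; apply: pdiffZ.
  apply: (pdiff_seg_int pi2 oV) => //.
  - by apply: mix_cont => // w /dfg[/pdiff_continuous ? /pdiff_continuous ?].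
  - exact: mix_cont.
  - exact: mix_cont.
  - move=> w t Vw _; have [df dg] := dfg _ (VDr w t Vw).
    have d1 := pdiffD (pdiff_fst w) (pdiff_cst (r * cos t) w).
    have d2 := pdiffD (pdiff_snd w) (pdiff_cst (r * sin t) w).
    have D1 := pdiffM (pdiff_comp d1 d2 df) (pdiff_cst (cos t) w).
    have D2 := pdiffM (pdiff_comp d1 d2 dg) (pdiff_cst (sin t) w).
    by apply: pdiff_eq (pdiffD D1 D2) _ _; rewrite /mix /polar; ring.
have nV := open_nbhs_nbhs (conj oV Vz).
have cN (f : R * R -> R) : (forall w, D w -> {for w, continuous f}) ->
    forall w, D w -> {for w, continuous (fun y => - f y)}.
  by move=> cf w /cf; exact: cvgN.
(* Each of the two partial derivatives under the integral sign is the circle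
  integral of the pair (ux, vx) or (- vx, ux): the Cauchy-Riemann equations again. *)
have d1 := pdiffmix _ _ _ _ _ _ cr cux (cN _ cvx) cvx cux.
have d2 := pdiffmix _ _ _ _ _ _ rot cvx (cN _ (cN _ cux)) (cN _ cux) cvx.
exists ((pi *+ 2 * r)^-1 * seg_int 0 (pi *+ 2) (mix ux vx r z),
        (pi *+ 2 * r)^-1 * seg_int 0 (pi *+ 2) (mix vx (fun w => - ux w) r z)) => _ /=.
split.
  apply: pdiff_eq (pdiff_near (mix_near r V _ _ _ _ z cr r0 oV Vz VD) d1) erefl _.
  rewrite -mulrN; congr (_ * _); rewrite -mulN1r -seg_intZ.
    by apply: eq_seg_int => t _; rewrite /mix; ring.
  apply: (@joint_cont_on _ _ _ V) => //.
  by apply: mix_cont => //; exact: cN.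
apply: pdiff_eq (pdiff_near (mix_near r V _ _ _ _ z rot r0 oV Vz VD) d2) erefl _.
by congr (_ * _); apply: eq_seg_int => t _; rewrite /mix opprK.
Qed.

End CauchyRiemann.

(** * The derivatives of a stem function *)

Section Tower.
Variable R : realType.
Implicit Types (D : set (R * R)) (u v : R * R -> R).

(** One real coordinate of the condition on stem functions. *)
Definition stem_pair D u v := forall z, D z ->
  u (cconj z) = u z /\ v (cconj z) = - v z.

Lemma stem_pair_derivative D u v ux vx : open D -> conj_invariant D -> CR D u v ux vx ->
  stem_pair D u v -> stem_pair D ux vx.
Proof.
move=> oD cD cr st z Dz; have [du _] := cr _ (cD _ Dz).
have d2 := pdiffZ (-1) (pdiff_snd z).
have sndN : (z.1, -1 * z.2) = cconj z by rewrite mulN1r.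
rewrite -sndN in du; have := pdiff_comp (pdiff_fst z) d2 du; rewrite sndN => H.
have nD := open_nbhs_nbhs (conj oD Dz).
have E : \forall w \near z, u (w.1, -1 * w.2) = u w.
  by apply: filterS nD => w Dw; rewrite mulN1r; have [] := st w Dw.
have [] := pdiff_unique (pdiff_near E H) (cr _ Dz).1.
rewrite !mulr1 !mulr0 !addr0 add0r mulrN1 opprK => -> ->; split=> //.
Qed.

Lemma CR_iterated_derivatives D u v ux vx : open D -> conj_invariant D -> CR D u v ux vx ->
  stem_pair D u v -> exists U V : nat -> R * R -> R,
  [/\ U 0%N = u, V 0%N = v, forall n, CR D (U n) (V n) (U n.+1) (V n.+1) &
      forall n, stem_pair D (U n) (V n)].
Proof.
move=> oD cD cr st; pose T := ((R * R -> R) * (R * R -> R))%type.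
have step (p : T * T) : exists q : T, CR D p.1.1 p.1.2 p.2.1 p.2.2 ->
    CR D p.2.1 p.2.2 q.1 q.2.
  have [/(CR_derivative oD)[a [b ab]]|?] := pselect (CR D p.1.1 p.1.2 p.2.1 p.2.2).
    by exists (a, b).
  by exists (u, v).
have [next Hnext] := choice step.
pose s n := iter n (fun p : T * T => (p.2, next p)) ((u, v), (ux, vx)).
have Hs n : CR D (s n).1.1 (s n).1.2 (s n).2.1 (s n).2.2.
  by elim: n => [|n IH] //; exact: Hnext.
exists (fun n => (s n).1.1), (fun n => (s n).1.2); split => // n.
by elim: n => [|n IH] //; exact: stem_pair_derivative (Hs n) IH.
Qed.

End Tower.

(** * Functions of class C^k *)

Section Smooth.
Variables (R : realType) (V W : normedModType R).
Implicit Types (U : set V) (g : V -> W).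

(** [class_C] only asks for derivatives along lines.  Requiring continuity at
  every order as well makes the class stable under products and composition by
  a plain induction on [k]. *)
Fixpoint smooth k U g : Prop :=
  (forall x, U x -> {for x, continuous g}) /\
  if k is k'.+1 then
    (forall x v, U x -> derivable g x v) /\ forall v, smooth k' U ('D_v g)
  else True.

Lemma smooth_continuous k U g x : smooth k U g -> U x -> {for x, continuous g}.
Proof. by case: k => [|k] [cg _] /cg. Qed.

Lemma smooth_pred k U g : smooth k.+1 U g -> smooth k U g.
Proof.
elim: k U g => [|k IH] U g [cg [dg sg]]; first by split.
by split => //; split => // v; exact: IH.
Qed.

Lemma smooth_D k U g v : smooth k.+1 U g -> smooth k U ('D_v g).
Proof. by move=> [_ [_ sg]]; exact: sg. Qed.

Lemma smooth_class_C k U g : smooth k U g -> class_C k U g.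
Proof.
elim: k g => [|k IH] g; first by case.
by move=> [_ [dg sg]]; split=> [|v]; [exact: dg|exact: IH (sg v)].
Qed.

Lemma smooth_local k U g : (forall x, U x -> exists2 U', U' x & smooth k U' g) ->
  smooth k U g.
Proof.
elim: k g => [|k IH] g H.
  by split => // x /H[U' U'x [cg _]]; exact: cg.
split; first by move=> x /H[U' U'x [cg _]]; exact: cg.
split; first by move=> x v /H[U' U'x [_ [dg _]]]; exact: dg.
by move=> v; apply: IH => x /H[U' U'x [_ [_ sg]]]; exists U' => //; exact: sg.
Qed.

Lemma near_eq_continuous g g' x : (\forall y \near x, g y = g' y) ->
  {for x, continuous g} -> {for x, continuous g'}.
Proof.
move=> nE cg; have c : g @ x --> g' x by rewrite -(nbhs_singleton nE); exact: cg.
exact: cvg_trans (near_eq_cvg nE) c.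
Qed.

Lemma smooth_eq k U g g' : open U -> (forall x, U x -> g x = g' x) ->
  smooth k U g -> smooth k U g'.
Proof.
move=> oU; elim: k g g' => [|k IH] g g' E [cg sg].
  split => // x Ux; apply: near_eq_continuous (cg x Ux).
  by apply: filterS (open_nbhs_nbhs (conj oU Ux)) => y; exact: E.
have nE x : U x -> \forall y \near x, g y = g' y.
  by move=> Ux; apply: filterS (open_nbhs_nbhs (conj oU Ux)) => y; exact: E.
case: sg => dg sg.
split; first by move=> x Ux; exact: near_eq_continuous (nE x Ux) (cg x Ux).
split; first by move=> x v Ux; exact: near_eq_derivable (nE x Ux) (dg x v Ux).
by move=> v; apply: IH (sg v) => x Ux; exact: near_eq_derive (nE x Ux).
Qed.

(** The induction step used throughout: exhibit the directional derivatives
  as functions already known to be of class C^k. *)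
Lemma smooth_derive k U g : open U -> (forall x, U x -> {for x, continuous g}) ->
  (forall v, exists2 dg, (forall x, U x -> is_derive x v g (dg x)) & smooth k U dg) ->
  smooth k.+1 U g.
Proof.
move=> oU cg H; split => //; split.
  by move=> x v Ux; have [dg Hdg _] := H v; case: (Hdg x Ux).
move=> v; have [dg Hdg sdg] := H v; apply: smooth_eq oU _ sdg => x Ux.
by case: (Hdg x Ux).
Qed.

Lemma smooth_is_derive k U g x v : smooth k.+1 U g -> U x ->
  is_derive x v g ('D_v g x).
Proof. by move=> [_ [dg _]] Ux; apply: derivableP; exact: dg. Qed.

Lemma smooth_cst k U (c : W) : open U -> smooth k U (fun=> c).
Proof.
move=> oU; elim: k c => [|k IH] c; first by split => // x _; exact: cvg_cst.
apply: smooth_derive => //; first by move=> x _; exact: cvg_cst.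
by move=> v; exists (fun=> 0) => // x _; exact: is_derive_cst.
Qed.

Lemma smoothD k U g g' : open U -> smooth k U g -> smooth k U g' ->
  smooth k U (fun x => g x + g' x).
Proof.
move=> oU; elim: k g g' => [|k IH] g g' sg sg'.
  by split => // x Ux; apply: cvgD; [exact: (smooth_continuous sg)|exact: (smooth_continuous sg')].
apply: smooth_derive => //.
  by move=> x Ux; apply: cvgD; [exact: (smooth_continuous sg)|exact: (smooth_continuous sg')].
move=> v; exists (fun x => 'D_v g x + 'D_v g' x).
  by move=> x Ux; apply: is_deriveD; [exact: (smooth_is_derive _ sg)|exact: (smooth_is_derive _ sg')].
by apply: IH; exact: smooth_D.
Qed.

End Smooth.

Section SmoothReal.
Variables (R : realType) (V : normedModType R).
Implicit Types (U : set V) (f g : V -> R).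

Lemma smoothM k U f g : open U -> smooth k U f -> smooth k U g ->
  smooth k U (fun x => f x * g x).
Proof.
move=> oU; elim: k f g => [|k IH] f g sf sg.
  by split => // x Ux; apply: cvgM; [exact: (smooth_continuous sf)|exact: (smooth_continuous sg)].
apply: smooth_derive => //.
  by move=> x Ux; apply: cvgM; [exact: (smooth_continuous sf)|exact: (smooth_continuous sg)].
move=> v; exists (fun x => f x * 'D_v g x + g x * 'D_v f x).
  by move=> x Ux; apply: is_deriveM; [exact: (smooth_is_derive _ sf)|exact: (smooth_is_derive _ sg)].
have [dsf dsg] : smooth k U ('D_v f) /\ smooth k U ('D_v g).
  by split; exact: smooth_D.
by apply: smoothD => //; apply: IH => //; exact: smooth_pred.
Qed.

Lemma smoothN k U f : open U -> smooth k U f -> smooth k U (fun x => - f x).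
Proof.
move=> oU sf; apply: (@smooth_eq _ _ _ _ _ (fun x => -1 * f x)) => //.
  by move=> x _; rewrite mulN1r.
by apply: smoothM => //; exact: smooth_cst.
Qed.

Lemma smoothV k U f : open U -> (forall x, U x -> f x != 0) -> smooth k U f ->
  smooth k U (fun x => (f x)^-1).
Proof.
move=> oU f0; elim: k f f0 => [|k IH] f f0 sf.
  by split => // x Ux; apply: cvgV; [exact: f0|exact: (smooth_continuous sf)].
apply: smooth_derive => //.
  by move=> x Ux; apply: cvgV; [exact: f0|exact: (smooth_continuous sf)].
move=> v; exists (fun x => - ('D_v f x * ((f x)^-1 * (f x)^-1))).
  move=> x Ux; rewrite -invfM -expr2; apply: is_derive_invf; first exact: f0.
  exact: (smooth_is_derive _ sf).
have dsf : smooth k U ('D_v f) by exact: smooth_D.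
apply: smoothN => //; apply: smoothM => //; apply: smoothM => //; apply: IH => //; exact: smooth_pred.
Qed.

End SmoothReal.

Section SmoothMatrix.
Variables (R : realType) (V : normedModType R) (m n : nat).

Lemma is_derive_mx (g : V -> 'M[R]_(m, n)) (dg : 'M[R]_(m, n)) x v :
  (forall i j, is_derive x v (fun y => g y i j) (dg i j)) ->
  is_derive x v g dg.
Proof.
move=> H; have dx : derivable g x v by apply/derivable_mxP => i j; case: (H i j).
apply: DeriveDef => //; rewrite derive_mx//; apply/matrixP => i j; rewrite mxE.
by case: (H i j).
Qed.

Lemma continuous_mx (g : V -> 'M[R]_(m, n)) x :
  (forall i j, {for x, continuous (fun y => g y i j)}) -> {for x, continuous g}.
Proof.
move=> H; apply/cvgrPdist_le => /= e e0; near=> y.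
rewrite /Num.Def.normr/= mx_normrE (bigmax_le _ (ltW e0))//= => i _.
rewrite !mxE/=.
move: i; near: y; apply: filter_forall => /= i.
exact: ((cvgrPdist_le _ _).1 (H i.1 i.2)).
Unshelve. all: by end_near. Qed.

Lemma smooth_mx k (U : set V) (g : V -> 'M[R]_(m, n)) : open U ->
  (forall i j, smooth k U (fun y => g y i j)) -> smooth k U g.
Proof.
move=> oU; elim: k g => [|k IH] g H.
  by split => // x Ux; apply: continuous_mx => i j; exact: (smooth_continuous (H i j)).
apply: smooth_derive => //.
  by move=> x Ux; apply: continuous_mx => i j; exact: (smooth_continuous (H i j)).
move=> v; exists (fun x => \matrix_(i, j) 'D_v (fun y => g y i j) x).
  move=> x Ux; apply: is_derive_mx => i j; rewrite mxE.
  exact: (smooth_is_derive _ (H i j)).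
apply: IH => i j; rewrite (_ : (fun _ => _) = 'D_v (fun y => g y i j)).
  by apply: smooth_D; exact: H.
by apply/funext => x; rewrite mxE.
Qed.

Lemma smooth_coord_mx k (U : set V) (g : V -> 'M[R]_(m, n)) i j : open U ->
  smooth k U g -> smooth k U (fun y => g y i j).
Proof.
have cc (h : V -> 'M[R]_(m, n)) x : {for x, continuous h} -> {for x, continuous (fun y => h y i j)}.
  move=> ch; exact: (continuous_comp ch (@coord_continuous _ _ _ i j _)).
move=> oU; elim: k g => [|k IH] g sg.
  by split => // x Ux; exact/cc/(smooth_continuous sg).
apply: smooth_derive => //; first by move=> x Ux; exact/cc/(smooth_continuous sg).
move=> v; exists (fun x => 'D_v g x i j); last by apply: IH; exact: smooth_D.
move=> x Ux; have dg : derivable g x v by case: sg => _ [dg _]; exact: dg.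
apply: DeriveDef; first by move/derivable_mxP: dg.
by rewrite derive_mx// mxE.
Qed.

End SmoothMatrix.

(** * The meridian half-plane of R^4 *)

Section Directional.
Variables (R : realType) (V W : normedModType R).

(** A directional derivative is an ordinary derivative along a line; the chain
  rules reduce to those for curves. *)
Lemma is_derive_lineP (F : V -> W) x v d :
  is_derive x v F d <-> is_derive (0 : R) 1 (fun t => F (t *: v + x)) d.
Proof.
have E : (fun h => h^-1 *: (F (h *: v + x) - F x)) =
    (fun h : R => h^-1 *: (((fun t => F (t *: v + x)) \o shift 0) (h *: 1) - F (0 *: v + x))).
  by apply/funext => h /=; rewrite addr0 scale0r add0r /GRing.scale /= mulr1.
split=> -[dF dE]; apply: DeriveDef.
- by move/derivable1P : dF.
- by rewrite -dE /derive /= -E.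
- exact/derivable1P.
- by rewrite -dE /derive /= -E.
Qed.

End Directional.

Section DirectionalChain.
Variables (R : realType) (V W : normedModType R).

Lemma is_derive_pdiff (u : R * R -> R) (g1 g2 : V -> R) x v d1 d2 a b :
  is_derive x v g1 d1 -> is_derive x v g2 d2 -> pdiff u (g1 x, g2 x) a b ->
  is_derive x v (fun y => u (g1 y, g2 y)) (a * d1 + b * d2).
Proof.
move=> /is_derive_lineP D1 /is_derive_lineP D2 du; apply/is_derive_lineP.
by apply: (pdiff_curve D1 D2); rewrite !scale0r !add0r.
Qed.

Lemma is_derive_comp1 (f : R -> R) (g : V -> R) x v (d : R) dg :
  is_derive (g x) 1 f d -> is_derive x v g dg ->
  is_derive x v (fun y => f (g y)) (d * dg).
Proof.
move=> df dgx.
have du := pdiff_comp1 (u := fst) (z := (g x, 0)) df (pdiff_fst _).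
by apply: (is_derive_eq (is_derive_pdiff dgx (is_derive_cst 0 x v) du)); rewrite mulr0 addr0 mulr1.
Qed.

Lemma is_derive_sumf n (h : 'I_n -> V -> W) (dh : 'I_n -> W) x v :
  (forall i, is_derive x v (h i) (dh i)) ->
  is_derive x v (fun y => \sum_(i < n) h i y) (\sum_(i < n) dh i).
Proof.
move=> H; rewrite (_ : (fun y => _) = \sum_(i < n) h i); first exact: is_derive_sum.
by apply/funext => y; rewrite fct_sumE.
Qed.

Lemma is_derive0_eps (F : R -> R) (d : R) :
  (forall e, 0 < e -> \forall t \near (0 : R), `|F t - F 0 - t * d| <= e * `|t|) ->
  is_derive (0 : R) 1 F d.
Proof.
move=> H.
have lin : linear (fun t : R => t * d) by move=> k s t; rewrite mulrDl -scalerAl.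
pose linM := GRing.isLinear.Build _ _ _ _ _ lin.
pose L : {linear _ -> _} := HB.pack (fun t : R => t * d) linM.
have Lc : continuous L by move=> t; apply: cvgM; [exact: cvg_id|exact: cvg_cst].
have [|dF dE] := @is_diff_near R _ _ F 0 L Lc.
  by move=> e /H; apply: filterS => t; rewrite addr0.
apply: DeriveDef; first exact/derivable1_diffP.
by rewrite deriveE// dE /= mul1r.
Qed.

End DirectionalChain.

Section Meridian.
Variable R : realType.
Implicit Types (x w : 'rV[R]_4) (g : R * R -> R).

Definition vcoord x (i : 'I_3) : R := x 0 (lift ord0 i).
Definition vdot w x : R := \sum_(i < 3) vcoord w i * vcoord x i.
Definition vnorm x : R := Num.sqrt (vdot x x).
(** The point [(a, b)] for [x = a + b I]. *)
Definition meridian x : R * R := (x 0 0, vnorm x).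

Lemma vdot_ge0 x : 0 <= vdot x x.
Proof. by apply: sumr_ge0 => i _; rewrite -expr2 sqr_ge0. Qed.

Lemma vnorm_ge0 x : 0 <= vnorm x. Proof. exact: sqrtr_ge0. Qed.

Lemma vnorm_sqr x : vnorm x ^+ 2 = vdot x x.
Proof. by rewrite sqr_sqrtr// vdot_ge0. Qed.

Lemma vnorm_eq0 x : vnorm x = 0 -> forall i, vcoord x i = 0.
Proof.
move=> x0 i; have := vnorm_sqr x; rewrite x0 expr0n /= => /esym/psumr_eq0P H.
have /eqP : vcoord x i * vcoord x i = 0.
  by apply: H => // j _; rewrite -expr2 sqr_ge0.
by rewrite mulf_eq0 orbb => /eqP.
Qed.

Lemma is_derive_coord m n (x w : 'M[R]_(m, n)) i j :
  is_derive x w (fun y : 'M[R]_(m, n) => y i j) (w i j).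
Proof.
have D : derivable (id : 'M[R]_(m, n) -> 'M[R]_(m, n)) x w by exact: derivable_id.
apply: DeriveDef; first by move/derivable_mxP: D => /(_ i j).
by rewrite -[in RHS](derive_id x w) derive_mx// mxE.
Qed.

Lemma is_derive_vcoord x w i : is_derive x w (fun y => vcoord y i) (vcoord w i).
Proof. exact: is_derive_coord. Qed.

Lemma is_derive_vdot x w : is_derive x w (fun y => vdot y y) (2 * vdot w x).
Proof.
rewrite (_ : 2 * vdot w x = \sum_(i < 3) (vcoord x i *: vcoord w i + vcoord x i *: vcoord w i)).
  apply: is_derive_sumf => i.
  exact: (is_deriveM (is_derive_vcoord x w i) (is_derive_vcoord x w i)).
rewrite mulr_sumr; apply: eq_bigr => i _; rewrite /GRing.scale /=; ring.
Qed.

Lemma is_derive_vnorm x w : vnorm x != 0 -> is_derive x w vnorm (vdot w x / vnorm x).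
Proof.
move=> x0; have d0 : 0 < vdot x x by rewrite -vnorm_sqr exprn_gt0// lt_def x0 vnorm_ge0.
have -> : vdot w x / vnorm x = (2 * vnorm x)^-1 * (2 * vdot w x) by field.
exact: (@is_derive_comp1 _ _ _ (fun y => vdot y y) x w _ _
  (is_derive1_sqrt d0) (is_derive_vdot x w)).
Qed.

Lemma vnormZ (t : R) x : vnorm (t *: x) = `|t| * vnorm x.
Proof.
rewrite /vnorm (_ : vdot _ _ = t ^+ 2 * vdot x x); first by rewrite sqrtrM ?sqr_ge0// sqrtr_sqr.
by rewrite mulr_sumr; apply: eq_bigr => i _; rewrite /vcoord !mxE; ring.
Qed.

Lemma vnorm_continuous : continuous vnorm.
Proof.
move=> x; apply: (@continuous_comp _ _ _ (fun y => vdot y y) Num.sqrt); last exact: sqrt_continuous.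
have cs i : {for x, continuous (fun y => vcoord y i * vcoord y i)}.
  have c : {for x, continuous (fun y : 'rV[R]_4 => y 0 (lift ord0 i))}.
    exact: (@coord_continuous _ _ _ _ _ x).
  exact: (cvgM c c).
rewrite (_ : (fun y => _) = (fun y => vcoord y 0 * vcoord y 0 +
  (vcoord y 1 * vcoord y 1 + vcoord y 2 * vcoord y 2))).
  exact: cvgD (cs _) (cvgD (cs _) (cs _)).
apply/funext => y; rewrite /vdot !big_ord_recl big_ord0 addr0.
by congr (_ + (_ + _)); congr (_ * _); congr (vcoord y _); exact/val_inj.
Qed.

Lemma meridian_continuous : continuous meridian.
Proof.
move=> x; have c : {for x, continuous (fun y : 'rV[R]_4 => y 0 0)}.
  exact: (@coord_continuous _ _ _ _ _ x).
exact: (cvg_pairP c (@vnorm_continuous x)).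
Qed.

(** On the axis [vnorm] is not differentiable, but there the hypothesis says that
  the second partial derivative of [g] vanishes, and [vnorm] is Lipschitz: its
  contribution is of second order. *)
Lemma is_derive_meridian g x w a b : pdiff g (meridian x) a (vnorm x * b) ->
  is_derive x w (fun y => g (meridian y)) (w 0 0 * a + vdot w x * b).
Proof.
move=> dg; have [x0|x0] := eqVneq (vnorm x) 0; last first.
  apply: (is_derive_eq (is_derive_pdiff (is_derive_coord x w 0 0) (is_derive_vnorm w x0) dg)).
  by field.
apply/is_derive_lineP/is_derive0_eps => e e0.
have xs := vnorm_eq0 x0.
have -> : vdot w x = 0 by rewrite /vdot big1// => i _; rewrite xs mulr0.
have nw t : vnorm (t *: w + x) = `|t| * vnorm w.
  rewrite -vnormZ /vnorm; congr Num.sqrt; apply: eq_bigr => i _.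
  by move: (xs i); rewrite /vcoord !mxE => ->; rewrite addr0.
rewrite x0 mul0r in dg; pose C := `|w 0 0| + vnorm w + 1.
have C0 : 0 < C by rewrite ltr_wpDl// addr_ge0// vnorm_ge0.
have eC : 0 < e / C by rewrite divr_gt0.
have /nbhs_ballP[r /= r0 Hr] := (pdiffP _ _ _ _).1 dg _ eC.
have rC : 0 < r / C by rewrite divr_gt0.
have nt : \forall t \near (0 : R), `|t| < r / C by exact: nbhs0_lt.
near=> t; pose h : R * R := (t * w 0 0, `|t| * vnorm w).
have hE : meridian (t *: w + x) = h + meridian x.
  by rewrite /meridian nw x0 /h !mxE; congr (_, _); rewrite addr0.
have hC : `|h| <= C * `|t|.
  rewrite prod_normE /= ge_max !normrM normr_id [C * _]mulrC (ger0_norm (vnorm_ge0 w)).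
  have := vnorm_ge0 w; have := normr_ge0 (w 0 0) => w00 nw0.
  by rewrite !ler_wpM2l// /C; lra.
have hr : `|h| < r.
  apply: le_lt_trans hC _; by rewrite mulrC -ltr_pdivlMr//; near: t.
have := Hr h; rewrite -ball_normE /= sub0r normrN => /(_ hr).
rewrite scale0r add0r hE /plin /= mul0r !addr0 mulrCA.
rewrite mul0r addr0 [w 0 0 * a]mulrC => /le_trans; apply.
by rewrite mulrAC ler_pdivrMr// -mulrA ler_wpM2l ?(ltW e0)// mulrC.
Unshelve. all: by end_near. Qed.

End Meridian.

(** * Averages along segments from the real axis *)

Section AxialWeights.
Variables (R : realType) (E : set (R * R)).
Hypothesis openE : open E.
Implicit Types (phi : R -> R) (f fx fy : R * R -> R) (z : R * R).

Definition squeeze (z : R * R) (t : R) : R * R := (z.1, t * z.2).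

Hypothesis starE : forall z t, E z -> 0 <= t <= 1 -> E (squeeze z t).

Definition axis_avg (phi : R -> R) (f : R * R -> R) (z : R * R) : R :=
  seg_int 0 1 (fun t => phi t * f (squeeze z t)).

Lemma squeeze_continuous : continuous (fun p : (R * R) * R => squeeze p.1 p.2).
Proof.
move=> [z t].
have c1 : p.1.1 @[p --> (z, t)] --> z.1.
  by apply: (@continuous_comp _ _ _ fst fst (z, t)); exact: cvg_fst.
have c2 : p.1.2 @[p --> (z, t)] --> z.2.
  by apply: (@continuous_comp _ _ _ fst snd (z, t)); [exact: cvg_fst|exact: cvg_snd].
have ct : p.2 @[p --> (z, t)] --> t by exact: cvg_snd.
exact: (cvg_pairP c1 (cvgM ct c2)).
Qed.

Lemma axis_joint_cont phi f : continuous phi -> (forall z, E z -> {for z, continuous f}) ->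
  joint_cont 0 1 E (fun z t => phi t * f (squeeze z t)).
Proof.
move=> cphi cf z t Ez t01; apply: cvgM.
  by apply: (@continuous_comp _ _ _ snd phi (z, t)); [exact: cvg_snd|exact: cphi].
apply: (@continuous_comp _ _ _ (fun p : (R * R) * R => squeeze p.1 p.2) f (z, t)).
  exact: squeeze_continuous.
by apply: cf; exact: starE.
Qed.

Lemma axis_cont_on phi f z : continuous phi -> (forall z, E z -> {for z, continuous f}) ->
  E z -> cont_on 0 1 (fun t => phi t * f (squeeze z t)).
Proof.
by move=> cphi cf Ez; exact: (joint_cont_on (axis_joint_cont cphi cf) Ez).
Qed.

Lemma pdiff_axis_avg phi f fx fy z : continuous phi ->
  (forall z, E z -> pdiff f z (fx z) (fy z)) ->
  (forall z, E z -> {for z, continuous fx}) ->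
  (forall z, E z -> {for z, continuous fy}) -> E z ->
  pdiff (axis_avg phi f) z (axis_avg phi fx z) (axis_avg (fun t => phi t * t) fy z).
Proof.
move=> cphi df cfx cfy Ez.
have cphit : continuous (fun t => phi t * t).
  by move=> t; apply: cvgM; [exact: cphi|exact: cvg_id].
apply: (@pdiff_seg_int _ 0 1 ler01 E openE (fun z t => phi t * f (squeeze z t))
  (fun z t => phi t * fx (squeeze z t)) (fun z t => phi t * t * fy (squeeze z t))) => //.
- by apply: axis_joint_cont => // w /df/pdiff_continuous.
- exact: axis_joint_cont.
- exact: axis_joint_cont.
- move=> w t Ew t01.
  have D1 := pdiff_comp (pdiff_fst w) (pdiffZ t (pdiff_snd w)) (df _ (starE Ew t01)).
  by apply: pdiff_eq (pdiffZ (phi t) D1) _ _; rewrite /squeeze; ring.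
Qed.

Variables (u v : R * R -> R) (ux vx : R * R -> R).
Hypothesis cr : CR E u v ux vx.
Hypothesis oddv : forall z, E z -> v (squeeze z 0) = 0.
Hypothesis cux : forall z, E z -> {for z, continuous ux}.

Let cv z : E z -> {for z, continuous v}.
Proof. by move=> /cr[_ /pdiff_continuous]. Qed.

Let dv z (t : R) : E z -> 0 <= t <= 1 ->
  is_derive t 1 (fun s => v (squeeze z s)) (z.2 * ux (squeeze z t)).
Proof.
move=> Ez t01; have [_ dv] := cr (starE Ez t01).
have d2 : is_derive t 1 (fun s : R => s * z.2) z.2.
  rewrite (_ : (fun s : R => _) = (fun s => s * z.2 + 0)); first exact: is_derive_affine.
  by apply/funext => s; rewrite addr0.
apply: (is_derive_eq (pdiff_curve (is_derive_cst z.1 t 1) d2 dv)).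
by rewrite mulr0 add0r mulrC.
Qed.

Let cpow n : continuous (fun t : R => t ^+ n).
Proof. exact: exprn_continuous. Qed.

(** Fundamental theorem of calculus along [squeeze z]; the weight [t ^+ 0] is
  written so as to belong to the family of [axis_avg_parts]. *)
Lemma axis_avg_odd z : E z -> v z = z.2 * axis_avg (fun t => t ^+ 0) ux z.
Proof.
move=> Ez; rewrite /axis_avg -seg_intZ; last exact: axis_cont_on.
have -> : seg_int 0 1 (fun t => z.2 * (t ^+ 0 * ux (squeeze z t))) =
    v (squeeze z 1) - v (squeeze z 0).
  apply: (@seg_int_deriv _ _ _ (fun s => v (squeeze z s))) => [//|t t01|t t01].
    by rewrite expr0 mul1r; exact: dv.
  have c := axis_cont_on (@cpow 0%N) cux Ez t01.
  exact: (cvgM (cvg_cst z.2) c).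
by rewrite (oddv Ez) subr0 /squeeze mul1r; case: (z).
Qed.

(** Integration by parts against [1 - t^(m+2)].  The explicit factor [z.2] on
  the right is what [is_derive_meridian] requires. *)
Lemma axis_avg_parts m z : E z ->
  m.+2%:R * axis_avg (fun t => t ^+ m.+1) v z =
  z.2 * (axis_avg (fun t => t ^+ 0) ux z - axis_avg (fun t => t ^+ m.+2) ux z).
Proof.
move=> Ez.
have cz n f : (forall z, E z -> {for z, continuous f}) ->
    cont_on 0 1 (fun t => t ^+ n * f (squeeze z t)).
  by move=> cf; apply: axis_cont_on.
have cB (f g : R -> R) : cont_on 0 1 f -> cont_on 0 1 g -> cont_on 0 1 (fun t => f t - g t).
  by move=> cf cg t t01; apply: cvgB; [exact: cf|exact: cg].
have cZ (k : R) (f : R -> R) : cont_on 0 1 f -> cont_on 0 1 (fun t => k * f t).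
  by move=> cf t t01; apply: cvgM; [exact: cvg_cst|exact: cf].
rewrite /axis_avg -seg_intB; try exact: cz.
rewrite -!seg_intZ; [|exact: (cB _ _ (cz _ _ cux) (cz _ _ cux))|exact: cz].
apply/esym/eqP; rewrite -subr_eq0 -seg_intB; last 2 first.
- by apply: (cZ _ _ (cB _ _ (cz _ _ cux) (cz _ _ cux))).
- exact: (cZ _ _ (cz _ _ cv)).
set g := (X in seg_int _ _ X).
have -> : seg_int 0 1 g =
    (1 - 1 ^+ m.+2) * v (squeeze z 1) - (1 - 0 ^+ m.+2) * v (squeeze z 0).
  apply: (@seg_int_deriv _ _ _ (fun t => (1 - t ^+ m.+2) * v (squeeze z t))) => [//|t t01|].
  - have d1 : is_derive t 1 (fun s : R => 1 - s ^+ m.+2) (- (m.+2%:R * t ^+ m.+1)).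
      have -> : (fun s : R => 1 - s ^+ m.+2) = cst 1 - id ^+ m.+2.
        by apply/funext => s; rewrite !fctE.
      apply: is_derive_eq.
      by rewrite sub0r /GRing.scale /= mulr1 mulr_natl.
    apply: (is_derive_eq (is_deriveM d1 (dv Ez t01))).
    by rewrite /g /GRing.scale /= expr0; ring.
  - apply: (cB); first by apply: (cZ _ _ (cB _ _ (cz _ _ cux) (cz _ _ cux))).
    exact: (cZ _ _ (cz _ _ cv)).
by rewrite expr1n subrr mul0r (oddv Ez) mulr0 subr0.
Qed.

End AxialWeights.

(** * Smoothness of axial functions across the real axis *)

Section SmoothAxial.
Variable R : realType.
Local Notation V4 := 'rV[R]_4.

Lemma smooth_sum (V W : normedModType R) n (h : 'I_n -> V -> W) k (S : set V) : open S ->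
  (forall i, smooth k S (h i)) -> smooth k S (fun x => \sum_(i < n) h i x).
Proof.
move=> oS; elim: n h => [|n IH] h sh.
  rewrite (_ : (fun x => _) = (fun=> 0)); first exact: smooth_cst.
  by apply/funext => x; rewrite big_ord0.
rewrite (_ : (fun x => _) = (fun x => h ord0 x + \sum_(i < n) h (lift ord0 i) x)).
  by apply: smoothD => //; apply: IH.
by apply/funext => x; rewrite big_ord_recl.
Qed.

Lemma smooth_coord m n k (S : set 'M[R]_(m, n)) i j : open S ->
  smooth k S (fun x : 'M[R]_(m, n) => x i j).
Proof.
move=> oS; have cc (x : 'M[R]_(m, n)) : {for x, continuous (fun y : 'M[R]_(m, n) => y i j)}.
  exact: (@coord_continuous _ _ _ i j x).
case: k => [|k]; first by split.
apply: smooth_derive => // v; exists (fun=> v i j); last exact: smooth_cst.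
by move=> x _; exact: is_derive_coord.
Qed.

Lemma smooth_vdot k (S : set V4) (w : V4) : open S -> smooth k S (vdot w).
Proof.
move=> oS; apply: (@smooth_sum _ _ _ (fun i x => vcoord w i * vcoord x i)) => // i.
by apply: smoothM => //; [exact: smooth_cst|exact: smooth_coord].
Qed.

Lemma smooth_sqvnorm k (S : set V4) : open S -> smooth k S (fun x => vdot x x).
Proof.
move=> oS; apply: (@smooth_sum _ _ _ (fun i x => vcoord x i * vcoord x i)) => // i.
by apply: smoothM => //; exact: smooth_coord.
Qed.

Variables (D : set (R * R)) (U V : nat -> R * R -> R).
Hypothesis openD : open D.
Hypothesis crUV : forall n, CR D (U n) (V n) (U n.+1) (V n.+1).
Hypothesis stemUV : forall n, stem_pair D (U n) (V n).

(** The part of R^4 whose meridian points lie in [D]; for a conjugation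
  invariant [D] this is the trace of the circularization, see
  [circularization_axial]. *)
Definition axial : set V4 := @meridian R @^-1` D.

Lemma open_preim_meridian (E : set (R * R)) : open E -> open (@meridian R @^-1` E).
Proof. by move=> oE; apply: open_comp => // x _; exact: meridian_continuous. Qed.

Let cU n z : D z -> {for z, continuous (U n)}.
Proof. by move=> /crUV - /(_ n)[/pdiff_continuous]. Qed.

Let cV n z : D z -> {for z, continuous (V n)}.
Proof. by move=> /crUV - /(_ n)[_ /pdiff_continuous]. Qed.

(** [V / b], continued to the axis by the derivative of [V] with respect to
  [b], which is [U n.+1] by the Cauchy-Riemann equations. *)
Definition sphere_quot n (z : R * R) : R :=
  if z.2 == 0 then U n.+1 z else V n z / z.2.

Section NearAxis.
Variable E : set (R * R).
Hypotheses (openE : open E) (ED : E `<=` D).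
Hypothesis starE : forall z (t : R), E z -> 0 <= t <= 1 -> E (squeeze z t).

Let avg m n : R * R -> R := axis_avg (fun t => t ^+ m) (U n).
Let crE n : CR E (U n) (V n) (U n.+1) (V n.+1).
Proof. by move=> z /ED; exact: crUV. Qed.
Let cUE n z : E z -> {for z, continuous (U n)}.
Proof. by move=> /ED; exact: cU. Qed.
Let cpow n : continuous (fun t : R => t ^+ n). Proof. exact: exprn_continuous. Qed.

Let oddV n z : E z -> V n (squeeze z 0) = 0.
Proof.
move=> Ez; have Dz : D (squeeze z 0) by apply: ED; apply: starE => //; rewrite lexx ler01.
have [_] := stemUV n Dz; rewrite /squeeze /cconj mul0r oppr0 => /eqP.
by rewrite -subr_eq0 opprK -mulr2n mulrn_eq0 /= => /eqP.
Qed.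

Let pdiffU n z : E z -> pdiff (U n) z (U n.+1 z) (z.2 * - avg 0 n.+2 z).
Proof.
move=> Ez; have [dU _] := crE n Ez; apply: pdiff_eq dU erefl _.
rewrite (axis_avg_odd starE (crE n.+1) (@oddV n.+1) (@cUE n.+2) Ez).
by rewrite mulrN.
Qed.

Let pdiff_avg m n z : E z -> pdiff (avg m n) z (avg m n.+1 z)
  (z.2 * (- (avg 0 n.+2 z - avg m.+2 n.+2 z) / m.+2%:R)).
Proof.
move=> Ez.
have cVN w : E w -> {for w, continuous (fun y => - V n.+1 y)}.
  by move=> /ED Dw; apply: cvgN; exact: cV.
have H := pdiff_axis_avg openE starE (@cpow m) (fun w Ew => (crE n Ew).1) (@cUE n.+1) cVN Ez.
apply: pdiff_eq H erefl _.
have P := axis_avg_parts starE (crE n.+1) (@oddV n.+1) (@cUE n.+2) m Ez.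
have -> : axis_avg (fun t => t ^+ m * t) (fun y => - V n.+1 y) z =
    - axis_avg (fun t => t ^+ m.+1) (V n.+1) z.
  rewrite /axis_avg -mulN1r -seg_intZ.
    by apply: eq_seg_int => t _; rewrite exprSr mulrN mulN1r.
  by apply: (axis_cont_on starE) => // w /ED; exact: cV.
rewrite -/(avg 0 n.+2) -/(avg m.+2 n.+2) in P.
have M0 : m.+2%:R != 0 :> R by rewrite pnatr_eq0.
apply: (mulfI M0).
by rewrite mulrN P -mulrN [RHS]mulrCA [X in _ = _ * X]mulrC divfK.
Qed.

(** Both families must be treated in one induction: differentiating [U n]
  produces an average, and differentiating an average produces averages with
  other weights. *)
Lemma smooth_near_axis k : (forall n, smooth k (@meridian R @^-1` E) (U n \o @meridian R)) /\
  (forall m n, smooth k (@meridian R @^-1` E) (avg m n \o @meridian R)).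
Proof.
have oS := open_preim_meridian openE.
have contU n x : (@meridian R @^-1` E) x -> {for x, continuous (U n \o @meridian R)}.
  by move=> Ex; apply: continuous_comp; [exact: meridian_continuous|exact: cUE].
have contA m n x : (@meridian R @^-1` E) x -> {for x, continuous (avg m n \o @meridian R)}.
  move=> Ex; apply: continuous_comp; first exact: meridian_continuous.
  exact: pdiff_continuous (pdiff_avg m n Ex).
have s0 k' (w : V4) : smooth k' (@meridian R @^-1` E) (fun=> w 0 0) by exact: smooth_cst.
elim: k => [|k [IHU IHA]]; first by split => *; split => // x; [exact: contU|exact: contA].
split => [n|m n]; apply: smooth_derive => [//|x Ex|w]; try by [exact: contU|exact: contA].
- exists (fun x => w 0 0 * U n.+1 (meridian x) + vdot w x * - avg 0 n.+2 (meridian x)).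
    by move=> x Ex; apply: is_derive_meridian; exact: pdiffU.
  apply: smoothD => //; apply: smoothM => //; first exact: IHU.
    exact: smooth_vdot.
  by apply: smoothN => //; exact: IHA.
- exists (fun x => w 0 0 * avg m n.+1 (meridian x) + vdot w x *
    (- (avg 0 n.+2 (meridian x) - avg m.+2 n.+2 (meridian x)) / m.+2%:R)).
    by move=> x Ex; apply: is_derive_meridian; exact: pdiff_avg.
  apply: smoothD => //; apply: smoothM => //; first exact: IHA.
    exact: smooth_vdot.
  apply: smoothM => //; last exact: smooth_cst.
  apply: smoothN => //; apply: smoothD => //; first exact: IHA.
  by apply: smoothN => //; exact: IHA.
Qed.

(** This represents the quotient by an expression without division by
  [b]. *)
Lemma sphere_quot_avg n z : E z -> sphere_quot n z = avg 0 n.+1 z.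
Proof.
move=> Ez; rewrite /sphere_quot; have [z0|z0] := eqVneq z.2 0; last first.
  rewrite (axis_avg_odd starE (crE n) (@oddV n) (@cUE n.+1) Ez).
  by rewrite mulrAC divff// mul1r.
have -> : avg 0 n.+1 z = seg_int 0 1 (fun=> U n.+1 z).
  apply: eq_seg_int => t _; rewrite expr0 mul1r /squeeze z0 mulr0 -z0.
  by case: (z).
by rewrite seg_int_cst// subr0 mulr1.
Qed.

End NearAxis.

Let open_snd_neq0 : open [set z : R * R | z.2 != 0].
Proof.
rewrite (_ : [set z | _] = snd @^-1` ([set y : R | y != 0]))//.
apply: open_comp; first by move=> z _; exact: cvg_snd.
exact: open_neq.
Qed.

Definition off_axis : set V4 := [set x | axial x /\ vnorm x != 0].

Lemma open_off_axis : open off_axis.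
Proof.
rewrite (_ : off_axis = @meridian R @^-1` (D `&` [set z | z.2 != 0]))//.
by apply: open_preim_meridian; exact: openI.
Qed.

Definition axP n (x : V4) : R := U n (meridian x).
Definition axQ n (x : V4) : R := sphere_quot n (meridian x).

Lemma is_derive_axP n x w : off_axis x ->
  is_derive x w (axP n) (w 0 0 * axP n.+1 x - vdot w x * axQ n.+1 x).
Proof.
move=> [Dx x0]; have [dU _] := crUV n Dx; rewrite -mulrN.
apply: is_derive_meridian; apply: pdiff_eq dU erefl _.
by rewrite /axQ /sphere_quot /= (negbTE x0) mulrN mulrC divfK.
Qed.

Lemma pdiff_sphere_quot n x : off_axis x -> pdiff (sphere_quot n) (meridian x)
  (axQ n.+1 x) (vnorm x * ((axP n.+1 x - axQ n x) / vdot x x)).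
Proof.
move=> [Dx x0]; have [_ dV] := crUV n Dx.
have nz : \forall z \near meridian x, V n z * (z.2)^-1 = sphere_quot n z.
  have nn : nbhs (meridian x) [set z : R * R | z.2 != 0] by exact: open_nbhs_nbhs.
  by apply: filterS nn => z /= z0; rewrite /sphere_quot (negbTE z0).
apply: pdiff_near nz _.
have dinv : is_derive (vnorm x) 1 (fun s : R => s^-1) (- (1 / vnorm x ^+ 2)).
  exact: is_derive_invf.
apply: pdiff_eq (pdiffM dV (pdiff_comp1 dinv (pdiff_snd (meridian x)))) _ _.
  by rewrite /axQ /sphere_quot /= (negbTE x0); field.
by rewrite /axQ /axP /sphere_quot /= (negbTE x0) -vnorm_sqr; field.
Qed.

Lemma is_derive_axQ n x w : off_axis x ->
  is_derive x w (axQ n) (w 0 0 * axQ n.+1 x +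
    vdot w x * ((axP n.+1 x - axQ n x) / vdot x x)).
Proof. by move=> xo; apply: is_derive_meridian; exact: pdiff_sphere_quot. Qed.

Lemma smooth_off_axis k n : smooth k off_axis (axP n) /\ smooth k off_axis (axQ n).
Proof.
have oS := open_off_axis.
have contP m x : off_axis x -> {for x, continuous (axP m)}.
  by move=> [Dx _]; apply: continuous_comp; [exact: meridian_continuous|exact: cU].
have contQ m x : off_axis x -> {for x, continuous (axQ m)}.
  move=> xo; apply: continuous_comp; first exact: meridian_continuous.
  exact: pdiff_continuous (pdiff_sphere_quot m xo).
have s0 k' (w : V4) : smooth k' off_axis (fun=> w 0 0) by exact: smooth_cst.
elim: k n => [|k IH] n.
  by split; split => // x; [exact: contP|exact: contQ].
split; apply: smooth_derive => [//|x xo|w]; try by [exact: contP|exact: contQ].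
- exists (fun x => w 0 0 * axP n.+1 x + - (vdot w x * axQ n.+1 x)).
    by move=> x xo; exact: is_derive_axP.
  apply: smoothD => //; first by apply: smoothM => //; exact: (IH _).1.
  apply: smoothN => //; apply: smoothM => //; first exact: smooth_vdot.
  exact: (IH _).2.
- exists (fun x => w 0 0 * axQ n.+1 x +
    vdot w x * ((axP n.+1 x + - axQ n x) * (vdot x x)^-1)).
    by move=> x xo; exact: is_derive_axQ.
  apply: smoothD => //; first by apply: smoothM => //; exact: (IH _).2.
  apply: smoothM => //; first exact: smooth_vdot.
  apply: smoothM => //.
    apply: smoothD => //; first exact: (IH _).1.
    by apply: smoothN => //; exact: (IH _).2.
  apply: smoothV => //; last exact: smooth_sqvnorm.
  by move=> x [_ x0]; rewrite -vnorm_sqr expf_neq0.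
Qed.

Lemma open_axial : open axial. Proof. exact: open_preim_meridian. Qed.

(** A point of the axis has a ball around it in the plane, which is stable
  under [squeeze], so that the averages are available; elsewhere the quotients
  are smooth by the ordinary rules. *)
Lemma smooth_axial k n : smooth k axial (axP n) /\ smooth k axial (axQ n).
Proof.
have H (x : V4) : axial x -> exists2 S : set V4, S x &
    smooth k S (axP n) /\ smooth k S (axQ n).
  move=> Dx; have [x0|x0] := eqVneq (vnorm x) 0; last first.
    by exists off_axis; [split|exact: smooth_off_axis].
  have /nbhs_ballP[r /= r0 Hr] := open_nbhs_nbhs (conj openD Dx).
  pose E : set (R * R) := ball (meridian x) r.
  have openE : open E by exact: ball_open.
  have starE z (t : R) : E z -> 0 <= t <= 1 -> E (squeeze z t).
    rewrite /E -ball_normE /= /meridian x0 !prod_normE /= !gt_max !sub0r !normrN.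
    move=> /andP[-> z2] /andP[t0 t1] /=; rewrite normrM (le_lt_trans _ z2)//.
    by rewrite ler_piMl// ger0_norm.
  have [sU sA] := smooth_near_axis openE Hr starE k.
  exists (@meridian R @^-1` E); first exact: ballxx.
  split; first exact: sU.
  apply: smooth_eq (sA 0%N n.+1); first exact: open_preim_meridian.
  by move=> y Ey /=; rewrite /axQ (sphere_quot_avg Hr starE n Ey).
by split; apply: smooth_local => x /H[S Sx [? ?]]; exists S.
Qed.

End SmoothAxial.

(** * Locality and smoothness of the differential operators *)

Section DifferentialOperators.
Variables (R : realType) (V W : normedModType R).

Lemma derive_eq_open (S : set V) (g g' : V -> W) v x : open S ->
  (forall y, S y -> g y = g' y) -> S x -> 'D_v g x = 'D_v g' x.
Proof.
move=> oS E Sx; apply: near_eq_derive.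
by apply: filterS (open_nbhs_nbhs (conj oS Sx)) => y; exact: E.
Qed.

(** Two continuous functions that agree near [x] on a line through [x], except
  possibly at [x], agree at [x]. *)
Lemma eq_at_limit (g g' : V -> W) x v : {for x, continuous g} -> {for x, continuous g'} ->
  (\forall t \near (0 : R)^', g (t *: v + x) = g' (t *: v + x)) -> g x = g' x.
Proof.
move=> cg cg' E.
have cl : (fun t : R => t *: v + x) @ (0 : R)^' --> x.
  have c0 : (fun t : R => t *: v + x) @ (0 : R) --> 0 *: v + x.
    by apply: cvgD; [apply: cvgZr_tmp|]; [exact: cvg_id|exact: cvg_cst].
  rewrite scale0r add0r in c0.
  exact: cvg_trans (cvg_app _ (@nbhs_dnbhs _ _)) c0.
have l1 := cvg_comp _ _ cl cg; have l2 := cvg_comp _ _ cl cg'.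
have E' : \forall t \near (0 : R)^', g' (t *: v + x) = g (t *: v + x).
  by apply: filterS E => t ->.
exact: (cvg_unique (@norm_hausdorff _ _) l1 (cvg_trans (near_eq_cvg E') l2)).
Qed.

End DifferentialOperators.

Section Laplacian.
Variables (R : realType) (n : nat) (W : normedModType R).
Local Notation V := 'rV[R]_n.

Lemma laplacian_eq (S : set V) (g g' : V -> W) x : open S ->
  (forall y, S y -> g y = g' y) -> S x -> laplacian g x = laplacian g' x.
Proof.
move=> oS E Sx; apply: eq_bigr => i _; apply: (derive_eq_open _ oS) => // y Sy.
exact: (derive_eq_open _ oS E Sy).
Qed.

Lemma smooth_laplacian k (S : set V) (g : V -> W) : open S -> smooth k.+2 S g ->
  smooth k S (laplacian g).
Proof.
move=> oS sg; apply: (@smooth_sum _ _ _ _ (fun i x => _)) => // i.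
by do 2!apply: smooth_D.
Qed.

End Laplacian.

Lemma laplacian_coord (R : realType) n m1 m2 (S : set 'rV[R]_n)
    (g : 'rV[R]_n -> 'M[R]_(m1, m2)) i j x : open S -> smooth 2 S g -> S x ->
  laplacian (fun y => g y i j) x = laplacian g x i j.
Proof.
move=> oS [_ [dg sg]] Sx; rewrite /laplacian summxE; apply: eq_bigr => k _.
have [_ [dg2 _]] := sg (delta_mx 0 k).
rewrite derive_mx ?mxE; last exact: dg2.
apply: (derive_eq_open _ oS) => // y Sy.
by rewrite derive_mx ?mxE//; exact: dg.
Qed.

Section CliffordCalculus.
Variable R : realType.
Local Notation cl3 := (clifford3 R).
Local Notation V4 := 'rV[R]_4.

Lemma is_derive_clmul (V : normedModType R) (c : cl3) (g : V -> cl3) x v (dg : cl3) :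
  is_derive x v g dg -> is_derive x v (fun y => c * g y) (c * dg).
Proof.
move=> [dgx E]; apply: is_derive_mx => i C; rewrite (ord1 i).
have dc B : is_derive x v (fun y => g y 0 B) (dg 0 B).
  by apply: DeriveDef; [move/derivable_mxP: dgx => /(_ 0 B)|rewrite -E derive_mx// mxE].
rewrite mxE (_ : (fun y => _) = (fun y => \sum_(A < 8)
    (-1) ^+ blade_swaps A (blade_xor A C) * (c 0 A * g y 0 (blade_xor A C)))); last first.
  by apply/funext => y; rewrite mxE.
apply: is_derive_sumf => A.
Qed.

Lemma is_derive_scale (V : normedModType R) m n (s : V -> R) (g : V -> 'M[R]_(m, n)) x v ds dg :
  is_derive x v s ds -> is_derive x v g dg ->
  is_derive x v (fun y => s y *: g y) (ds *: g x + s x *: dg).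
Proof.
move=> dsx [dgx E]; apply: is_derive_mx => i j.
have dc : is_derive x v (fun y => g y i j) (dg i j).
  by apply: DeriveDef; [move/derivable_mxP: dgx => /(_ i j)|rewrite -E derive_mx// mxE].
rewrite (_ : (fun y => _) = (fun y => s y * g y i j)); last by apply/funext => y; rewrite mxE.
apply: (is_derive_eq (is_deriveM dsx dc)).
by rewrite !mxE /GRing.scale /= addrC [g x i j * _]mulrC.
Qed.

Lemma smooth_clmul (V : normedModType R) k (S : set V) (c : cl3) (g : V -> cl3) :
  open S -> smooth k S g -> smooth k S (fun y => c * g y).
Proof.
move=> oS sg; apply: smooth_mx => // i C; rewrite (ord1 i).
rewrite (_ : (fun y => _) = (fun y => \sum_(A < 8)
    (-1) ^+ blade_swaps A (blade_xor A C) * (c 0 A * g y 0 (blade_xor A C)))); last first.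
  by apply/funext => y; rewrite mxE.
apply: smooth_sum => // A; apply: smoothM => //; first exact: smooth_cst.
by apply: smoothM => //; [exact: smooth_cst|exact: smooth_coord_mx].
Qed.

Lemma smooth_scale (V : normedModType R) k m n (S : set V) (s : V -> R) (g : V -> 'M[R]_(m, n)) :
  open S -> smooth k S s -> smooth k S g -> smooth k S (fun y => s y *: g y).
Proof.
move=> oS ss sg; apply: smooth_mx => // i j.
rewrite (_ : (fun y => _) = (fun y => s y * g y i j)); last by apply/funext => y; rewrite mxE.
by apply: smoothM => //; exact: smooth_coord_mx.
Qed.

Lemma dbar_eq (S : set V4) (g g' : V4 -> cl3) x : open S ->
  (forall y, S y -> g y = g' y) -> S x -> dbar g x = dbar g' x.
Proof.
move=> oS E Sx; rewrite /dbar (derive_eq_open _ oS E Sx); congr (_ + _).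
by apply: eq_bigr => i _; rewrite (derive_eq_open _ oS E Sx).
Qed.

Lemma smooth_dbar k (S : set V4) (g : V4 -> cl3) : open S -> smooth k.+1 S g ->
  smooth k S (dbar g).
Proof.
move=> oS sg; apply: smoothD => //; first exact: smooth_D.
apply: (@smooth_sum _ _ _ _ (fun i x => cl_gen R i * 'D_(delta_mx 0 (lift ord0 i)) g x)) => // i.
by apply: smooth_clmul => //; exact: smooth_D.
Qed.

End CliffordCalculus.

(** * The operators on axial functions *)

Section AxialJets.
Variable R : realType.
Local Notation cl3 := (clifford3 R).
Local Notation V4 := 'rV[R]_4.
Local Notation gen := (cl_gen R).
Implicit Types (x w : V4) (g a b : V4 -> cl3).

Definition vpart x : cl3 := \sum_(i < 3) vcoord x i *: gen i.

Lemma vpart_anticomm x y : vpart x * vpart y + vpart y * vpart x = (- 2 * vdot x y)%:A.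
Proof.
have E z t : vpart z * vpart t = \sum_(i < 3) \sum_(j < 3) (vcoord z i * vcoord t j) *: (gen i * gen j).
  rewrite mulr_suml; apply: eq_bigr => i _; rewrite mulr_sumr; apply: eq_bigr => j _.
  by rewrite -scalerAl -scalerAr scalerA.
rewrite !E [X in _ + X]exchange_big -big_split /vdot mulr_sumr scaler_suml.
apply: eq_bigr => i _; rewrite -big_split /= (bigD1 i) //= big1 ?addr0.
  rewrite [vcoord y i * _]mulrC -scalerDr cl_gen_anticomm eqxx mulr1.
  have -> : (- 2 : cl3) = (- 2 : R)%:A by rewrite scaleNr scaler_nat.
  by rewrite scalerA mulrC.
move=> j /negbTE ji; rewrite [vcoord y j * _]mulrC -scalerDr cl_gen_anticomm.
by rewrite [i == j]eq_sym ji mulr0 scaler0.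
Qed.

Lemma vpart_sqr x : vpart x * vpart x = (- vdot x x)%:A.
Proof.
have := vpart_anticomm x x; rewrite -mulr2n -scaler_nat => /(congr1 ( *:%R (2%:R^-1))).
by rewrite !scalerA mulVf ?pnatr_eq0// scale1r mulrA mulrN mulVf ?pnatr_eq0// mulN1r.
Qed.

Lemma gen_sqr i : gen i * gen i = -1.
Proof.
have := cl_gen_anticomm R i i; rewrite eqxx mulr1 -mulr2n -[in LHS]scaler_nat.
move=> /(congr1 ( *:%R (2%:R^-1))); rewrite scalerA mulVf ?pnatr_eq0// scale1r => ->.
have -> : (2 : cl3) = (2 : R)%:A by rewrite scaler_nat.
by rewrite scalerN scalerA mulVf ?pnatr_eq0// scale1r.
Qed.

Lemma is_derive_vpartM g x w dg : is_derive x w g dg ->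
  is_derive x w (fun y => vpart y * g y) (vpart w * g x + vpart x * dg).
Proof.
move=> dgx.
rewrite (_ : (fun y => _) = (fun y => \sum_(i < 3) vcoord y i *: (gen i * g y))); last first.
  by apply/funext => y; rewrite mulr_suml; apply: eq_bigr => i _; rewrite scalerAl.
rewrite !mulr_suml -big_split /=; apply: is_derive_sumf => i.
rewrite -!scalerAl; apply: is_derive_scale; first exact: is_derive_vcoord.
exact: is_derive_clmul.
Qed.

Lemma smooth_vpartM k (S : set V4) g : open S -> smooth k S g ->
  smooth k S (fun y => vpart y * g y).
Proof.
move=> oS sg.
rewrite (_ : (fun y => _) = (fun y => \sum_(i < 3) vcoord y i *: (gen i * g y))).
  apply: smooth_sum => // i; apply: smooth_scale => //; first exact: smooth_coord.
  exact: smooth_clmul.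
by apply/funext => y; rewrite mulr_suml; apply: eq_bigr => i _; rewrite scalerAl.
Qed.

Lemma vcoord_delta0 i : vcoord (delta_mx 0 0 : V4) i = 0.
Proof. by rewrite /vcoord mxE. Qed.

Lemma vcoord_delta i j : vcoord (delta_mx 0 (lift ord0 j) : V4) i = (i == j)%:R.
Proof. by rewrite /vcoord mxE eqxx /= (inj_eq lift_inj). Qed.

Lemma vdot_delta0 x : vdot (delta_mx 0 0) x = 0.
Proof. by rewrite /vdot big1// => i _; rewrite vcoord_delta0 mul0r. Qed.

Lemma vdot_delta x i : vdot (delta_mx 0 (lift ord0 i)) x = vcoord x i.
Proof.
rewrite /vdot (bigD1 i)//= vcoord_delta eqxx mul1r big1 ?addr0// => j /negbTE ji.
by rewrite vcoord_delta ji mul0r.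
Qed.

Lemma vpart_delta0 : vpart (delta_mx 0 0) = 0.
Proof. by rewrite /vpart big1// => i _; rewrite vcoord_delta0 scale0r. Qed.

Lemma vpart_delta i : vpart (delta_mx 0 (lift ord0 i)) = gen i.
Proof.
rewrite /vpart (bigD1 i)//= vcoord_delta eqxx scale1r big1 ?addr0// => j /negbTE ji.
by rewrite vcoord_delta ji scale0r.
Qed.

Variable S : set V4.
Hypothesis openS : open S.

(** For a function of [(a, b)] alone, [a] and [b] here are its derivative with
  respect to the real part and its derivative with respect to the length of
  the vector part divided by that length: the only two first-order data that
  the operators see. *)
Definition axial_jet g a b := forall x w, S x ->
  is_derive x w g (w 0 0 *: a x + vdot w x *: b x).

Lemma jet_D0 g a b x : axial_jet g a b -> S x -> 'D_(delta_mx 0 0) g x = a x.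
Proof.
move=> j Sx; have [_ ->] := j x (delta_mx 0 0) Sx.
by rewrite vdot_delta0 scale0r addr0 mxE !eqxx scale1r.
Qed.

Lemma jet_D g a b x i : axial_jet g a b -> S x ->
  'D_(delta_mx 0 (lift ord0 i)) g x = vcoord x i *: b x.
Proof.
move=> j Sx; have [_ ->] := j x (delta_mx 0 (lift ord0 i)) Sx.
by rewrite vdot_delta mxE /= scale0r add0r.
Qed.

Lemma is_derive_jet_D g a b x i : axial_jet g a b -> S x ->
  is_derive x (delta_mx 0 (lift ord0 i)) g (vcoord x i *: b x).
Proof.
move=> j Sx; have := j x (delta_mx 0 (lift ord0 i)) Sx.
by rewrite vdot_delta mxE /= scale0r add0r.
Qed.

(** The radial Laplacian in three variables is [g'' + 2 g' / r]; in terms of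
  [b = g' / r] it reads [3 b + r b']. *)
Lemma laplacian_jet g a b aa ab ba bb x :
  axial_jet g a b -> axial_jet a aa ab -> axial_jet b ba bb -> S x ->
  laplacian g x = aa x + 3 *: b x + vdot x x *: bb x.
Proof.
move=> jg ja jb Sx; rewrite /laplacian big_ord_recl.
rewrite (derive_eq_open _ openS (fun y => jet_D0 jg (x := y)) Sx).
rewrite (jet_D0 ja Sx) -addrA; congr (_ + _).
have E i : 'D_(delta_mx 0 (lift ord0 i)) ('D_(delta_mx 0 (lift ord0 i)) g) x =
    b x + (vcoord x i * vcoord x i) *: bb x.
  rewrite (derive_eq_open _ openS (fun y => jet_D i jg (x := y)) Sx).
  have [_ ->] := is_derive_scale (is_derive_vcoord x (delta_mx 0 (lift ord0 i)) i)
    (is_derive_jet_D i jb Sx).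
  by rewrite vcoord_delta eqxx scale1r scalerA.
rewrite (eq_bigr _ (fun i _ => E i)) big_split /= -scaler_suml; congr (_ + _).
by rewrite sumr_const card_ord scaler_nat.
Qed.

(** The product with a coordinate function adds twice its gradient paired with
  that of [g], whence [5] in place of [3]. *)
Lemma laplacian_vpart_jet g a b aa ab ba bb x :
  axial_jet g a b -> axial_jet a aa ab -> axial_jet b ba bb -> S x ->
  laplacian (fun y => vpart y * g y) x =
  vpart x * (aa x + 5 *: b x + vdot x x *: bb x).
Proof.
move=> jg ja jb Sx; rewrite /laplacian big_ord_recl.
have D0 h ha hb y : axial_jet h ha hb -> S y ->
    'D_(delta_mx 0 0) (fun y => vpart y * h y) y = vpart y * ha y.
  move=> jh Sy; have [_ ->] := is_derive_vpartM (jh y (delta_mx 0 0) Sy).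
  by rewrite vpart_delta0 mul0r add0r vdot_delta0 scale0r addr0 mxE !eqxx scale1r.
rewrite (derive_eq_open _ openS (fun y => D0 _ _ _ y jg) Sx).
rewrite (D0 _ _ _ _ ja Sx) -addrA mulrDr; congr (_ + _).
have D1 y i : S y -> 'D_(delta_mx 0 (lift ord0 i)) (fun y => vpart y * g y) y =
    gen i * g y + vpart y * (vcoord y i *: b y).
  move=> Sy; have [_ ->] := is_derive_vpartM (is_derive_jet_D i jg Sy).
  by rewrite vpart_delta.
have E i : 'D_(delta_mx 0 (lift ord0 i)) ('D_(delta_mx 0 (lift ord0 i)) (fun y => vpart y * g y)) x =
    (vcoord x i *: gen i) * b x + (vcoord x i *: gen i) * b x +
    (vpart x * b x + (vcoord x i * vcoord x i) *: (vpart x * bb x)).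
  rewrite (derive_eq_open _ openS (fun y => D1 y i) Sx).
  have db := is_derive_scale (is_derive_vcoord x (delta_mx 0 (lift ord0 i)) i)
    (is_derive_jet_D i jb Sx).
  have [_ ->] := is_deriveD (is_derive_clmul (gen i) (is_derive_jet_D i jg Sx)) (is_derive_vpartM db).
  rewrite vcoord_delta eqxx scale1r vpart_delta -!scalerAr mulrDr -!scalerAr !scalerA.
  by rewrite -!scalerAl addrA.
rewrite (eq_bigr _ (fun i _ => E i)) !big_split /= -!mulr_suml -/(vpart x) -scaler_suml.
rewrite sumr_const card_ord mulrDr -!scalerAr -/(vdot x x) addrA; congr (_ + _).
by rewrite -mulr2n mulrnAl -mulrnDr scaler_nat.
Qed.

Lemma dbar_jet g a b x : axial_jet g a b -> S x -> dbar g x = a x + vpart x * b x.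
Proof.
move=> jg Sx; rewrite /dbar (jet_D0 jg Sx); congr (_ + _).
rewrite mulr_suml; apply: eq_bigr => i _.
by rewrite (jet_D i jg Sx) -scalerAl -scalerAr.
Qed.

Lemma dbar_vpart_jet g a b x : axial_jet g a b -> S x ->
  dbar (fun y => vpart y * g y) x = vpart x * a x - 3 *: g x - vdot x x *: b x.
Proof.
move=> jg Sx; rewrite /dbar.
have [_ ->] := is_derive_vpartM (jg x (delta_mx 0 0) Sx).
rewrite vpart_delta0 mul0r add0r vdot_delta0 scale0r addr0 mxE !eqxx scale1r -addrA; congr (_ + _).
have E i : gen i * 'D_(delta_mx 0 (lift ord0 i)) (fun y => vpart y * g y) x =
    - g x + (vcoord x i *: gen i) * (vpart x * b x).
  have [_ ->] := is_derive_vpartM (is_derive_jet_D i jg Sx).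
  rewrite vpart_delta mulrDr mulrA gen_sqr mulN1r; congr (_ + _).
  by rewrite -scalerAr -scalerAl -scalerAr.
rewrite (eq_bigr _ (fun i _ => E i)) big_split /= -mulr_suml -/(vpart x) mulrA vpart_sqr.
rewrite mulr_algl scaleNr; congr (_ - _).
by rewrite sumr_const card_ord mulNrn scaler_nat.
Qed.

End AxialJets.

(** * The harmonic parts of a slice regular function *)

Section LinearOperators.
Variables (R : realType).
Local Notation cl3 := (clifford3 R).

Lemma laplacianD n (W : normedModType R) (S : set 'rV[R]_n) (g g' : 'rV[R]_n -> W) x :
  open S -> smooth 2 S g -> smooth 2 S g' -> S x ->
  laplacian (fun y => g y + g' y) x = laplacian g x + laplacian g' x.
Proof.
move=> oS sg sg' Sx; rewrite -big_split; apply: eq_bigr => i _ /=.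
rewrite (derive_eq_open (g' := fun y => 'D_(delta_mx 0 i) g y + 'D_(delta_mx 0 i) g' y) _ oS)//.
  have [_ ->] := is_deriveD (smooth_is_derive (delta_mx 0 i) (smooth_D (delta_mx 0 i) sg) Sx)
    (smooth_is_derive (delta_mx 0 i) (smooth_D (delta_mx 0 i) sg') Sx).
  by [].
move=> y Sy.
by have [_ ->] := is_deriveD (smooth_is_derive (delta_mx 0 i) sg Sy)
  (smooth_is_derive (delta_mx 0 i) sg' Sy).
Qed.

Lemma laplacianZ n (W : normedModType R) (S : set 'rV[R]_n) (k : R) (g : 'rV[R]_n -> W) x :
  open S -> smooth 2 S g -> S x ->
  laplacian (fun y => k *: g y) x = k *: laplacian g x.
Proof.
move=> oS sg Sx; rewrite /laplacian scaler_sumr; apply: eq_bigr => i _.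
rewrite (derive_eq_open (g' := fun y => k *: 'D_(delta_mx 0 i) g y) _ oS)//.
  by have [_ ->] := is_deriveZ k (smooth_is_derive (delta_mx 0 i) (smooth_D (delta_mx 0 i) sg) Sx).
by move=> y Sy; have [_ ->] := is_deriveZ k (smooth_is_derive (delta_mx 0 i) sg Sy).
Qed.

Lemma dbarD (S : set 'rV[R]_4) (g g' : 'rV[R]_4 -> cl3) x :
  smooth 1 S g -> smooth 1 S g' -> S x ->
  dbar (fun y => g y + g' y) x = dbar g x + dbar g' x.
Proof.
move=> sg sg' Sx.
have E v : 'D_v (fun y => g y + g' y) x = 'D_v g x + 'D_v g' x.
  by have [_ ->] := is_deriveD (smooth_is_derive v sg Sx) (smooth_is_derive v sg' Sx).
rewrite /dbar E addrACA -big_split; congr (_ + _).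
by apply: eq_bigr => i _; rewrite E mulrDr.
Qed.

Lemma dbarZ (S : set 'rV[R]_4) (k : R) (g : 'rV[R]_4 -> cl3) x :
  smooth 1 S g -> S x -> dbar (fun y => k *: g y) x = k *: dbar g x.
Proof.
move=> sg Sx.
have E v : 'D_v (fun y => k *: g y) x = k *: 'D_v g x.
  by have [_ ->] := is_deriveZ k (smooth_is_derive v sg Sx).
rewrite /dbar E scalerDr scaler_sumr; congr (_ + _).
by apply: eq_bigr => i _; rewrite E scalerAr.
Qed.

Lemma smoothZ (V W : normedModType R) k (S : set V) (c : R) (g : V -> W) : open S ->
  smooth k S g -> smooth k S (fun y => c *: g y).
Proof.
move=> oS; elim: k g => [|k IH] g sg.
  by split => // x Sx; exact: (cvgZ (cvg_cst c) (smooth_continuous sg Sx)).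
apply: smooth_derive => [//|x Sx|v].
  exact: (cvgZ (cvg_cst c) (smooth_continuous sg Sx)).
exists (fun x => c *: 'D_v g x); last by apply: IH; exact: smooth_D.
by move=> x Sx; apply: is_deriveZ; exact: smooth_is_derive sg Sx.
Qed.

End LinearOperators.

Section AxialStem.
Variable R : realType.
Local Notation cl3 := (clifford3 R).
Local Notation V4 := 'rV[R]_4.
Variables (D : set (R * R)) (U V : 'I_8 -> nat -> R * R -> R).
Hypothesis openD : open D.
Hypothesis crUV : forall A n, CR D (U A n) (V A n) (U A n.+1) (V A n.+1).
Hypothesis stemUV : forall A n, stem_pair D (U A n) (V A n).

Local Notation S := (off_axis D).
Local Notation Omega := (axial D).
Let openS : open S := open_off_axis openD.
Let openOmega : open Omega := open_axial openD.
Local Notation jet := (axial_jet S).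

(** [parP n] and [parQ n] belong to the n-th derivative of the stem function;
  [parZ], [parY] and [parX] are the successive radial derivatives divided by
  the length of the vector part, starting from [parQ]. *)
Definition parP n (x : V4) : cl3 := \row_A axP (U A) n x.
Definition parQ n (x : V4) : cl3 := \row_A axQ (U A) (V A) n x.
Definition parZ n (x : V4) : cl3 := (vdot x x)^-1 *: (parP n.+1 x - parQ n x).
Definition parY n (x : V4) : cl3 := (vdot x x)^-1 *: (- parQ n.+2 x - 3 *: parZ n x).
Definition parX n (x : V4) : cl3 := (vdot x x)^-1 *: (- parZ n.+2 x - 5 *: parY n x).

Let vdot_neq0 x : S x -> vdot x x != 0.
Proof. by move=> [_ x0]; rewrite -vnorm_sqr expf_neq0. Qed.

Let parZ_mul n x : S x -> vdot x x *: parZ n x = parP n.+1 x - parQ n x.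
Proof. by move=> /vdot_neq0 x0; rewrite scalerA divff// scale1r. Qed.

Let parY_mul n x : S x -> vdot x x *: parY n x = - parQ n.+2 x - 3 *: parZ n x.
Proof. by move=> /vdot_neq0 x0; rewrite scalerA divff// scale1r. Qed.

Let parX_mul n x : S x -> vdot x x *: parX n x = - parZ n.+2 x - 5 *: parY n x.
Proof. by move=> /vdot_neq0 x0; rewrite scalerA divff// scale1r. Qed.

Lemma jet_ext g a b a' b' : jet g a b -> (forall x, S x -> a x = a' x) ->
  (forall x, S x -> b x = b' x) -> jet g a' b'.
Proof. by move=> j Ea Eb x w Sx; rewrite -Ea// -Eb//; exact: j. Qed.

Lemma jetD g a b g' a' b' : jet g a b -> jet g' a' b' ->
  jet (fun x => g x + g' x) (fun x => a x + a' x) (fun x => b x + b' x).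
Proof.
move=> j j' x w Sx; apply: (is_derive_eq (is_deriveD (j x w Sx) (j' x w Sx))).
by rewrite !scalerDr addrACA.
Qed.

Lemma jetZ k g a b : jet g a b ->
  jet (fun x => k *: g x) (fun x => k *: a x) (fun x => k *: b x).
Proof.
move=> j x w Sx; apply: (is_derive_eq (is_deriveZ k (j x w Sx))).
by rewrite scalerDr !scalerA ![k * _]mulrC.
Qed.

Lemma jet_inv_sqr g a b : jet g a b ->
  jet (fun x => (vdot x x)^-1 *: g x) (fun x => (vdot x x)^-1 *: a x)
    (fun x => (vdot x x)^-1 *: (b x - 2 *: ((vdot x x)^-1 *: g x))).
Proof.
move=> j x w Sx; have x0 := vdot_neq0 Sx.
have dinv := @is_derive_invf _ _ (fun y => vdot y y) x w _ x0 (is_derive_vdot x w).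
apply: (is_derive_eq (is_derive_scale dinv (j x w Sx))).
by apply/rowP => A; rewrite !mxE; field.
Qed.

Lemma jet_parP n : jet (parP n) (parP n.+1) (fun x => - 1 *: parQ n.+1 x).
Proof.
move=> x w Sx; apply: is_derive_mx => i A; rewrite !mxE mulN1r mulrN.
rewrite (_ : (fun y => _) = axP (U A) n); first exact: (is_derive_axP (crUV A)).
by apply/funext => y; rewrite mxE.
Qed.

Lemma jet_parQ n : jet (parQ n) (parQ n.+1) (parZ n).
Proof.
move=> x w Sx; apply: is_derive_mx => i A; rewrite !mxE [_^-1 * _]mulrC.
rewrite (_ : (fun y => _) = axQ (U A) (V A) n); first exact: (is_derive_axQ (crUV A)).
by apply/funext => y; rewrite mxE.
Qed.

Lemma jet_parZ n : jet (parZ n) (parZ n.+1) (parY n).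
Proof.
rewrite (_ : parZ n = fun x => (vdot x x)^-1 *: (parP n.+1 x + - 1 *: parQ n x)); last first.
  by apply/funext => x; rewrite scaleN1r.
apply: jet_ext (jet_inv_sqr (jetD (jet_parP _) (jetZ (- 1) (jet_parQ _)))) _ _ => x Sx.
  by rewrite scaleN1r.
by rewrite !scaleN1r; apply/rowP => A; rewrite !mxE; ring.
Qed.

Lemma jet_parY n : jet (parY n) (parY n.+1) (parX n).
Proof.
rewrite (_ : parY n = fun x => (vdot x x)^-1 *: (- 1 *: parQ n.+2 x + - 3 *: parZ n x)); last first.
  by apply/funext => x; rewrite scaleN1r scaleNr.
apply: jet_ext (jet_inv_sqr (jetD (jetZ (- 1) (jet_parQ _)) (jetZ (- 3) (jet_parZ _)))) _ _ => x Sx.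
  by rewrite scaleN1r scaleNr.
by rewrite !scaleN1r !scaleNr; apply/rowP => A; rewrite !mxE; ring.
Qed.

Lemma lap_parP n x : S x -> laplacian (parP n) x = - 2 *: parQ n.+1 x.
Proof.
move=> Sx; rewrite (laplacian_jet openS (jet_parP n) (jet_parP _) (jetZ _ (jet_parQ _)) Sx).
rewrite !scaleN1r !scalerN parZ_mul//.
by apply/rowP => A; rewrite !mxE; ring.
Qed.

(** [parY] is the second radial quotient computed by the Cauchy-Riemann equations;
  its value cancels the other two terms of [laplacian_jet]. *)
Lemma lap_parQ n x : S x -> laplacian (parQ n) x = 0.
Proof.
move=> Sx; rewrite (laplacian_jet openS (jet_parQ n) (jet_parQ _) (jet_parZ _) Sx).
by rewrite parY_mul//; apply/rowP => A; rewrite !mxE; ring.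
Qed.

Lemma lap_vpart_parQ n x : S x ->
  laplacian (fun y => vpart y * parQ n y) x = vpart x * (2 *: parZ n x).
Proof.
move=> Sx; rewrite (laplacian_vpart_jet openS (jet_parQ n) (jet_parQ _) (jet_parZ _) Sx).
congr (_ * _); rewrite parY_mul//.
by apply/rowP => A; rewrite !mxE; ring.
Qed.

Lemma lap_vpart_parZ n x : S x -> laplacian (fun y => vpart y * parZ n y) x = 0.
Proof.
move=> Sx; rewrite (laplacian_vpart_jet openS (jet_parZ n) (jet_parZ _) (jet_parY _) Sx).
rewrite [X in _ * X](_ : _ = 0) ?mulr0// parX_mul//.
by apply/rowP => A; rewrite !mxE; ring.
Qed.

Lemma dbar_parP n x : S x -> dbar (parP n) x = parP n.+1 x - vpart x * parQ n.+1 x.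
Proof. by move=> Sx; rewrite (dbar_jet (jet_parP n) Sx) scaleN1r mulrN. Qed.

Lemma dbar_parQ n x : S x -> dbar (parQ n) x = parQ n.+1 x + vpart x * parZ n x.
Proof. by move=> Sx; rewrite (dbar_jet (jet_parQ n) Sx). Qed.

Lemma dbar_vpart_parQ n x : S x -> dbar (fun y => vpart y * parQ n y) x =
  vpart x * parQ n.+1 x - 2 *: parQ n x - parP n.+1 x.
Proof.
move=> Sx; rewrite (dbar_vpart_jet (jet_parQ n) Sx) parZ_mul//.
by set t := vpart x * _; apply/rowP => A; rewrite !mxE; ring.
Qed.

Lemma dbar_vpart_parZ n x : S x -> dbar (fun y => vpart y * parZ n y) x =
  vpart x * parZ n.+1 x + parQ n.+2 x.
Proof.
move=> Sx; rewrite (dbar_vpart_jet (jet_parZ n) Sx) parY_mul//.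
by set t := vpart x * _; apply/rowP => A; rewrite !mxE; ring.
Qed.

Lemma smooth_parP k n : smooth k Omega (parP n).
Proof.
apply: smooth_mx => // i A; rewrite (_ : (fun y => _) = axP (U A) n).
  exact: (smooth_axial openD (crUV A) (stemUV A) k n).1.
by apply/funext => y; rewrite mxE.
Qed.

Lemma smooth_parQ k n : smooth k Omega (parQ n).
Proof.
apply: smooth_mx => // i A; rewrite (_ : (fun y => _) = axQ (U A) (V A) n).
  exact: (smooth_axial openD (crUV A) (stemUV A) k n).2.
by apply/funext => y; rewrite mxE.
Qed.

(** The slice function [F1 + J F2] on paravectors; [vpart x * parQ 0 x] is
  [J F2] with the division by the length made explicit, which remains
  meaningful on the axis. *)
Definition slice4 (x : V4) : cl3 := parP 0 x + vpart x * parQ 0 x.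

Lemma smooth_slice4 k : smooth k Omega slice4.
Proof.
apply: smoothD => //; first exact: smooth_parP.
by apply: smooth_vpartM => //; exact: smooth_parQ.
Qed.

Let smooth_sub (W : normedModType R) k (g : V4 -> W) : smooth k Omega g -> smooth k S g.
Proof. by move=> sg; apply: smooth_local => x [Ox _]; exists Omega. Qed.

(** Points of the axis are approached along [e1]. *)
Lemma off_axis_dense (W : normedModType R) (g g' : V4 -> W) :
  smooth 0 Omega g -> smooth 0 Omega g' ->
  (forall x, S x -> g x = g' x) -> forall x, Omega x -> g x = g' x.
Proof.
move=> [cg _] [cg' _] E x Ox; have [x0|x0] := eqVneq (vnorm x) 0; last exact: E.
pose d : V4 := delta_mx 0 (lift ord0 0).
have nx (t : R) : vnorm (t *: d + x) = `|t|.
  have -> : vnorm (t *: d + x) = vnorm (t *: d).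
    congr Num.sqrt; apply: eq_bigr => i _; have := vnorm_eq0 x0 i.
    by rewrite /vcoord !mxE => ->; rewrite addr0.
  rewrite vnormZ (_ : vnorm d = 1) ?mulr1// /vnorm (_ : vdot d d = 1) ?sqrtr1//.
  by rewrite vdot_delta vcoord_delta eqxx.
apply: (@eq_at_limit _ _ _ g g' x d); [exact: cg|exact: cg'|].
have cl : (fun t : R => t *: d + x) @ (0 : R) --> x.
  have : (fun t : R => t *: d + x) @ (0 : R) --> 0 *: d + x.
    by apply: cvgD; [apply: cvgZr_tmp|]; [exact: cvg_id|exact: cvg_cst].
  by rewrite scale0r add0r.
have nO : \forall t \near (0 : R), Omega (t *: d + x).
  by apply: cl; exact: open_nbhs_nbhs.
near=> t; apply: E; split; first by near: t; exact: nbhs_dnbhs.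
by rewrite nx normr_eq0; near: t; exact: nbhs_dnbhs_neq.
Unshelve. all: by end_near. Qed.

Lemma smooth_off_parQ k n : smooth k S (parQ n).
Proof. exact: smooth_sub (smooth_parQ k n). Qed.

Lemma smooth_off_parZ k n : smooth k S (parZ n).
Proof.
apply: smooth_scale => //.
  by apply: smoothV => //; exact: smooth_sqvnorm.
apply: smooth_eq openS _ (smoothD openS (smooth_sub (smooth_parP k n.+1))
  (smoothZ (- 1) openS (smooth_off_parQ k n))) => x _.
by rewrite scaleN1r.
Qed.

Lemma dbar_slice4 x : Omega x -> dbar slice4 x = - 2 *: parQ 0 x.
Proof.
move: x; apply: off_axis_dense => [||x Sx].
- exact: (smooth_dbar openOmega (smooth_slice4 _)).
- exact: (smoothZ _ openOmega (smooth_parQ _ _)).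
rewrite /slice4 (dbarD (smooth_sub (smooth_parP _ _)) (smooth_vpartM openS (smooth_off_parQ _ _)) Sx).
rewrite dbar_parP// dbar_vpart_parQ//.
by set t := vpart x * _; apply/rowP => A; rewrite !mxE; ring.
Qed.

Lemma laplacian_slice4 x : S x ->
  laplacian slice4 x = - 2 *: parQ 1 x + 2 *: (vpart x * parZ 0 x).
Proof.
move=> Sx; rewrite /slice4 (laplacianD openS (smooth_sub (smooth_parP _ _))
  (smooth_vpartM openS (smooth_off_parQ _ _)) Sx).
by rewrite lap_parP// lap_vpart_parQ// scalerAr.
Qed.

Lemma laplacian_parQ n x : Omega x -> laplacian (parQ n) x = 0.
Proof.
move: x; apply: off_axis_dense => [||x Sx].
- exact: (smooth_laplacian openOmega (smooth_parQ _ _)).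
- exact: (smooth_cst _ _ openOmega).
- exact: lap_parQ.
Qed.

Lemma bilaplacian_slice4 x : Omega x -> laplacian (laplacian slice4) x = 0.
Proof.
move: x; apply: off_axis_dense => [||x Sx].
- exact: (smooth_laplacian openOmega (smooth_laplacian openOmega (smooth_slice4 _))).
- exact: (smooth_cst _ _ openOmega).
rewrite (laplacian_eq openS laplacian_slice4 Sx).
have sZ : smooth 2 S (fun y => vpart y * parZ 0 y) :=
  smooth_vpartM openS (smooth_off_parZ _ _).
rewrite (laplacianD openS (smoothZ _ openS (smooth_off_parQ _ _)) (smoothZ _ openS sZ) Sx).
rewrite (laplacianZ _ openS (smooth_off_parQ _ _) Sx) (laplacianZ _ openS sZ Sx).
by rewrite lap_parQ// lap_vpart_parZ// !scaler0 addr0.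
Qed.

Lemma dbar_laplacian_slice4 x : Omega x -> dbar (laplacian slice4) x = 0.
Proof.
move: x; apply: off_axis_dense => [||x Sx].
- exact: (smooth_dbar openOmega (smooth_laplacian openOmega (smooth_slice4 _))).
- exact: (smooth_cst _ _ openOmega).
rewrite (dbar_eq openS laplacian_slice4 Sx).
have sZ : smooth 1 S (fun y => vpart y * parZ 0 y) :=
  smooth_vpartM openS (smooth_off_parZ _ _).
rewrite (dbarD (smoothZ _ openS (smooth_off_parQ _ _)) (smoothZ _ openS sZ) Sx).
rewrite (dbarZ _ (smooth_off_parQ _ _) Sx) (dbarZ _ sZ Sx) dbar_parQ// dbar_vpart_parZ//.
by set t := vpart x * _; apply/rowP => A; rewrite !mxE; ring.
Qed.

End AxialStem.

(** * Imaginary units and the quadratic cone *)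

Section ImaginaryUnits.
Variable R : realType.
Local Notation cl3 := (clifford3 R).
Local Notation V4 := 'rV[R]_4.
Local Notation gen := (cl_gen R).
Implicit Types (J : cl3) (x : V4) (z : R * R).

Lemma cl_conj1 : cl_conj (1 : cl3) = 1.
Proof.
apply/rowP => A; rewrite !mxE /=; case: eqP => [->|_]; last by rewrite mulr0.
by rewrite expr0 mul1r.
Qed.

Lemma cl_conjN (y : cl3) : cl_conj (- y) = - cl_conj y.
Proof. by rewrite -scaleN1r cl_conjZ scaleN1r. Qed.

Lemma cl_conj_alg (a : R) : cl_conj (a%:A : cl3) = a%:A.
Proof. by rewrite cl_conjZ cl_conj1. Qed.

Lemma cl_conj_sum n (h : 'I_n -> cl3) :
  cl_conj (\sum_(i < n) h i) = \sum_(i < n) cl_conj (h i).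
Proof.
apply: (big_morph (@cl_conj R) (@cl_conjD R)).
by apply/rowP => A; rewrite !mxE mulr0.
Qed.

Lemma cl_conj_vpart x : cl_conj (vpart x) = - vpart x.
Proof.
rewrite cl_conj_sum -sumrN; apply: eq_bigr => i _.
by rewrite cl_conjZ cl_conj_gen scalerN.
Qed.

Lemma scalar_alg (a : R) : (a%:A : cl3) 0 0 = a.
Proof. by rewrite !mxE mulr1. Qed.

(** The scalar part of [y y^c] is the Euclidean square norm: the two signs of
  the algebra cancel on each basis element. *)
Lemma cl_mul_conj0 (y : cl3) : (y * cl_conj y) 0 0 = \sum_A (y 0 A) ^+ 2.
Proof.
rewrite mxE; apply: eq_bigr => A _; rewrite blade_xorr0 mxE.
have S : (-1) ^+ blade_swaps A A * (-1) ^+ 'C((blade_size A).+1, 2) = 1 :> R.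
  rewrite -exprD -signr_odd.
  have /eqP -> : odd (blade_swaps A A + 'C((blade_size A).+1, 2)) == false.
    have H : all (fun a => odd (blade_swaps a a + 'C((blade_size a).+1, 2)) == false)
      (iota 0 8) by vm_compute.
    exact: (forall_blade H).
  by rewrite expr0.
have E (p q t : R) : p * q = 1 -> p * (t * (q * t)) = t ^+ 2.
  by move=> pq; rewrite -[RHS]mul1r -pq; ring.
exact: E S.
Qed.

Lemma imag_conj J : imag_units J -> cl_conj J = - J.
Proof. by move=> [/eqP]; rewrite addrC addr_eq0 => /eqP. Qed.

Lemma imag_sqr J : imag_units J -> J * J = -1.
Proof. by move=> iJ; case: (iJ) => _; rewrite (imag_conj iJ) mulrN => <-; rewrite opprK. Qed.

Lemma imagP J : cl_conj J = - J -> J * J = -1 -> imag_units J.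
Proof. by move=> cJ J2; split; rewrite cJ ?subrr// mulrN J2 opprK. Qed.

Lemma imagN J : imag_units J -> imag_units (- J).
Proof.
move=> iJ; apply: imagP; first by rewrite cl_conjN (imag_conj iJ).
by rewrite mulrNN imag_sqr.
Qed.

Lemma imag_scalar J : imag_units J -> J 0 0 = 0.
Proof.
move=> /imag_conj /rowP /(_ 0); rewrite !mxE /= expr0 mul1r => /eqP.
by rewrite -subr_eq0 opprK -mulr2n mulrn_eq0 /= => /eqP.
Qed.

Lemma imag_gen i : imag_units (gen i).
Proof. by apply: imagP; [exact: cl_conj_gen|exact: gen_sqr]. Qed.

Lemma imag_vpart x : vnorm x != 0 -> imag_units ((vnorm x)^-1 *: vpart x).
Proof.
move=> x0; apply: imagP; first by rewrite cl_conjZ cl_conj_vpart scalerN.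
rewrite -scalerAl -scalerAr vpart_sqr !scalerA -vnorm_sqr.
by rewrite (_ : _ * _ = -1) ?scaleN1r//; field.
Qed.

Lemma sqr_scale_imag (a : R) J : imag_units J -> (a *: J) * (a *: J) = (- a ^+ 2)%:A.
Proof. by move=> /imag_sqr J2; rewrite -scalerAl -scalerAr J2 scalerA scalerN scaleNr. Qed.

(** A point of the quadratic cone determines its complex coordinate up to
  conjugation, and the unit up to the corresponding sign. *)
Lemma slice_coord_inj z z' J J' : imag_units J -> imag_units J' ->
  z.1%:A + z.2 *: J = z'.1%:A + z'.2 *: J' ->
  z.2 *: J = z'.2 *: J' /\ (z' = z \/ z' = cconj z).
Proof.
case: z z' => [a b] [a' b'] /= iJ iJ' E.
have /rowP/(_ 0) := E; rewrite !mxE !imag_scalar//= !mulr0 !addr0 !mulr1 => aa.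
move: E; rewrite aa => /addrI E; split => //.
have := congr1 (fun y => y * y) E; rewrite !sqr_scale_imag// => /(congr1 (fun y : cl3 => y 0 0)).
rewrite !scalar_alg => /oppr_inj/eqP; rewrite eqf_sqr => /orP[]/eqP ->.
  by left.
by right; rewrite /cconj /= opprK.
Qed.

(** The choice of the unit on the real axis is arbitrary, since its coefficient
  vanishes there. *)
Definition unit_vpart x : cl3 := if vnorm x == 0 then gen ord0 else (vnorm x)^-1 *: vpart x.

Lemma imag_unit_vpart x : imag_units (unit_vpart x).
Proof. by rewrite /unit_vpart; case: eqVneq => [_|x0]; [exact: imag_gen|exact: imag_vpart]. Qed.

Lemma vpart_unit_vpart x : vpart x = vnorm x *: unit_vpart x.
Proof.
rewrite /unit_vpart; case: eqVneq => [x0|x0].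
  by rewrite x0 scale0r /vpart big1// => i _; rewrite vnorm_eq0// scale0r.
by rewrite scalerA divff// scale1r.
Qed.

Lemma paravector_meridian x :
  paravector x = (meridian x).1%:A + (meridian x).2 *: unit_vpart x.
Proof. by rewrite /paravector -vpart_unit_vpart. Qed.

Lemma circularization_axial (D : set (R * R)) : conj_invariant D ->
  (@paravector R) @^-1` circularization D = axial D.
Proof.
move=> cD; apply/seteqP; split => x /=.
  move=> [z [J [Dz iJ]]]; rewrite paravector_meridian => E.
  have [_ []] := slice_coord_inj (imag_unit_vpart x) iJ E; rewrite /axial /= => zE.
    by rewrite -zE.
  by have := cD _ Dz; rewrite zE /cconj /= opprK.
move=> Dx; exists (meridian x), (unit_vpart x).
by split => //; [exact: imag_unit_vpart|exact: paravector_meridian].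
Qed.

(** The slice plane spanned by 1 and [e1], as a plane in R^4; functions of the
  meridian point alone are recovered from their restriction to it. *)
Definition embed_plane z : V4 := z.1 *: delta_mx 0 0 + z.2 *: delta_mx 0 (lift ord0 ord0).

Lemma embed_plane_linear (t : R) v z : embed_plane (t *: v + z) = t *: embed_plane v + embed_plane z.
Proof.
by rewrite /embed_plane /= scalerDr !scalerDl !scalerA -!addrA; congr (_ + _); rewrite addrCA.
Qed.

Lemma embed_plane_0 z : embed_plane z 0 0 = z.1.
Proof. by rewrite !mxE /= mulr1 mulr0 addr0. Qed.

Lemma vcoord_embed_plane z i : vcoord (embed_plane z) i = z.2 * (i == ord0)%:R.
Proof. by rewrite /vcoord !mxE /= mulr0 add0r (inj_eq lift_inj). Qed.

Lemma vdot_embed_plane z x : vdot (embed_plane z) x = z.2 * vcoord x ord0.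
Proof.
rewrite /vdot (bigD1 ord0)//= vcoord_embed_plane eqxx mulr1 big1 ?addr0// => i /negbTE i0.
by rewrite vcoord_embed_plane i0 mulr0 mul0r.
Qed.

Lemma vpart_embed_plane z : vpart (embed_plane z) = z.2 *: gen ord0.
Proof.
rewrite /vpart (bigD1 ord0)//= vcoord_embed_plane eqxx mulr1 big1 ?addr0// => i /negbTE i0.
by rewrite vcoord_embed_plane i0 mulr0 scale0r.
Qed.

Lemma paravector_embed_plane z : paravector (embed_plane z) = z.1%:A + z.2 *: gen ord0.
Proof. by rewrite /paravector embed_plane_0 -vpart_embed_plane. Qed.

Lemma vnorm_embed_plane z : vnorm (embed_plane z) = `|z.2|.
Proof. by rewrite /vnorm vdot_embed_plane vcoord_embed_plane eqxx mulr1 -expr2 sqrtr_sqr. Qed.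

Lemma meridian_embed_plane z : meridian (embed_plane z) = (z.1, `|z.2|).
Proof. by rewrite /meridian embed_plane_0 vnorm_embed_plane. Qed.

Lemma embed_plane_continuous : continuous embed_plane.
Proof.
move=> z; apply: cvgD; apply: cvgZ; try exact: cvg_cst.
  exact: cvg_fst.
exact: cvg_snd.
Qed.

Lemma axial_embed_plane (D : set (R * R)) z : conj_invariant D -> axial D (embed_plane z) <-> D z.
Proof.
move=> cD; rewrite /axial /= meridian_embed_plane; case: z => a b /=.
case: (ger0P b) => // _; split => [/cD|/cD]; rewrite /cconj /= ?opprK//.
Qed.

Lemma open_of_axial (D : set (R * R)) : conj_invariant D -> open (axial D) -> open D.
Proof.
move=> cD oA; rewrite (_ : D = embed_plane @^-1` axial D).
  by apply: open_comp => // z _; exact: embed_plane_continuous.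
by apply/seteqP; split => z /(axial_embed_plane z cD).
Qed.

End ImaginaryUnits.

(** * Functions on a slice plane *)

Section PlaneFunctions.
Variable R : realType.

Lemma is_derive_pair (V W1 W2 : normedModType R) (f : V -> W1) (g : V -> W2) x v df dg :
  is_derive x v f df -> is_derive x v g dg ->
  is_derive x v (fun y => (f y, g y)) (df, dg).
Proof.
move=> /is_derive_lineP [Df Ef] /is_derive_lineP [Dg Eg]; apply/is_derive_lineP.
move/derivable1_diffP in Df; move/derivable1_diffP in Dg.
apply: DeriveDef; first exact/derivable1_diffP/differentiable_pair.
rewrite deriveE; last exact: differentiable_pair.
by rewrite diff_pair// -!deriveE// Ef Eg.
Qed.

Lemma smooth_pair0 (V W1 W2 : normedModType R) k (S : set V) (g : V -> W1) : open S ->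
  smooth k S g -> smooth k S (fun y => (g y, 0 : W2)).
Proof.
move=> oS; elim: k g => [|k IH] g sg.
  by split => // x Sx; exact: (cvg_pairP (smooth_continuous sg Sx) (cvg_cst 0)).
apply: smooth_derive => [//|x Sx|v].
  exact: (cvg_pairP (smooth_continuous sg Sx) (cvg_cst 0)).
exists (fun x => ('D_v g x, 0)); last exact: (IH _ (smooth_D v sg)).
by move=> x Sx; exact: (is_derive_pair (smooth_is_derive v sg Sx) (is_derive_cst 0 x v)).
Qed.

Lemma is_derive_embed_plane (W : normedModType R) (g : 'rV[R]_4 -> W) z v dg :
  is_derive (embed_plane z) (embed_plane v) g dg -> is_derive z v (fun y => g (embed_plane y)) dg.
Proof.
move=> /is_derive_lineP H; apply/is_derive_lineP.
by rewrite (_ : (fun t => _) = (fun t : R => g (t *: embed_plane v + embed_plane z)))//;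
  apply/funext => t; rewrite embed_plane_linear.
Qed.

Lemma smooth_embed_plane (W : normedModType R) k (S : set 'rV[R]_4) (g : 'rV[R]_4 -> W) : open S ->
  smooth k S g -> smooth k (@embed_plane R @^-1` S) (fun z => g (embed_plane z)).
Proof.
move=> oS; have oS' : open (@embed_plane R @^-1` S).
  by apply: open_comp => // z _; exact: embed_plane_continuous.
have cc h z : {for embed_plane z, continuous h} -> {for z, continuous (fun y => h (@embed_plane R y) : W)}.
  by move=> ch; exact: (continuous_comp (@embed_plane_continuous R z) ch).
elim: k g => [|k IH] g sg.
  by split => // z Sz; apply: cc; exact: (smooth_continuous sg).
apply: smooth_derive => [//|z Sz|v].
  by apply: cc; exact: (smooth_continuous sg).
exists (fun z => 'D_(embed_plane v) g (embed_plane z)); last exact: (IH _ (smooth_D (embed_plane v) sg)).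
by move=> z Sz; apply: is_derive_embed_plane; exact: smooth_is_derive sg Sz.
Qed.

Lemma is_derive_even (m n : nat) (g : R * R -> 'M[R]_(m, n)) (z : R * R) (dg : 'M[R]_(m, n)) :
  (forall w, g (cconj w) = g w) -> is_derive z (0, 1) g dg ->
  is_derive (cconj z) (0, 1) g (- dg).
Proof.
move=> ge dgz; apply: is_derive_mx => i j.
have {dgz} : is_derive z (0, 1) (fun w => g w i j) (dg i j).
  by case: dgz => D E; apply: DeriveDef; [move/derivable_mxP: D|rewrite -E derive_mx// mxE].
move=> /is_derive_lineP H; apply/is_derive_lineP; rewrite mxE.
have N : is_derive (0 : R) 1 (fun t : R => - t) (- 1) by exact: is_deriveNid.
have {}H : is_derive (- (0 : R)) 1 (fun t : R => g (t *: (0, 1) + z) i j) (dg i j).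
  by rewrite oppr0.
have := is_derive_comp1 H N; rewrite mulrN1.
congr is_derive; apply/funext => t /=.
rewrite -[in RHS]ge; congr (g _ i j); case: z {H} => p q.
rewrite [LHS]surjective_pairing /cconj /= !scaler0; congr (_, _).
by rewrite opprD opprK scaleNr.
Qed.

End PlaneFunctions.

Section StemFunctions.
Variable R : realType.
Local Notation cl3 := (clifford3 R).
Variable D : set (R * R).

(** The stem condition is exactly the compatibility of the values prescribed at
  a point of the cone by its two representations. *)
Lemma stem_induces (H : R * R -> cl3 * cl3) : stem D H -> exists h, induces D H h.
Proof.
move=> st.
have pick (y : cl3) : exists v : cl3, forall z J, D z -> imag_units J ->
    y = z.1%:A + z.2 *: J -> v = (H z).1 + J * (H z).2.
  have [[z [J [Dz iJ ->]]]|no] := pselect (circularization D y); last first.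
    by exists 0 => z J Dz iJ yE; case: no; exists z, J.
  exists ((H z).1 + J * (H z).2) => z' J' Dz' iJ' E.
  have [E2 E1] := slice_coord_inj iJ iJ' E.
  have [z0|z0] := eqVneq z.2 0.
    have zz : cconj z = z by case: (z) z0 => a b /= ->; rewrite /cconj /= oppr0.
    have -> : z' = z by case: E1 => //; rewrite zz.
    have H2 : (H z).2 = 0.
      have := st z Dz; rewrite zz => /(congr1 snd) /= /eqP.
      rewrite -subr_eq0 opprK -mulr2n -scaler_nat scaler_eq0 pnatr_eq0 /=.
      by move=> /eqP.
    by rewrite H2 !mulr0.
  case: E1 => zE; rewrite zE in E2 *.
    by rewrite (scalerI z0 E2).
  rewrite (st z Dz) /= mulrN -mulNr; congr (_ + _ * _).
  by apply: (scalerI z0); rewrite E2 /= scaleNr scalerN.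
have [h Hh] := choice pick.
by exists h => z J Dz iJ; exact: Hh.
Qed.

(** The values at [J] and [- J] determine both components. *)
Lemma induces_inj (G G' : R * R -> cl3 * cl3) f z :
  induces D G f -> induces D G' f -> D z -> G z = G' z.
Proof.
move=> iG iG' Dz; pose J := cl_gen R 0; have iJ : imag_units J := imag_gen R 0.
have := iG z J Dz iJ; rewrite (iG' z J Dz iJ) => E1.
have := iG z _ Dz (imagN iJ); rewrite (iG' z _ Dz (imagN iJ)) => E2.
have E3 : (G z).1 = (G' z).1.
  apply: (@scalerI _ _ (2 : R)); first by rewrite pnatr_eq0.
  have H (a b : cl3) : 2 *: a = (a + J * b) + (a + - J * b).
    by rewrite mulNr addrACA subrr addr0 scaler_nat.
  by rewrite (H _ (G z).2) (H (G' z).1 (G' z).2) E1 E2.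
move: E1; rewrite E3 => /addrI /(congr1 ( *%R J)).
rewrite !mulrA (imag_sqr iJ) !mulN1r => /oppr_inj E4.
by case: (G z) (G' z) E3 E4 => a b [a' b'] /= -> ->.
Qed.

End StemFunctions.

(** * The spherical derivative *)

Section SliceRegular.
Variable R : realType.
Local Notation cl3 := (clifford3 R).
Local Notation V4 := 'rV[R]_4.
Local Notation e1 := (cl_gen R 0).

(** Complex linearity of the differential, read in each of the eight real
  coordinates. *)
Lemma holomorphic_CR (D : set (R * R)) (F : R * R -> cl3 * cl3) (A : 'I_8) :
  holomorphic D F -> CR D (fun z => (F z).1 0 A) (fun z => (F z).2 0 A)
    (fun z => ('d F z (1, 0)).1 0 A) (fun z => ('d F z (1, 0)).2 0 A).
Proof.
move=> hol z Dz; have [dF dFi] := hol z Dz.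
have norm1 (w : cl3 * cl3) : `|w.1 0 A| <= `|w|.
  rewrite prod_normE /= le_max; apply/orP; left.
  rewrite [leRHS]/Num.Def.normr /= mx_normrE.
  exact: (le_bigmax _ (fun i => `|w.1 i.1 i.2|) (0, A)).
have norm2 (w : cl3 * cl3) : `|w.2 0 A| <= `|w|.
  rewrite prod_normE /= le_max; apply/orP; right.
  rewrite [leRHS]/Num.Def.normr /= mx_normrE.
  exact: (le_bigmax _ (fun i => `|w.2 i.1 i.2|) (0, A)).
have near_dF e : 0 < e -> \forall h \near (0 : R * R),
    `|F (h + z) - F z - 'd F z h| <= e * `|h|.
  move=> e0; have /eqaddoP/(_ e e0) := diff_locally dF.
  by apply: filterS => h /=; rewrite !fctE /= opprD addrA.
have dFE h : 'd F z h = h.1 *: 'd F z (1, 0) + h.2 *: imul ('d F z (1, 0)).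
  rewrite -dFi -!linearZ -linearD; congr ('d F z _).
  by case: h => a b; rewrite /imul /= [RHS]surjective_pairing /= oppr0 !scaler0 addr0 add0r /GRing.scale /= !mulr1.
split; apply/pdiffP => e e0; have := near_dF e e0; apply: filterS => h /(le_trans _); apply.
  apply: le_trans (norm1 _); rewrite (dFE h) /plin /= !mxE.
  by rewrite le_eqVlt; apply/orP; left; apply/eqP; congr `|_|; ring.
apply: le_trans (norm2 _); rewrite (dFE h) /plin /= !mxE.
by rewrite le_eqVlt; apply/orP; left; apply/eqP; congr `|_|; ring.
Qed.

Variables (D : set (R * R)) (U V : 'I_8 -> nat -> R * R -> R).
Hypothesis openD : open D.
Hypothesis symD : conj_invariant D.
Hypothesis crUV : forall A n, CR D (U A n) (V A n) (U A n.+1) (V A n.+1).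
Hypothesis stemUV : forall A n, stem_pair D (U A n) (V A n).

Variable f : cl3 -> cl3.
Let Fre (z : R * R) : cl3 := \row_A U A 0%N z.
Let Fim (z : R * R) : cl3 := \row_A V A 0%N z.
Hypothesis induced_f : forall z J, D z -> imag_units J ->
  f (z.1%:A + z.2 *: J) = Fre z + J * Fim z.

Local Notation Omega := (axial D).
Local Notation S := (off_axis D).
Local Notation P := (parP U).
Local Notation Q := (parQ U V).
Local Notation Z := (parZ U V).
Let openOmega : open Omega := open_axial openD.

(** The spherical derivative as a function of the complex coordinate: it is
  [F2 / b], already continued to the axis. *)
Definition stemQ (z : R * R) : cl3 := Q 0%N (embed_plane z).

Lemma Fim_real z : D z -> z.2 = 0 -> Fim z = 0.
Proof.
move=> Dz z0; apply/rowP => A; rewrite !mxE.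
have zz : cconj z = z by case: (z) z0 => a b /= ->; rewrite /cconj /= oppr0.
have [_] := stemUV A 0 Dz; rewrite zz => /eqP.
by rewrite -subr_eq0 opprK -mulr2n mulrn_eq0 /= => /eqP.
Qed.

Lemma Fim_stemQ z : D z -> Fim z = z.2 *: stemQ z.
Proof.
move=> Dz; have [z0|z0] := eqVneq z.2 0; first by rewrite Fim_real// z0 scale0r.
apply/rowP => A; rewrite !mxE /axQ meridian_embed_plane /sphere_quot /= normr_eq0 (negbTE z0).
have [zp|zn] := ger0P z.2.
  have -> : (z.1, z.2) = z by case: (z).
  by rewrite mulrCA divff// mulr1.
have [_] := stemUV A 0 Dz; rewrite /cconj => ->.
by rewrite invrN mulrNN mulrCA divff// mulr1.
Qed.

Lemma slice4E x : Omega x -> f (paravector x) = slice4 U V x.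
Proof.
move=> Ox; rewrite paravector_meridian induced_f//; last exact: imag_unit_vpart.
rewrite /slice4; congr (_ + _); rewrite /unit_vpart; case: eqVneq => [x0|x0].
  rewrite Fim_real// mulr0; have -> : vpart x = 0.
    by rewrite vpart_unit_vpart x0 scale0r.
  by rewrite mul0r.
rewrite -scalerAl scalerAr; congr (_ * _); apply/rowP => A.
by rewrite !mxE /axQ /sphere_quot /= (negbTE x0) mulrC.
Qed.

Lemma cl_im_slice (z : R * R) (J : cl3) : imag_units J -> cl_im (z.1%:A + z.2 *: J) = z.2 *: J.
Proof.
move=> iJ; rewrite /cl_im cl_conjD cl_conj_alg cl_conjZ (imag_conj iJ) scalerN.
by apply/rowP => A; rewrite !mxE; field.
Qed.

Lemma invr_imag (a : R) (J : cl3) : a != 0 -> imag_units J -> (a *: J)^-1 = - (a^-1 *: J).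
Proof.
move=> a0 iJ; have JJ := imag_sqr iJ.
have E1 : - (a^-1 *: J) * (a *: J) = 1.
  by rewrite mulNr -scalerAl -scalerAr scalerA mulVf// scale1r JJ opprK.
have E2 : (a *: J) * - (a^-1 *: J) = 1.
  by rewrite mulrN -scalerAl -scalerAr scalerA divff// scale1r JJ opprK.
have uJ : a *: J \is a GRing.unit by apply/unitrP; exists (- (a^-1 *: J)).
by apply: (mulrI uJ); rewrite mulrV// E2.
Qed.

Lemma spherical_quotient_slice z J : D z -> imag_units J -> z.2 != 0 ->
  spherical_quotient f (z.1%:A + z.2 *: J) = stemQ z.
Proof.
move=> Dz iJ z0; rewrite /spherical_quotient cl_im_slice// invr_imag//.
have -> : cl_conj (z.1%:A + z.2 *: J) = z.1%:A + z.2 *: - J.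
  by rewrite cl_conjD cl_conj_alg cl_conjZ (imag_conj iJ).
rewrite induced_f// induced_f//; last exact: imagN.
have -> : Fre z + J * Fim z - (Fre z + - J * Fim z) = 2 *: (J * Fim z).
  by rewrite mulNr opprD addrACA subrr add0r opprK scaler_nat mulr2n.
rewrite Fim_stemQ// mulNr -!scalerAl -!scalerAr mulrA (imag_sqr iJ) mulN1r.
rewrite !scalerN opprK !scalerA (_ : _ * _ = 1) ?scale1r//.
by field.
Qed.

Lemma slice_not_real z J : imag_units J -> z.2 != 0 ->
  ~ @cl_real R (z.1%:A + z.2 *: J).
Proof.
move=> iJ z0 [a _ /(congr1 (@cl_im R))]; rewrite cl_im_slice//.
rewrite /cl_im cl_conj_alg subrr scaler0 => /esym/eqP.
rewrite scaler_eq0 (negbTE z0) /= => /eqP J0.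
have := imag_sqr iJ; rewrite J0 mul0r => /esym/eqP.
by rewrite oppr_eq0 oner_eq0.
Qed.

(** On the quadratic cone this is the modulus of the imaginary part. *)
Let imdist (y : cl3) : R := Num.sqrt (\sum_A y 0 A ^+ 2 - y 0 0 ^+ 2).

Let imdist_slice z J : imag_units J -> imdist (z.1%:A + z.2 *: J) = `|z.2|.
Proof.
move=> iJ; rewrite /imdist -sqrtr_sqr; congr Num.sqrt.
rewrite -cl_mul_conj0 cl_conjD cl_conj_alg cl_conjZ (imag_conj iJ) scalerN.
rewrite mulrBr !mulrDl !mulr_algl mulr_algr sqr_scale_imag// addrKA.
by rewrite !mxE /= imag_scalar//; ring.
Qed.

Lemma stemQ_even z z' : z.1 = z'.1 -> `|z.2| = `|z'.2| -> stemQ z = stemQ z'.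
Proof.
by move=> E1 E2; apply/rowP => A; rewrite !mxE /axQ !meridian_embed_plane E1 E2.
Qed.

Lemma smooth_stemQ k : smooth k D stemQ.
Proof.
have := smooth_embed_plane openOmega (smooth_parQ openD crUV stemUV k 0).
rewrite (_ : _ @^-1` _ = D)//.
by apply/seteqP; split => z /(axial_embed_plane z symD).
Qed.

(** On the cone without the reals the spherical quotient coincides with
  [stemQ] of the point [(y 0 0, imdist y)], which depends continuously on [y];
  the limit at a real point is therefore the value of [stemQ] there. *)
Lemma spherical_derivative_slice z J : D z -> imag_units J ->
  spherical_derivative D f (z.1%:A + z.2 *: J) = stemQ z.
Proof.
move=> Dz iJ; rewrite /spherical_derivative; have [z0|z0] := eqVneq z.2 0; last first.
  rewrite ifF; first exact: spherical_quotient_slice.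
  by apply/negP => /set_mem; exact: slice_not_real.
rewrite z0 scale0r addr0 ifT; last by rewrite inE; exists z.1.
set y0 : cl3 := z.1%:A; set T := _ `\` _.
have y0E : y0 = z.1%:A + z.2 *: J by rewrite z0 scale0r addr0.
pose phi (y : cl3) := stemQ (y 0 0, imdist y).
have phiE w I : imag_units I -> phi (w.1%:A + w.2 *: I) = stemQ w.
  move=> iI; apply: stemQ_even; last by rewrite /= imdist_slice// normr_id.
  by rewrite /= mxE scalar_alg mxE imag_scalar// mulr0 addr0.
have E y : T y -> phi y = spherical_quotient f y.
  move=> [[w [I [Dw iI ->]]] nr]; rewrite phiE// spherical_quotient_slice//.
  by apply/eqP => w0; apply: nr; rewrite w0 scale0r addr0; exists w.1.
have cphi : {for y0, continuous phi}.
  have cA A : continuous (fun y : cl3 => y 0 A) by move=> y; exact: coord_continuous.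
  have cim : {for y0, continuous imdist}.
    apply: (@continuous_comp _ _ _ (fun y : cl3 => \sum_A y 0 A ^+ 2 - y 0 0 ^+ 2) Num.sqrt).
      have sA A : smooth 0 setT (fun y : cl3 => y 0 A ^+ 2).
        exact: (smoothM openT (smooth_coord 0 0 A openT) (smooth_coord 0 0 A openT)).
      apply: (@smooth_continuous _ _ _ 0 setT _ y0) I.
      exact: (smoothD openT (smooth_sum openT sA) (smoothN openT (sA 0))).
    exact: sqrt_continuous.
  apply: (@continuous_comp _ _ _ (fun y : cl3 => (y 0 0, imdist y)) stemQ).
    exact: (cvg_pairP (cA 0 y0) cim).
  apply: (smooth_continuous (smooth_stemQ 0)).
  by rewrite y0E imdist_slice// mxE scalar_alg mxE imag_scalar// mulr0 addr0 z0 normr0 -z0; case: (z) Dz.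
(* Real points are limits of non-real points of the cone, along J. *)
have pT : ProperFilter (within T (nbhs y0)).
  apply: within_nbhs_proper => B nB.
  have cl : (fun t : R => z.1%:A + t *: J) @ (0 : R) --> y0.
    have : (fun t : R => z.1%:A + t *: J) @ (0 : R) --> z.1%:A + 0 *: J.
      by apply: cvgD; [exact: cvg_cst|apply: cvgZr_tmp; exact: cvg_id].
    by rewrite scale0r addr0.
  have cD : (fun t : R => (z.1, t)) @ (0 : R) --> z.
    have : (fun t : R => (z.1, t)) @ (0 : R) --> (z.1, 0 : R).
      by apply: cvg_pairP; [exact: cvg_cst|exact: cvg_id].
    by rewrite -[X in (_, X)]z0 -surjective_pairing.
  have nD : \forall t \near (0 : R)^', B (z.1%:A + t *: J) /\ D (z.1, t).
    apply: nbhs_dnbhs; apply: filterI; first exact: cl.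
    by apply: cD; exact: open_nbhs_nbhs.
  have [t [[Bt Dt] t0]] := filter_ex (filterI nD (@nbhs_dnbhs_neq _ (0 : R))).
  exists (z.1%:A + t *: J); split => //; split.
    by exists (z.1, t), J.
  exact: (@slice_not_real (z.1, t)).
rewrite -(phiE z J iJ) -y0E; apply: cvg_lim; first exact: norm_hausdorff.
have c : phi @ within T (nbhs y0) --> phi y0.
  exact: (cvg_trans (cvg_app _ (@cvg_within _ _ _ _)) cphi).
apply: cvg_trans c; apply: near_eq_cvg; rewrite near_withinE.
by apply: nearW => y Ty; exact: E.
Qed.
End SliceRegular.

(** * The slice derivative of the spherical derivative *)

Section SliceDerivative.
Variable R : realType.
Local Notation cl3 := (clifford3 R).
Local Notation V4 := 'rV[R]_4.
Local Notation e1 := (cl_gen R ord0).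

Variables (D : set (R * R)) (U V : 'I_8 -> nat -> R * R -> R).
Hypothesis openD : open D.
Hypothesis symD : conj_invariant D.
Hypothesis crUV : forall A n, CR D (U A n) (V A n) (U A n.+1) (V A n.+1).
Hypothesis stemUV : forall A n, stem_pair D (U A n) (V A n).

Local Notation Omega := (axial D).
Local Notation S := (off_axis D).
Let openOmega : open Omega := open_axial openD.
Local Notation q := (stemQ U V).
Let G (z : R * R) : cl3 * cl3 := (q z, 0).
Let smooth_q k : smooth k D q := smooth_stemQ openD symD crUV stemUV k.

Lemma stem_dz_stemQ z : D z ->
  stem_dz G z = (2^-1 *: 'D_(1, 0) q z, - (2^-1 *: 'D_(0, 1) q z)).
Proof.
move=> Dz; rewrite /stem_dz.
have E v : 'D_v G z = ('D_v q z, 0).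
  by have [_ ->] := is_derive_pair (smooth_is_derive v (smooth_q 1) Dz) (is_derive_cst (0 : cl3) z v).
rewrite !E /imul /= oppr0; rewrite [LHS]surjective_pairing /=; congr (_, _).
  by rewrite oppr0 addr0.
by rewrite add0r scalerN.
Qed.

Lemma stem_stemQ : stem D G.
Proof.
move=> z Dz; rewrite /G [RHS]/cconj /= oppr0; congr (_, _).
by apply: stemQ_even; rewrite //= normrN.
Qed.

(** [q] is even in [b], so [d/da q] is even and [d/db q] is odd. *)
Lemma stem_stem_dz : stem D (stem_dz G).
Proof.
move=> z Dz; rewrite !stem_dz_stemQ//; last exact: symD.
have d v := smooth_is_derive v (smooth_q 1) Dz.
have -> : 'D_(1, 0) q (cconj z) = 'D_(1, 0) q z.
  have /is_derive_lineP H := d (1, 0).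
  have {}H : is_derive (cconj z) (1, 0) q ('D_(1, 0) q z).
    apply/is_derive_lineP; move: H; congr is_derive; apply/funext => t.
    by apply: stemQ_even => //=; rewrite scaler0 !add0r normrN.
  by have [_ ->] := H.
have -> : 'D_(0, 1) q (cconj z) = - 'D_(0, 1) q z.
  have even w : q (cconj w) = q w by apply: stemQ_even; rewrite //= normrN.
  by have [_ ->] := is_derive_even even (d (0, 1)).
by rewrite /cconj /= scalerN.
Qed.

Variable fs : cl3 -> cl3.
Hypothesis fsE : forall z J, D z -> imag_units J -> fs (z.1%:A + z.2 *: J) = q z.

Let induces_fs : induces D G fs.
Proof. by move=> z J Dz iJ; rewrite fsE// mulr0 addr0. Qed.

Lemma exists_slice_derivative : exists h, is_slice_derivative D fs h.
Proof.
have [h Hh] := stem_induces stem_stem_dz.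
exists h, G; split => //; first exact: stem_stemQ.
exact: (smooth_class_C (smooth_pair0 _ openD (smooth_q 1))).
Qed.

Variable h : cl3 -> cl3.
Hypothesis dfs : is_slice_derivative D fs h.

(** The stem function of a slice function is unique on [D], which is open;
  hence so are its derivatives, and the slice derivative can be computed from
  [q]. *)
Lemma slice_derivativeE z J : D z -> imag_units J ->
  h (z.1%:A + z.2 *: J) = 2^-1 *: ('D_(1, 0) q z - J * 'D_(0, 1) q z).
Proof.
case: dfs => G' [_ _ iG' ih] Dz iJ; rewrite ih//.
have E w : D w -> G' w = G w by move=> Dw; exact: (induces_inj iG' induces_fs Dw).
have -> : stem_dz G' z = stem_dz G z.
  by rewrite /stem_dz !(derive_eq_open _ openD E Dz).
by rewrite stem_dz_stemQ//= mulrN -scalerAr scalerBr.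
Qed.

(** With [d/da Q0 = Q1] and [d/db Q0 = b Z0], this is the formula
  [laplacian f = - 2 Q1 + 2 vpart * Z0]. *)
Lemma laplacian_slice4_off_axis x : S x ->
  laplacian (slice4 U V) x = - 4 *: h (paravector x).
Proof.
move=> Sx; have [Ox x0] := Sx.
have mm : meridian (embed_plane (meridian x)) = meridian x.
  by rewrite meridian_embed_plane /= ger0_norm// vnorm_ge0.
have Sm : S (embed_plane (meridian x)).
  by split; [rewrite /axial /= mm|move: x0; rewrite vnorm_embed_plane normr_eq0].
have d v : 'D_v q (meridian x) =
    v.1 *: parQ U V 1 x + (v.2 * vnorm x) *: parZ U V 0 x.
  have J := jet_parQ crUV 0 (embed_plane v) Sm.
  have [_ ->] := is_derive_embed_plane J.
  rewrite embed_plane_0 vdot_embed_plane vcoord_embed_plane eqxx mulr1; congr (_ *: _ + _ *: _).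
    by apply/rowP => A; rewrite !mxE /axQ mm.
  apply/rowP => A; rewrite !mxE /axQ /axP mm.
  by rewrite vdot_embed_plane vcoord_embed_plane eqxx mulr1 -expr2 vnorm_sqr.
rewrite paravector_meridian slice_derivativeE//; last exact: imag_unit_vpart.
rewrite !d /= (laplacian_slice4 openD crUV stemUV Sx) vpart_unit_vpart.
rewrite !scale1r !mul0r !scale0r addr0 add0r mul1r -scalerAl -!scalerAr.
by move: (vnorm x *: _) (parQ U V 1 x) => t p; apply/rowP => A; rewrite !mxE; field.
Qed.

(** At a point of the axis, both sides are compared on the slice plane of [e1],
  where the right-hand side is continuous by the formula for the slice
  derivative. *)
Lemma laplacian_slice4_slice_derivative x : Omega x ->
  laplacian (slice4 U V) x = - 4 *: h (paravector x).
Proof.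
move=> Ox; have [x0|x0] := eqVneq (vnorm x) 0; last exact: laplacian_slice4_off_axis.
pose z := meridian x.
have xE : x = embed_plane z.
  apply/rowP => i; rewrite /embed_plane /= x0 scale0r addr0 !mxE /=.
  case: (unliftP ord0 i) => [j ->|->]; last by rewrite mulr1.
  by rewrite mulr0; exact: (vnorm_eq0 x0 j).
have Dz : D z by [].
pose g w := - 2 *: 'D_(1, 0) q w + 2 *: (e1 * 'D_(0, 1) q w).
have gE w : D w -> - 4 *: h (paravector (embed_plane w)) = g w.
  move=> Dw; rewrite paravector_embed_plane slice_derivativeE//; last exact: imag_gen.
  by rewrite /g; set t := e1 * _; apply/rowP => A; rewrite !mxE; field.
rewrite xE gE//.
have sL := smooth_embed_plane openOmega (smooth_laplacian openOmega (smooth_slice4 openD crUV stemUV 2)).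
apply: (@eq_at_limit _ _ _ (fun w => laplacian (slice4 U V) (embed_plane w)) g z (0, 1)).
- by apply: (smooth_continuous sL); rewrite /= -xE.
- apply: smooth_continuous Dz; apply: (smoothD openD (smoothZ _ openD (smooth_D _ (smooth_q 1)))).
  exact: (smoothZ _ openD (smooth_clmul _ openD (smooth_D _ (smooth_q 1)))).
have cD : (fun t : R => t *: (0 : R, 1 : R) + z) @ (0 : R) --> z.
  have : (fun t : R => t *: (0 : R, 1 : R) + z) @ (0 : R) --> 0 *: (0 : R, 1 : R) + z.
    by apply: cvgD; [apply: cvgZr_tmp; exact: cvg_id|exact: cvg_cst].
  by rewrite scale0r add0r.
have nD : \forall t \near (0 : R)^', D (t *: (0 : R, 1 : R) + z).
  by apply: nbhs_dnbhs; apply: cD; exact: open_nbhs_nbhs.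
apply: filterS (filterI nD (@nbhs_dnbhs_neq _ (0 : R))) => t [Dt t0].
rewrite -gE//; apply: laplacian_slice4_off_axis; split.
  by apply/(axial_embed_plane _ symD).
by rewrite vnorm_embed_plane /= x0 addr0 normr_eq0 [_ *: _]mulr1.
Qed.

End SliceDerivative.

(** * Harmonicity of the spherical derivative *)

Lemma cl_harmonic_smooth (R : realType) (S : set 'rV[R]_4) (g : 'rV[R]_4 -> clifford3 R) :
  open S -> smooth 2 S g -> (forall x, S x -> laplacian g x = 0) -> cl_harmonic S g.
Proof.
move=> oS sg g0 A; split; first exact: (smooth_class_C (smooth_coord_mx 0 A oS sg)).
by move=> x Sx; rewrite (laplacian_coord 0 A oS sg Sx) g0// mxE.
Qed.

Theorem corollary4p2 (R : realType) (D : set (R * R))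
    (f : clifford3 R -> clifford3 R) (Omega : set 'rV[R]_4)
    (hD : conj_invariant D)
    (hOmega : Omega = (@paravector R) @^-1` circularization D)
    (openOmega : open Omega)
    (hf : slice_regular D f) :
  let f4 : 'rV[R]_4 -> clifford3 R := f \o @paravector R in
  let fs : clifford3 R -> clifford3 R := spherical_derivative D f in
  let fs4 : 'rV[R]_4 -> clifford3 R := fs \o @paravector R in
  [/\ (* (a) *)
      cl_harmonic Omega fs4,
      (* (b) *)
      forall x, Omega x ->
        [/\ dbar (laplacian f4) x = laplacian (dbar f4) x,
            laplacian (dbar f4) x = - 2 *: laplacian fs4 x
          & - 2 *: laplacian fs4 x = 0],
      (* (c) *)
      cl_biharmonic Omega f4
    & (* (d) *)
      (exists h, is_slice_derivative D fs h) /\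
      forall h : clifford3 R -> clifford3 R, is_slice_derivative D fs h ->
        (forall x, Omega x -> laplacian f4 x = - 4 *: h (paravector x)) /\
        cl_harmonic Omega (h \o @paravector R)].
Proof.
move=> f4 fs fs4.
have OE : Omega = axial D by rewrite hOmega circularization_axial.
move: hOmega => _; subst Omega.
have openD : open D by exact: open_of_axial openOmega.
have [F [stF holF indF]] := hf.
(* Towers of derivatives of the eight coordinates of the stem function. *)
have /choice[U /choice[V UV]] A : exists U V : nat -> R * R -> R,
    [/\ U 0%N = (fun z => (F z).1 0 A), V 0%N = (fun z => (F z).2 0 A),
     forall n, CR D (U n) (V n) (U n.+1) (V n.+1)
     & forall n, stem_pair D (U n) (V n)].
  have := CR_iterated_derivatives openD hD (holomorphic_CR A holF) _; apply.
  by move=> z Dz; rewrite stF//= mxE.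
have crUV A := let: And4 _ _ H _ := UV A in H.
have stUV A := let: And4 _ _ _ H := UV A in H.
have induced_f z J : D z -> imag_units J ->
    f (z.1%:A + z.2 *: J) = (\row_A U A 0%N z) + J * (\row_A V A 0%N z).
  move=> Dz iJ; rewrite indF//; congr (_ + _ * _); apply/rowP => A; rewrite mxE.
    by have [-> _ _ _] := UV A.
  by have [_ -> _ _] := UV A.
have fsE z J : D z -> imag_units J -> fs (z.1%:A + z.2 *: J) = stemQ U V z.
  exact: (spherical_derivative_slice openD hD crUV stUV induced_f).
have f4E x : axial D x -> slice4 U V x = f4 x.
  by move=> Ox; rewrite /f4 /= (slice4E stUV induced_f).
have fs4E x : axial D x -> parQ U V 0 x = fs4 x.
  move=> Ox; rewrite /fs4 /= paravector_meridian fsE//; last exact: imag_unit_vpart.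
  by apply/rowP => A; rewrite !mxE /axQ meridian_embed_plane /= ger0_norm// vnorm_ge0.
have sf k := smooth_slice4 openD crUV stUV k.
have sq k := smooth_parQ openD crUV stUV k 0.
have lf x : axial D x -> laplacian (slice4 U V) x = laplacian f4 x.
  exact: laplacian_eq openOmega f4E.
have lfs x : axial D x -> laplacian fs4 x = 0.
  by move=> Ox; rewrite -(laplacian_eq openOmega fs4E Ox) (laplacian_parQ openD crUV stUV).
have ldf x : axial D x -> laplacian (dbar f4) x = - 2 *: laplacian fs4 x.
  move=> Ox.
  rewrite -(laplacian_eq openOmega fs4E Ox) -(laplacianZ _ openOmega (sq 2) Ox).
  apply: (laplacian_eq openOmega _ Ox) => y Oy.
  by rewrite -(dbar_eq openOmega f4E Oy) (dbar_slice4 openD crUV stUV Oy).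
split.
- exact: (cl_harmonic_smooth openOmega (smooth_eq openOmega fs4E (sq 2)) lfs).
- move=> x Ox; rewrite ldf// lfs// scaler0; split => //.
  by rewrite -(dbar_eq openOmega lf Ox) (dbar_laplacian_slice4 openD crUV stUV Ox).
- split; first exact: smooth_class_C (smooth_eq openOmega f4E (sf 4)).
  move=> x Ox.
  by rewrite -(laplacian_eq openOmega lf Ox) (bilaplacian_slice4 openD crUV stUV Ox).
split; first exact: (exists_slice_derivative openD hD crUV stUV fsE).
move=> h hh; have lh x : axial D x -> laplacian f4 x = - 4 *: h (paravector x).
  by move=> Ox; rewrite -lf// (laplacian_slice4_slice_derivative openD hD crUV stUV fsE hh).
split => //.
have hE x : axial D x -> - 4^-1 *: laplacian (slice4 U V) x = (h \o @paravector R) x.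
  move=> Ox; rewrite lf// lh// scalerA (_ : _ * _ = 1) ?scale1r//.
  by field.
have sh := smooth_laplacian openOmega (sf 4).
apply: (cl_harmonic_smooth openOmega (smooth_eq openOmega hE (smoothZ _ openOmega sh))) => x Ox.
rewrite -(laplacian_eq openOmega hE Ox) (laplacianZ _ openOmega sh Ox).
by rewrite (bilaplacian_slice4 openD crUV stUV Ox) scaler0.
Qed.
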